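(* Let $\Gamma$ be a cubulated, $\delta$-hyperbolic group. Then every finite order element $\phi\in\mathrm{Out}(\Gamma)$ can be realized as an automorphism of an NPC cube complex $Y$ with $\pi_1(Y)\cong\Gamma$; that is, there are such a $Y$ and an automorphism $f:Y\to Y$ whose induced outer automorphism $f_*$ of $\pi_1(Y)\cong\Gamma$ equals $\phi$.
   Context: A cube complex is a connected, finite-dimensional space obtained by gluing Euclidean cubes $[-1,1]^n$ along faces by isometries; it is non-positively curved (NPC) if the link of every vertex is a flag simplicial complex (equivalently, its universal cover is CAT(0)). A finitely generated group $\Gamma$ is cubulated if $\Gamma\cong\pi_1(X)$ for some compact NPC cube complex $X$. $\delta$-hyperbolic means hyperbolic in the sense of Gromov. An automorphism of a cube complex is a cellular isomorphism mapping cubes isometrically onto cubes. *)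

(* Defs.v *)
From HB Require Import structures.
From mathcomp Require Import all_boot all_order all_algebra generic_quotient.
From mathcomp Require Import all_classical all_reals.
From mathcomp Require Import topology normedtype.
From mathcomp Require Import ring lra.

Set Implicit Arguments.
Unset Strict Implicit.
Unset Printing Implicit Defensive.

Import Order.TTheory GRing.Theory Num.Theory.
Import numFieldNormedType.Exports.

Local Open Scope quotient_scope.
Local Open Scope classical_set_scope.
Local Open Scope ring_scope.

(* Only the restriction of [cpath_fun] to [0, 1] is meaningful. *)
Record cpath (R : realType) (X : topologicalType) (x y : X) := CPath {
  cpath_fun :> R -> X;
  cpath_continuous : {within `[0, 1], continuous cpath_fun};
  cpath0 : cpath_fun 0 = x;
  cpath1 : cpath_fun 1 = y }.

HB.instance Definition _ (R : realType) (X : topologicalType) (x y : X) :=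
  gen_eqMixin (cpath R x y).
HB.instance Definition _ (R : realType) (X : topologicalType) (x y : X) :=
  gen_choiceMixin (cpath R x y).

Definition unit_square (R : realType) : set (R * R) := `[0, 1] `*` `[0, 1].
Arguments unit_square : clear implicits.

Definition homotopic (R : realType) (X : topologicalType) (x y : X)
    (p q : cpath R x y) : Prop :=
  exists H : R * R -> X,
    [/\ {within unit_square R, continuous H},
        (forall t : R, 0 <= t <= 1 -> H (0, t) = p t /\ H (1, t) = q t) &
        (forall s : R, 0 <= s <= 1 -> H (s, 0) = x /\ H (s, 1) = y)].

Arguments cpath_continuous {R X x y} c.
Arguments cpath0 {R X x y} c.
Arguments cpath1 {R X x y} c.

Section continuity.
Variable R : realType.

Lemma within_comp (X Y Z : topologicalType) (A : set X) (B : set Y)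
    (f : X -> Y) (g : Y -> Z) : (forall x, A x -> B (f x)) ->
  {within A, continuous f} -> {within B, continuous g} ->
  {within A, continuous (g \o f)}.
Proof.
move=> AB /subspace_continuousP cf /subspace_continuousP cg.
apply/subspace_continuousP => x Ax W /= nW.
have := cg _ (AB _ Ax) W nW; rewrite /= => h.
have := cf _ Ax _ h; rewrite /nbhs /= /within /=.
by apply: filterS => y /[swap] Ay /(_ Ay); apply; exact: AB.
Qed.

Lemma within_if (X Y : topologicalType) (A : set X) (c : X -> R) (a : R)
    (f g : X -> Y) : closed A -> continuous c ->
  {within A `&` [set x | c x <= a], continuous f} ->
  {within A `&` [set x | a <= c x], continuous g} ->
  (forall x, A x -> c x = a -> f x = g x) ->
  {within A, continuous (fun x => if c x <= a then f x else g x)}.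
Proof.
move=> cA cc cf cg fg.
have -> : A = (A `&` [set x | c x <= a]) `|` (A `&` [set x | a <= c x]).
  rewrite -setIUr; apply/esym/setIidPl => x _ /=.
  by case: (leP (c x) a) => [|/ltW]; [left|right].
apply: withinU_continuous.
- apply: closedI => //.
  by apply: (@closed_comp _ _ c [set y | y <= a]) => [x _|]; [exact: cc|exact: closed_le].
- apply: closedI => //.
  by apply: (@closed_comp _ _ c [set y | a <= y]) => [x _|]; [exact: cc|exact: closed_ge].
- apply: (subspace_eq_continuous _ cf) => x; rewrite inE => -[_ /= xa].
  by rewrite /from_subspace xa.
- apply: (subspace_eq_continuous _ cg) => x; rewrite inE => -[Ax /= ax] //.
  rewrite /from_subspace; case: ifPn => // xa.
  by rewrite -fg //; apply/eqP; rewrite eq_le xa.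
Qed.

Lemma unit_squareE (z : R * R) :
  unit_square R z <-> 0 <= z.1 <= 1 /\ 0 <= z.2 <= 1.
Proof. by rewrite /unit_square /= !in_itv. Qed.

Lemma closed_unit_square : closed (unit_square R).
Proof.
have -> : unit_square R = (fst @^-1` `[0, 1]) `&` (snd @^-1` `[0, 1]) by [].
by apply: closedI; apply: closed_comp; try exact: interval_closed;
  move=> x _; [exact: cvg_fst|exact: cvg_snd].
Qed.

Lemma lin_continuous (T : topologicalType) (c : T -> R) (a b : R) :
  continuous c -> continuous (fun z => a * c z + b).
Proof.
move=> cc z; apply: cvgD; last exact: cvg_cst.
by apply: cvgM; [exact: cvg_cst|exact: cc].
Qed.

Lemma pair_continuous (T U V : topologicalType) (f : T -> U) (g : T -> V) :
  continuous f -> continuous g -> continuous (fun z => (f z, g z)).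
Proof. by move=> cf cg z; apply: cvg_pair => /=; [exact: cf|exact: cg]. Qed.

Lemma fst_continuous : continuous (fst : R * R -> R).
Proof. by move=> z; exact: cvg_fst. Qed.

Lemma snd_continuous : continuous (snd : R * R -> R).
Proof. by move=> z; exact: cvg_snd. Qed.

Lemma minr_continuous (T : topologicalType) (f g : T -> R) :
  continuous f -> continuous g -> continuous (fun z => Num.min (f z) (g z)).
Proof. by move=> cf cg z; apply: (@continuous_min R T f g z); [exact: cf|exact: cg]. Qed.

Lemma maxr_continuous (T : topologicalType) (f g : T -> R) :
  continuous f -> continuous g -> continuous (fun z => Num.max (f z) (g z)).
Proof. by move=> cf cg z; apply: (@continuous_max R T f g z); [exact: cf|exact: cg]. Qed.

Lemma id_continuous (T : topologicalType) : continuous (fun z : T => z).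
Proof. by move=> z. Qed.

End continuity.

Section path_operations.
Variables (R : realType) (X : topologicalType).

Lemma cpath_comp (x y : X) (p : cpath R x y) (T : topologicalType) (A : set T)
    (c : T -> R) : continuous c -> (forall z, A z -> 0 <= c z <= 1) ->
  {within A, continuous (fun z => p (c z))}.
Proof.
move=> cc Ac; apply: (@within_comp T R X A `[0, 1]%classic c p _ _ (cpath_continuous p)).
  by move=> z /Ac; rewrite /= in_itv.
exact: continuous_subspaceT.
Qed.

Lemma cst_continuous (x : X) : {within `[(0 : R), 1], continuous (fun=> x)}.
Proof. by apply: continuous_subspaceT => z; exact: cvg_cst. Qed.

Definition cpath_cst (x : X) : cpath R x x :=
  CPath (@cst_continuous x) erefl erefl.

Definition rev_fun (p : R -> X) (t : R) : X := p (1 - t).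

Lemma rev_continuous (x y : X) (p : cpath R x y) :
  {within `[0, 1], continuous (rev_fun p)}.
Proof.
rewrite (_ : rev_fun p = fun t => p (-1 * t + 1)); last first.
  by apply/funext => t; rewrite /rev_fun; congr (cpath_fun _ _); ring.
apply: cpath_comp; first by apply: lin_continuous; exact: id_continuous.
by move=> z; rewrite /= in_itv /= => /andP[? ?]; lra.
Qed.

Lemma rev0 (x y : X) (p : cpath R x y) : rev_fun p 0 = y.
Proof. by rewrite /rev_fun subr0 cpath1. Qed.

Lemma rev1 (x y : X) (p : cpath R x y) : rev_fun p 1 = x.
Proof. by rewrite /rev_fun subrr cpath0. Qed.

Definition cpath_rev (x y : X) (p : cpath R x y) : cpath R y x :=
  CPath (@rev_continuous x y p) (rev0 p) (rev1 p).

Definition cat_fun (p q : R -> X) (t : R) : X :=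
  if t <= 1 / 2 then p (2 * t) else q (2 * t - 1).

Lemma cat_continuous (x y z : X) (p : cpath R x y) (q : cpath R y z) :
  {within `[0, 1], continuous (cat_fun p q)}.
Proof.
apply: (within_if (c := fun t : R => t)).
- exact: interval_closed.
- by move=> t.
- apply: (@cpath_comp _ _ p R _ (fun t => 2 * t)).
    by move=> t; apply: cvgM; [exact: cvg_cst|exact: cvg_id].
  by move=> t [/=]; rewrite in_itv /= => /andP[? ?] ?; lra.
- apply: (@cpath_comp _ _ q R _ (fun t => 2 * t - 1)).
    by apply: lin_continuous; exact: id_continuous.
  by move=> t [/=]; rewrite in_itv /= => /andP[? ?] ?; lra.
- move=> t _ ->; have -> : 2 * (1 / 2) = 1 :> R by lra.
  by rewrite subrr cpath0 cpath1.
Qed.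

Lemma cat0 (x y z : X) (p : cpath R x y) (q : cpath R y z) : cat_fun p q 0 = x.
Proof. by rewrite /cat_fun ifT ?mulr0 ?cpath0 //; lra. Qed.

Lemma cat1 (x y z : X) (p : cpath R x y) (q : cpath R y z) : cat_fun p q 1 = z.
Proof.
rewrite /cat_fun ifF; last by apply/negP => ?; lra.
have -> : 2 * 1 - 1 = 1 :> R by lra.
by rewrite cpath1.
Qed.

Definition cpath_cat (x y z : X) (p : cpath R x y) (q : cpath R y z) : cpath R x z :=
  CPath (@cat_continuous x y z p q) (cat0 p q) (cat1 p q).

Lemma homotopic_reparam (x y : X) (p q r : cpath R x y) (phi psi : R -> R) :
  continuous phi -> continuous psi ->
  (forall t : R, 0 <= t <= 1 -> 0 <= phi t <= 1 /\ 0 <= psi t <= 1) ->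
  phi 0 = psi 0 -> phi 1 = psi 1 ->
  (forall t : R, 0 <= t <= 1 -> q t = p (phi t) /\ r t = p (psi t)) ->
  homotopic q r.
Proof.
move=> cphi cpsi I01 e0 e1 qr.
have h0 : (0 : R) <= (0 : R) <= (1 : R) by apply/andP; split; [exact: lexx|exact: ler01].
have h1 : (0 : R) <= (1 : R) <= (1 : R) by apply/andP; split; [exact: ler01|exact: lexx].
exists (fun z => p ((1 - z.1) * phi z.2 + z.1 * psi z.2)); split.
- apply: cpath_comp.
    move=> z; apply: cvgD; apply: cvgM.
    + by apply: cvgB; [exact: cvg_cst|exact: cvg_fst].
    + by apply: (@continuous_comp _ _ _ snd phi); [exact: cvg_snd|exact: cphi].
    + exact: cvg_fst.
    + by apply: (@continuous_comp _ _ _ snd psi); [exact: cvg_snd|exact: cpsi].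
  move=> [s t] /unit_squareE /= [/andP[? ?] /I01 [/andP[? ?] /andP[? ?]]].
  have : 0 <= (1 - s) * (1 - phi t) by apply: mulr_ge0; lra.
  have : 0 <= (1 - s) * phi t by apply: mulr_ge0; lra.
  have : 0 <= s * (1 - psi t) by apply: mulr_ge0; lra.
  have : 0 <= s * psi t by apply: mulr_ge0; lra.
  by move=> ? ? ? ?; apply/andP; split; lra.
- move=> t /qr [-> ->] /=; rewrite subr0 subrr !mul1r !mul0r addr0 add0r.
  by split.
- move=> s s01 /=; rewrite -e0 -e1 -!mulrDl subrK !mul1r.
  have [<- _] := qr _ h0; have [<- _] := qr _ h1.
  by rewrite cpath0 cpath1.
Qed.

Lemma square_comp (H : R * R -> X) (A : set (R * R)) (f : R * R -> R * R) :
  {within unit_square R, continuous H} -> continuous f ->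
  (forall z, A z -> unit_square R (f z)) ->
  {within A, continuous (fun z => H (f z))}.
Proof.
move=> cH cf Af.
by apply: (@within_comp _ _ _ A _ f H Af _ cH); exact: continuous_subspaceT.
Qed.

Lemma homotopic_refl (x y : X) (p : cpath R x y) : homotopic p p.
Proof.
apply: (@homotopic_reparam _ _ p p p id id) => // t; exact: id_continuous.
Qed.

Lemma homotopic_sym (x y : X) (p q : cpath R x y) :
  homotopic p q -> homotopic q p.
Proof.
move=> [H [cH H0 H1]]; exists (fun z => H (1 - z.1, z.2)); split.
- apply: (@square_comp H _ (fun z : R * R => (1 - z.1, z.2))) => //; last first.
    by move=> z /unit_squareE[? ?]; apply/unit_squareE => /=; lra.
  apply: pair_continuous; last exact: snd_continuous.
  by move=> z; apply: cvgB; [exact: cvg_cst|exact: cvg_fst].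
- by move=> t /H0 /=; rewrite subr0 subrr => -[].
- by move=> s s01 /=; apply: H1; lra.
Qed.

Lemma homotopic_trans (x y : X) (p q r : cpath R x y) :
  homotopic p q -> homotopic q r -> homotopic p r.
Proof.
move=> [H [cH H0 H1]] [K [cK K0 K1]].
exists (fun z => if z.1 <= 1 / 2 then H (2 * z.1 + 0, z.2)
                 else K (2 * z.1 + -1, z.2)); split.
- apply: (@within_if R _ _ _ fst (1 / 2)
      (fun z => H (2 * z.1 + 0, z.2)) (fun z => K (2 * z.1 + -1, z.2))).
  + exact: closed_unit_square.
  + exact: fst_continuous.
  + apply: (@square_comp H _ (fun z : R * R => (2 * z.1 + 0, z.2))) => //; last first.
      by move=> z [/unit_squareE[? ?] /= ?]; apply/unit_squareE => /=; lra.
    apply: pair_continuous; last exact: snd_continuous.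
    exact/lin_continuous/fst_continuous.
  + apply: (@square_comp K _ (fun z : R * R => (2 * z.1 + -1, z.2))) => //; last first.
      by move=> z [/unit_squareE[? ?] /= ?]; apply/unit_squareE => /=; lra.
    apply: pair_continuous; last exact: snd_continuous.
    exact/lin_continuous/fst_continuous.
  + move=> [s t] /unit_squareE /= [_ t01] ->.
    have -> : 2 * (1 / 2) + 0 = 1 :> R by lra.
    have -> : 2 * (1 / 2) + -1 = 0 :> R by lra.
    by have [_ ->] := H0 _ t01; have [-> _] := K0 _ t01.
- move=> t t01 /=; rewrite ifT ?ifF; last 2 first.
  + by apply/negP => ?; lra.
  + by lra.
  have -> : 2 * 0 + 0 = 0 :> R by lra.
  have -> : 2 * 1 + -1 = 1 :> R by lra.
  by have [-> _] := H0 _ t01; have [_ ->] := K0 _ t01.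
- by move=> s s01 /=; case: leP => ?; [apply: H1|apply: K1]; lra.
Qed.

Lemma homotopic_cat (x y z : X) (p p' : cpath R x y) (q q' : cpath R y z) :
  homotopic p p' -> homotopic q q' ->
  homotopic (cpath_cat p q) (cpath_cat p' q').
Proof.
move=> [H [cH H0 H1]] [K [cK K0 K1]].
exists (fun u => if u.2 <= 1 / 2 then H (u.1, 2 * u.2 + 0)
                 else K (u.1, 2 * u.2 + -1)); split.
- apply: (@within_if R _ _ _ snd (1 / 2)
      (fun u => H (u.1, 2 * u.2 + 0)) (fun u => K (u.1, 2 * u.2 + -1))).
  + exact: closed_unit_square.
  + exact: snd_continuous.
  + apply: (@square_comp H _ (fun u : R * R => (u.1, 2 * u.2 + 0))) => //; last first.
      by move=> u [/unit_squareE[? ?] /= ?]; apply/unit_squareE => /=; lra.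
    apply: pair_continuous; first exact: fst_continuous.
    exact/lin_continuous/snd_continuous.
  + apply: (@square_comp K _ (fun u : R * R => (u.1, 2 * u.2 + -1))) => //; last first.
      by move=> u [/unit_squareE[? ?] /= ?]; apply/unit_squareE => /=; lra.
    apply: pair_continuous; first exact: fst_continuous.
    exact/lin_continuous/snd_continuous.
  + move=> [s t] /unit_squareE /= [s01 _] ->.
    have -> : 2 * (1 / 2) + 0 = 1 :> R by lra.
    have -> : 2 * (1 / 2) + -1 = 0 :> R by lra.
    by have [_ ->] := H1 _ s01; have [-> _] := K1 _ s01.
- move=> t t01 /=; rewrite /cat_fun; case: leP => ht; rewrite ?addr0.
  + by apply: H0; lra.
  + by apply: K0; lra.
- move=> s s01 /=; rewrite ifT ?ifF; last 2 first.
  + by apply/negP => ?; lra.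
  + by lra.
  have -> : 2 * 0 + 0 = 0 :> R by lra.
  have -> : 2 * 1 + -1 = 1 :> R by lra.
  by have [-> _] := H1 _ s01; have [_ ->] := K1 _ s01.
Qed.

Lemma homotopic_rev (x y : X) (p q : cpath R x y) :
  homotopic p q -> homotopic (cpath_rev p) (cpath_rev q).
Proof.
move=> [H [cH H0 H1]]; exists (fun z => H (z.1, 1 - z.2)); split.
- apply: (@square_comp H _ (fun z : R * R => (z.1, 1 - z.2))) => //; last first.
    by move=> z /unit_squareE[? ?]; apply/unit_squareE => /=; lra.
  apply: pair_continuous; first exact: fst_continuous.
  by move=> z; apply: cvgB; [exact: cvg_cst|exact: cvg_snd].
- by move=> t t01 /=; apply: H0; lra.
- by move=> s s01 /=; rewrite subr0 subrr; have [-> ->] := H1 _ s01.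
Qed.

Lemma homotopic_catA (x y z u : X) (p : cpath R x y) (q : cpath R y z)
    (r : cpath R z u) :
  homotopic (cpath_cat p (cpath_cat q r)) (cpath_cat (cpath_cat p q) r).
Proof.
apply: (@homotopic_reparam _ _ (cpath_cat p (cpath_cat q r)) _ _ id
  (fun t => Num.min (2 * t + 0) (Num.min (1 * t + 1 / 4) ((1 / 2) * t + 1 / 2)))).
- exact: id_continuous.
- by do 2?apply: minr_continuous; apply: lin_continuous; exact: id_continuous.
- move=> t t01; split=> //.
  case: (leP (1 * t + 1 / 4) ((1 / 2) * t + 1 / 2)) => ?;
  by case: (leP (2 * t + 0) _) => ?; lra.
- case: (leP (1 * 0 + 1 / 4) ((1 / 2) * 0 + 1 / 2 : R)) => ?;
  by case: (leP (2 * 0 + 0) _) => ?; lra.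
- case: (leP (1 * 1 + 1 / 4) ((1 / 2) * 1 + 1 / 2 : R)) => ?;
  by case: (leP (2 * 1 + 0) _) => ?; lra.
- move=> t t01; split=> //=; rewrite /cat_fun.
  case: (leP (1 * t + 1 / 4) ((1 / 2) * t + 1 / 2)) => ?;
  case: (leP (2 * t + 0) _) => ?;
  do ![case: ifPn; rewrite -?ltNge => ?]; try (by exfalso; lra);
  by congr (cpath_fun _ _); field.
Qed.

Lemma homotopic_cat1p (x y : X) (p : cpath R x y) :
  homotopic (cpath_cat (cpath_cst x) p) p.
Proof.
apply: (@homotopic_reparam _ _ p _ _ (fun t => Num.max 0 (2 * t + -1)) id).
- apply: maxr_continuous; first by move=> z; exact: cvg_cst.
  by apply: lin_continuous; exact: id_continuous.
- exact: id_continuous.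
- by move=> t t01; split=> //; rewrite maxEle; case: ifPn; rewrite -?ltNge => ?; lra.
- by rewrite maxEle; case: ifPn; rewrite -?ltNge => ?; lra.
- by rewrite maxEle; case: ifPn; rewrite -?ltNge => ?; lra.
- move=> t t01; split=> //=; rewrite /cat_fun.
  by case: leP => ?; rewrite maxEle; case: ifPn; rewrite -?ltNge => ?; rewrite ?cpath0 //; try (by exfalso; lra);
     rewrite (_ : 2 * t + -1 = 0) ?cpath0 //; lra.
Qed.

Lemma homotopic_catp1 (x y : X) (p : cpath R x y) :
  homotopic (cpath_cat p (cpath_cst y)) p.
Proof.
apply: (@homotopic_reparam _ _ p _ _ (fun t => Num.min 1 (2 * t + 0)) id).
- apply: minr_continuous; first by move=> z; exact: cvg_cst.
  by apply: lin_continuous; exact: id_continuous.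
- exact: id_continuous.
- by move=> t t01; split=> //; rewrite minEle; case: ifPn; rewrite -?ltNge => ?; lra.
- by rewrite minEle; case: ifPn; rewrite -?ltNge => ?; lra.
- by rewrite minEle; case: ifPn; rewrite -?ltNge => ?; lra.
- move=> t t01; split=> //=; rewrite /cat_fun.
  case: leP => ?; rewrite minEle; case: ifPn; rewrite -?ltNge => ?; rewrite ?addr0 ?cpath1 //; try (by exfalso; lra).
  by rewrite (_ : 2 * t = 1) ?cpath1 //; lra.
Qed.

Lemma homotopic_catpV (x y : X) (p : cpath R x y) :
  homotopic (cpath_cat p (cpath_rev p)) (cpath_cst x).
Proof.
have cm : continuous (fun z : R * R => Num.min (2 * z.2 + 0) (-2 * z.2 + 2)).
  by apply: minr_continuous; apply: lin_continuous; exact: snd_continuous.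
exists (fun z => p ((1 - z.1) * Num.min (2 * z.2 + 0) (-2 * z.2 + 2))); split.
- apply: cpath_comp.
    move=> z; apply: cvgM; last exact: cm.
    by apply: cvgB; [exact: cvg_cst|exact: cvg_fst].
  move=> [s t] /unit_squareE /= [s01 t01].
  move: s01 t01 => /andP[? ?] /andP[? ?].
  set m := Num.min _ _.
  have [? ?] : 0 <= m /\ m <= 1 by rewrite /m minEle; case: ifPn; rewrite -?ltNge => ?; split; lra.
  have : 0 <= (1 - s) * m by apply: mulr_ge0; lra.
  have : 0 <= s * m by apply: mulr_ge0; lra.
  by move=> ? ?; apply/andP; split; lra.
- move=> t t01 /=; rewrite subr0 subrr mul1r mul0r cpath0; split=> //.
  rewrite /cat_fun /rev_fun minEle.
  by case: ifPn; rewrite -?ltNge => ?; case: ifPn; rewrite -?ltNge => ?; try (by exfalso; lra); congr (cpath_fun _ _); lra.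
- move=> s s01 /=; rewrite -[X in _ = X /\ _](cpath0 p) -[X in _ /\ _ = X](cpath0 p).
  by rewrite !minEle; split; case: ifPn; rewrite -?ltNge => ?; congr (cpath_fun _ _); lra.
Qed.

Lemma cpath_revK (x y : X) (p : cpath R x y) :
  homotopic (cpath_rev (cpath_rev p)) p.
Proof.
apply: (@homotopic_reparam _ _ p _ _ id id) => //; try exact: id_continuous.
by move=> t t01; split=> //=; rewrite /rev_fun; congr (cpath_fun _ _); ring.
Qed.

Lemma homotopic_catVp (x y : X) (p : cpath R x y) :
  homotopic (cpath_cat (cpath_rev p) p) (cpath_cst y).
Proof.
apply: homotopic_trans (homotopic_catpV (cpath_rev p)).
by apply: homotopic_cat; [exact: homotopic_refl|exact/homotopic_sym/cpath_revK].
Qed.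

End path_operations.

Section path_image.
Variables (R : realType) (X Y : topologicalType) (f : X -> Y).
Hypothesis cf : continuous f.

Lemma image_continuous (x y : X) (p : cpath R x y) :
  {within `[0, 1], continuous (f \o p)}.
Proof.
apply: (@within_comp _ _ _ _ setT p f) => //; first exact: cpath_continuous.
exact: continuous_subspaceT.
Qed.

Lemma image0 (x y : X) (p : cpath R x y) : (f \o p) 0 = f x.
Proof. by rewrite /= cpath0. Qed.

Lemma image1 (x y : X) (p : cpath R x y) : (f \o p) 1 = f y.
Proof. by rewrite /= cpath1. Qed.

Definition cpath_map (x y : X) (p : cpath R x y) : cpath R (f x) (f y) :=
  CPath (@image_continuous x y p) (image0 p) (image1 p).

End path_image.

Section fundamental_group.
Variables (R : realType) (X : topologicalType) (x0 : X).

Definition loop_rel (p q : cpath R x0 x0) : bool := `[< homotopic p q >].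

Lemma loop_rel_refl : reflexive loop_rel.
Proof. by move=> p; apply/asboolP/homotopic_refl. Qed.

Lemma loop_rel_sym : symmetric loop_rel.
Proof. by move=> p q; apply/asboolP/asboolP => /homotopic_sym. Qed.

Lemma loop_rel_trans : transitive loop_rel.
Proof.
by move=> q p r /asboolP pq /asboolP qr; apply/asboolP/(homotopic_trans pq).
Qed.

Canonical loop_equiv := EquivRel loop_rel loop_rel_refl loop_rel_sym loop_rel_trans.

Definition pi1 : Type := {eq_quot loop_equiv}.
HB.instance Definition _ := Choice.on pi1.
HB.instance Definition _ := EqQuotient.on pi1.

Definition pi1_class (p : cpath R x0 x0) : pi1 := \pi_pi1 p.

Lemma pi1_classP (p q : cpath R x0 x0) :
  pi1_class p = pi1_class q <-> homotopic p q.
Proof. by split=> [/eqmodP/asboolP|h]//; apply/eqmodP/asboolP. Qed.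

Lemma pi1_reprP (p : cpath R x0 x0) : homotopic (repr (pi1_class p)) p.
Proof. by apply/pi1_classP; rewrite /pi1_class reprK. Qed.

Definition pi1_mul (u v : pi1) : pi1 := pi1_class (cpath_cat (repr u) (repr v)).
Definition pi1_inv (u : pi1) : pi1 := pi1_class (cpath_rev (repr u)).
Definition pi1_one : pi1 := pi1_class (cpath_cst R x0).

Lemma pi1_mulE (p q : cpath R x0 x0) :
  pi1_mul (pi1_class p) (pi1_class q) = pi1_class (cpath_cat p q).
Proof. by apply/pi1_classP/homotopic_cat; exact: pi1_reprP. Qed.

Lemma pi1_invE (p : cpath R x0 x0) :
  pi1_inv (pi1_class p) = pi1_class (cpath_rev p).
Proof. by apply/pi1_classP/homotopic_rev; exact: pi1_reprP. Qed.

Lemma pi1_ind (P : pi1 -> Prop) : (forall p, P (pi1_class p)) -> forall u, P u.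
Proof. by move=> h u; rewrite -[u]reprK; exact: h. Qed.

Lemma pi1_mulA : associative pi1_mul.
Proof.
elim/pi1_ind => p; elim/pi1_ind => q; elim/pi1_ind => r.
by rewrite !pi1_mulE; apply/pi1_classP/homotopic_catA.
Qed.

Lemma pi1_mul1g : left_id pi1_one pi1_mul.
Proof.
by elim/pi1_ind => p; rewrite pi1_mulE; apply/pi1_classP/homotopic_cat1p.
Qed.

Lemma pi1_mulg1 : right_id pi1_one pi1_mul.
Proof.
by elim/pi1_ind => p; rewrite pi1_mulE; apply/pi1_classP/homotopic_catp1.
Qed.

Lemma pi1_mulVg : left_inverse pi1_one pi1_inv pi1_mul.
Proof.
by elim/pi1_ind => p; rewrite pi1_invE pi1_mulE; apply/pi1_classP/homotopic_catVp.
Qed.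

Lemma pi1_mulgV : right_inverse pi1_one pi1_inv pi1_mul.
Proof.
by elim/pi1_ind => p; rewrite pi1_invE pi1_mulE; apply/pi1_classP/homotopic_catpV.
Qed.

HB.instance Definition _ :=
  isGroup.Build pi1 pi1_mulA pi1_mul1g pi1_mulg1 pi1_mulVg pi1_mulgV.

End fundamental_group.

Record gaut (G : groupType) := GAut {
  gaut_fun :> G -> G;
  gaut_inv : G -> G;
  gautK : cancel gaut_fun gaut_inv;
  gautKV : cancel gaut_inv gaut_fun;
  gautM : {morph gaut_fun : x y / (x * y)%g} }.

HB.instance Definition _ (G : groupType) := gen_eqMixin (gaut G).
HB.instance Definition _ (G : groupType) := gen_choiceMixin (gaut G).

Section outer_automorphisms.
Local Open Scope group_scope.
Variable G : groupType.
Implicit Types a b c : gaut G.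

Lemma gautP a b : a =1 b -> a = b.
Proof.
case: a b => [f f' fK f'K fM] [g g' gK g'K gM] /= /funext fg; subst g.
have fg' : f' = g' by apply/funext => x; rewrite -[x in LHS]g'K fK.
subst g'; congr GAut; exact: Prop_irrelevance.
Qed.

Lemma gaut_invM a : {morph gaut_inv a : x y / x * y}.
Proof. by move=> x y; apply: (can_inj (gautK a)); rewrite gautM !gautKV. Qed.

Lemma gaut1 a : a 1 = 1.
Proof. by apply: (mulgI (a 1)); rewrite -gautM !mulg1. Qed.

Lemma gautV a x : a x^-1 = (a x)^-1.
Proof. by apply: (mulgI (a x)); rewrite -gautM !mulgV gaut1. Qed.

Definition gaut_one : gaut G :=
  @GAut G id id (fun=> erefl) (fun=> erefl) (fun _ _ => erefl).

Definition gaut_mul a b : gaut G.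
Proof.
exists (a \o b) (gaut_inv b \o gaut_inv a).
- by move=> x /=; rewrite !gautK.
- by move=> x /=; rewrite !gautKV.
- by move=> x y /=; rewrite !gautM.
Defined.

Definition gaut_V a : gaut G := GAut (gautKV a) (gautK a) (gaut_invM a).

Lemma gaut_mulA : associative gaut_mul.
Proof. by move=> a b c; apply: gautP. Qed.

Lemma gaut_mul1g : left_id gaut_one gaut_mul.
Proof. by move=> a; apply: gautP. Qed.

Lemma gaut_mulg1 : right_id gaut_one gaut_mul.
Proof. by move=> a; apply: gautP. Qed.

Lemma gaut_mulVg : left_inverse gaut_one gaut_V gaut_mul.
Proof. by move=> a; apply: gautP => x /=; rewrite gautK. Qed.

Lemma gaut_mulgV : right_inverse gaut_one gaut_V gaut_mul.
Proof. by move=> a; apply: gautP => x /=; rewrite gautKV. Qed.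

HB.instance Definition _ := isGroup.Build (gaut G)
  gaut_mulA gaut_mul1g gaut_mulg1 gaut_mulVg gaut_mulgV.

Definition inner_rel a b : bool := `[< exists g, forall x, a x = g * b x * g^-1 >].

Lemma inner_rel_refl : reflexive inner_rel.
Proof. by move=> a; apply/asboolP; exists 1 => x; rewrite invg1 mulg1 mul1g. Qed.

Lemma inner_rel_imply a b : inner_rel a b -> inner_rel b a.
Proof.
move=> /asboolP[g ab]; apply/asboolP; exists g^-1 => x.
by rewrite ab invgK !mulgA mulVg mul1g mulgVK.
Qed.

Lemma inner_rel_sym : symmetric inner_rel.
Proof. by move=> a b; apply/idP/idP; exact: inner_rel_imply. Qed.

Lemma inner_rel_trans : transitive inner_rel.
Proof.
move=> b a c /asboolP[g ab] /asboolP[h bc]; apply/asboolP; exists (g * h) => x.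
by rewrite ab bc invgM !mulgA.
Qed.

Canonical inner_equiv :=
  EquivRel inner_rel inner_rel_refl inner_rel_sym inner_rel_trans.

Definition Out : Type := {eq_quot inner_equiv}.
HB.instance Definition _ := Choice.on Out.
HB.instance Definition _ := EqQuotient.on Out.

Definition out_class a : Out := \pi_Out a.

Lemma out_classP a b :
  out_class a = out_class b <-> exists g, forall x, a x = g * b x * g^-1.
Proof. by split=> [/eqmodP/asboolP|h]//; apply/eqmodP/asboolP. Qed.

Lemma out_ind (P : Out -> Prop) : (forall a, P (out_class a)) -> forall u, P u.
Proof. by move=> h u; rewrite -[u]reprK; exact: h. Qed.

Definition out_mul (u v : Out) : Out := out_class (repr u * repr v).
Definition out_inv (u : Out) : Out := out_class (repr u)^-1.
Definition out_one : Out := out_class 1.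

Lemma out_reprP a : exists g, forall x, repr (out_class a) x = g * a x * g^-1.
Proof. by apply/out_classP; rewrite /out_class reprK. Qed.

Lemma out_mulE a b : out_mul (out_class a) (out_class b) = out_class (a * b).
Proof.
have [g ga] := out_reprP a; have [h hb] := out_reprP b.
apply/out_classP; exists (g * a h) => x; rewrite /= ga hb.
by rewrite !gautM gautV invgM !mulgA.
Qed.

Lemma out_invE a : out_inv (out_class a) = out_class a^-1.
Proof.
have [g ga] := out_reprP a.
apply/out_classP; exists (gaut_inv a g^-1) => x.
apply: (can_inj (gautK (repr (out_class a)))); rewrite /= gautKV ga.
by rewrite !gautM gautV !gautKV invgK !mulgA mulgV mul1g mulgK.
Qed.

Lemma out_mulA : associative out_mul.
Proof.
by elim/out_ind => a; elim/out_ind => b; elim/out_ind => c; rewrite !out_mulE mulgA.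
Qed.

Lemma out_mul1g : left_id out_one out_mul.
Proof. by elim/out_ind => a; rewrite out_mulE mul1g. Qed.

Lemma out_mulg1 : right_id out_one out_mul.
Proof. by elim/out_ind => a; rewrite out_mulE mulg1. Qed.

Lemma out_mulVg : left_inverse out_one out_inv out_mul.
Proof. by elim/out_ind => a; rewrite out_invE out_mulE mulVg. Qed.

Lemma out_mulgV : right_inverse out_one out_inv out_mul.
Proof. by elim/out_ind => a; rewrite out_invE out_mulE mulgV. Qed.

HB.instance Definition _ := isGroup.Build Out
  out_mulA out_mul1g out_mulg1 out_mulVg out_mulgV.

End outer_automorphisms.

Section hyperbolic_groups.
Local Open Scope group_scope.
Variables (R : realType) (G : groupType).
Implicit Types (S : seq G) (g h : G).

Definition has_word S g (n : nat) : Prop :=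
  exists w : seq G, [/\ size w = n, foldr *%g 1 w = g &
    forall x, x \in w -> x \in S \/ x^-1 \in S].

Definition generates S : Prop := forall g, exists n, has_word S g n.

Definition finitely_generated : Prop := exists S, generates S.

(* The least length of a word representing [g]. *)
Definition word_length S g : nat :=
  xget 0%N [set n | has_word S g n /\ forall m, has_word S g m -> (n <= m)%N].

Definition word_dist S g h : R := (word_length S (g^-1 * h))%:R%R.

Definition gromov_product S (w x y : G) : R :=
  ((word_dist S x w + word_dist S y w - word_dist S x y) / 2)%R.

Definition delta_hyperbolic (delta : R) : Prop :=
  exists S, generates S /\ forall w x y z : G,
    (Num.min (gromov_product S w x y) (gromov_product S w y z) - delta
       <= gromov_product S w x z)%R.

End hyperbolic_groups.

Section cubes.
Variable R : realType.

Definition cube (n : nat) : set 'rV[R]_n := [set x | forall i, `|x 0 i| <= 1].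

(* The norm of the library on ['rV[R]_n] is the sup norm. *)
Definition edist (n : nat) (x y : 'rV[R]_n) : R :=
  Num.sqrt (\sum_i (x 0 i - y 0 i) ^+ 2).

(* The face through [x] on which only the coordinates in [S] vary. *)
Definition face (n : nat) (x : 'rV[R]_n) (S : {set 'I_n}) : set 'rV[R]_n :=
  [set y | cube y /\ forall i, i \notin S -> y 0 i = x 0 i].

(* The unique face of the cube containing [x] in its relative interior. *)
Definition supp (n : nat) (x : 'rV[R]_n) : set 'rV[R]_n :=
  face x [set i | `|x 0 i| < 1]%SET.

Definition is_corner (n : nat) (c : 'rV[R]_n) : Prop := forall i, `|c 0 i| = 1.

Definition isometry_onto (n m : nat) (F : set 'rV[R]_n) (F' : set 'rV[R]_m)
    (h : 'rV[R]_n -> 'rV[R]_m) : Prop :=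
  h @` F = F' /\ forall x y, F x -> F y -> edist (h x) (h y) = edist x y.

End cubes.

(* The cubed complexes of Bridson and Haefliger: [cc_char k] is the restriction
   to the k-th cube of the projection from the disjoint union of the cubes onto
   its quotient (values outside [cube] are junk).  Cubes need not embed, and the
   faces of the listed cubes need not be listed themselves. *)
Record cube_complex (R : realType) := CubeComplex {
  cc_space :> topologicalType;
  cc_cube : Type;
  cc_dim : cc_cube -> nat;
  cc_char : forall k, 'rV[R]_(cc_dim k) -> cc_space;
  cc_cover : forall z, exists k x, cube x /\ @cc_char k x = z;
  cc_inj : forall k (x y : 'rV[R]_(cc_dim k)), cube x -> cube y ->
    supp x = supp y -> cc_char x = cc_char y -> x = y;
  cc_glue : forall k k' (x : 'rV[R]_(cc_dim k)) (x' : 'rV[R]_(cc_dim k')),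
    cube x -> cube x' -> cc_char x = cc_char x' ->
    exists h, isometry_onto (supp x) (supp x') h /\
      forall y, supp x y -> cc_char y = cc_char (h y);
  cc_quotient_topology : forall A : set cc_space, open A <->
    forall k, open (@cc_char k @^-1` A : set (subspace (@cube R (cc_dim k))));
  cc_finite_dim : exists N : nat, forall k, (cc_dim k <= N)%N;
  cc_connected : connected [set: cc_space] }.

Section links.
Variables (R : realType) (X : cube_complex R).

(* A nonempty face (given by its set of free directions) of a cube of [X] at a
   corner of that cube: it contributes one simplex to the link of the image of
   the corner, with one vertex for each direction. *)
Record corner := Corner {
  co_cube : cc_cube X;
  co_pt : 'rV[R]_(cc_dim co_cube);
  co_dirs : {set 'I_(cc_dim co_cube)} }.

Definition co_face (s : corner) := face (co_pt s) (co_dirs s).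

Arguments co_face : clear implicits.

Definition link_simplex (v : X) (s : corner) : Prop :=
  [/\ is_corner (co_pt s), cc_char (co_pt s) = v & co_dirs s != finset.set0].

(* Two corners contribute the same simplex when the gluing identifies them. *)
Definition same_simplex (s t : corner) : Prop :=
  exists h, [/\ isometry_onto (co_face s) (co_face t) h, h (co_pt s) = co_pt t &
    forall y, co_face s y -> cc_char y = cc_char (h y)].

Definition co_edge (s : corner) (i : 'I_(cc_dim (co_cube s))) : corner :=
  Corner (co_pt s) [set i]%SET.

Definition link_vertex (v : X) (e : corner) : Prop :=
  link_simplex v e /\ #|co_dirs e| = 1%N.

Definition has_vertex (s e : corner) : Prop :=
  exists2 i, i \in co_dirs s & same_simplex e (co_edge i).

Definition link_simplicial (v : X) : Prop :=
  (forall s, link_simplex v s -> forall i j,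
     i \in co_dirs s -> j \in co_dirs s ->
     same_simplex (co_edge i) (co_edge j) -> i = j) /\
  (forall s t, link_simplex v s -> link_simplex v t ->
     (forall e, link_vertex v e -> has_vertex s e <-> has_vertex t e) ->
     same_simplex s t).

(* Distinct, pairwise adjacent vertices [e 0, ..., e n] span a simplex. *)
Definition link_flag (v : X) : Prop :=
  forall (n : nat) (e : 'I_n.+1 -> corner),
    (forall i, link_vertex v (e i)) ->
    (forall i j, i != j -> ~ same_simplex (e i) (e j) /\
       exists s, [/\ link_simplex v s, has_vertex s (e i) & has_vertex s (e j)]) ->
    exists s, link_simplex v s /\
      forall e', link_vertex v e' ->
        (has_vertex s e' <-> exists i, same_simplex e' (e i)).

Definition is_vertex (v : X) : Prop :=
  exists k (c : 'rV[R]_(cc_dim k)), is_corner c /\ cc_char c = v.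

Definition NPC : Prop :=
  forall v, is_vertex v -> link_simplicial v /\ link_flag v.

End links.

(* Every cube is mapped isometrically onto a cube, i.e. onto a face of some
   listed cube. *)
Definition cubical (R : realType) (X Y : cube_complex R) (f : X -> Y) : Prop :=
  forall k, exists k' (x' : 'rV[R]_(cc_dim k')) h,
    [/\ cube x', isometry_onto (@cube R (cc_dim k)) (supp x') h &
        forall x : 'rV[R]_(cc_dim k), cube x -> f (cc_char x) = cc_char (h x)].

Record cube_automorphism (R : realType) (X : cube_complex R) := CubeAutomorphism {
  ca_fun :> X -> X;
  ca_inv : X -> X;
  ca_funK : cancel ca_fun ca_inv;
  ca_invK : cancel ca_inv ca_fun;
  ca_continuous : continuous ca_fun;
  ca_inv_continuous : continuous ca_inv;
  ca_cubical : cubical ca_fun;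
  ca_inv_cubical : cubical ca_inv }.

Definition cubulated (R : realType) (G : groupType) : Prop :=
  finitely_generated G /\
  exists X : cube_complex R, [/\ NPC X, compact [set: X] &
    exists (x0 : X) (theta : {multiplicative pi1 R x0 -> G}), bijective theta].

(* The outer automorphism of [G] induced by [f] under the isomorphism [theta]:
   [f] maps loops at [x0] to loops at [f x0], which are brought back to [x0]
   along a path [gamma]; another [gamma] changes the result by an inner
   automorphism. *)
Definition induces (R : realType) (X : cube_complex R) (f : cube_automorphism X)
    (x0 : X) (G : groupType) (theta : pi1 R x0 -> G) (phi : Out G) : Prop :=
  exists (gamma : cpath R x0 (f x0)) (a : gaut G), out_class a = phi /\
    forall l : cpath R x0 x0, a (theta (pi1_class l)) =
      theta (pi1_class (cpath_cat gamma
        (cpath_cat (cpath_map (@ca_continuous _ _ f) l) (cpath_rev gamma)))).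

(* Main.v *)
(* Let X be a compact non-positively curved cube complex with fundamental group G,
   and let a be an automorphism of G representing phi, so that a^n is conjugation
   by some g.  On the n-th power of the universal cover of X let c in G act by
   (c, a c, ..., a^(n-1) c), which is free, and put

     F (x_0, ..., x_(n-1)) = (x_1, ..., x_(n-1), g x_0).

   Then F (c x) = (a c) (F x), so F descends to an automorphism of the quotient Y
   which induces phi.

   Concretely Y is the cover of X^n associated with the subgroup
   {(c, a c, ..., a^(n-1) c)} of G^n, its points being classes of paths, and F lifts
   the cyclic shift of X^n.  The weak topology on powers and covers is tractable
   because compactness of X makes the cubical stars of a point a basis of its
   neighbourhoods. *)

From HB Require Import structures.
From mathcomp Require Import all_boot all_order all_algebra all_classical all_reals.
From mathcomp Require Import topology normedtype generic_quotient.
From mathcomp Require Import finmap ring lra.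
Require Import Defs.

Set Implicit Arguments.
Unset Strict Implicit.
Unset Printing Implicit Defensive.

Import Order.TTheory GRing.Theory Num.Theory.
Import numFieldNormedType.Exports.

Local Open Scope quotient_scope.
Local Open Scope classical_set_scope.
Local Open Scope ring_scope.

(** * Isometries between faces *)

Section faces.
Variable R : realType.

(** A cube complex only comes with gluings that are isometries between faces, so everything rests on
    one rigidity statement, [isometry_coord]: such an isometry permutes the free coordinates up to
    sign. Gluings are therefore affine and preserve sup-norm nearness, and straight segments, stars
    and radial contractions of stars may be computed in any cube. Hence a path that starts at the
    centre of a star and stays in it is homotopic to a segment, and the cover can be built by
    transporting path classes along segments of cubes. Non-positive curvature is passed on through
    links: a cover has the links of its base, and the link of a power is the join of the links of
    the factors. Working with loops in X^n, and not upstairs in the universal cover, turns the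
    action of G into a condition on the coordinates of a loop class, and the element g into a loop
    run through by the last coordinate while the others stay put. *)

Definition face_pt n (x : 'rV[R]_n) (S : {set 'I_n}) (v : 'I_n -> R) : 'rV[R]_n :=
  \row_i (if i \in S then v i else x 0 i).

Lemma face_ptP n (x : 'rV[R]_n) S v : cube x -> (forall i, `|v i| <= 1) ->
  face x S (face_pt x S v).
Proof.
move=> cx hv; split=> i; rewrite !mxE; first by case: ifP.
by move/negbTE->.
Qed.

Definition face_sqd n (S : {set 'I_n}) (y z : 'rV[R]_n) : R :=
  \sum_(i in S) (y 0 i - z 0 i) ^+ 2.

Lemma edist_face n (x : 'rV[R]_n) S y z : face x S y -> face x S z ->
  edist y z ^+ 2 = face_sqd S y z.
Proof.
move=> [_ hy] [_ hz]; rewrite /edist sqr_sqrtr; last first.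
  by apply: sumr_ge0 => i _; exact: sqr_ge0.
rewrite (bigID (mem S)) /= [X in _ + X]big1 ?addr0 // => i iS.
by rewrite hy // hz // subrr expr0n.
Qed.

Lemma face_sqd_le n (x : 'rV[R]_n) S y z : face x S y -> face x S z ->
  face_sqd S y z <= 4 * #|S|%:R.
Proof.
move=> [cy _] [cz _]; rewrite mulr_natr -sumr_const; apply: ler_sum => i _.
by have := cy i; have := cz i; rewrite !ler_norml => /andP[? ?] /andP[? ?]; nra.
Qed.

Lemma isometry_sqd n m (x : 'rV[R]_n) S (x' : 'rV[R]_m) S' h :
  isometry_onto (face x S) (face x' S') h ->
  forall y z, face x S y -> face x S z ->
  face_sqd S' (h y) (h z) = face_sqd S y z.
Proof.
move=> [ho hd] y z fy fz.
rewrite -(edist_face fy fz) -(@edist_face _ x' S') ?hd //.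
- by rewrite -ho; exists y.
- by rewrite -ho; exists z.
Qed.

(** The inner product of [y - c] and [z - c] along the directions of [S]. By polarization
    ([face_prodE]) it is a combination of squared distances, so an isometry preserves it before
    anything is known about linearity. *)
Definition face_prod n (c : 'rV[R]_n) (S : {set 'I_n}) (y z : 'rV[R]_n) : R :=
  \sum_(i in S) (c 0 i - y 0 i) * (c 0 i - z 0 i).

Lemma face_prodE n (c : 'rV[R]_n) S y z : face_prod c S y z =
  (face_sqd S y c + face_sqd S z c - face_sqd S y z) / 2.
Proof.
rewrite /face_sqd -big_split -sumrB /= mulr_suml; by apply: eq_bigr => i _; field.
Qed.

Lemma normr1_sqr (a : R) : `|a| = 1 -> a * a = 1.
Proof. by move=> h; rewrite -expr2 -real_normK ?num_real// h expr1n. Qed.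

Definition face_neighbour n (c : 'rV[R]_n) (x : 'rV[R]_n) S (i : 'I_n) :=
  face_pt x S (fun k => if k == i then - c 0 k else c 0 k).

(** Pairing with a neighbour of [c] isolates one coordinate; this is how coordinates are read off
    from inner products. *)
Lemma face_prod_neighbour n (c x : 'rV[R]_n) (S : {set 'I_n}) y i : i \in S ->
  face_prod c S y (face_neighbour c x S i) = 2 * c 0 i * (c 0 i - y 0 i).
Proof.
move=> iS; rewrite /face_prod (bigD1 i)//= big1 ?addr0.
  by rewrite !mxE iS eqxx; ring.
by move=> j /andP[jS /negbTE ji]; rewrite !mxE jS ji subrr mulr0.
Qed.

Lemma sum_sqr_neq0 (I : finType) (S : {set I}) (F : I -> R) :
  \sum_(i in S) F i ^+ 2 = 4 -> exists2 i, i \in S & F i != 0.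
Proof.
move=> h4; apply: contrapT => nF.
have h0 i : i \in S -> F i = 0.
  by move=> iS; apply/eqP/negPn/negP => Fi; apply: nF; exists i.
move: h4; rewrite big1 => [h4|i /h0 ->]; last by rewrite expr0n.
by lra.
Qed.

Definition coord_match n m (x : 'rV[R]_n) S (h : 'rV[R]_n -> 'rV[R]_m) i j :=
  exists e : R, `|e| = 1 /\ forall y, face x S y -> h y 0 j = e * y 0 i.

(* The neighbours of a corner in a face are sent to an orthogonal family with
   nonnegative coordinates, and so are those of its image under the inverse:
   a matrix which is orthogonal and nonnegative is a permutation. *)
Lemma isometry_corner_coord n m (x : 'rV[R]_n) S (x' : 'rV[R]_m) S' h c :
  cube x -> cube x' -> isometry_onto (face x S) (face x' S') h ->
  face x S c -> (forall i, i \in S -> `|c 0 i| = 1) -> (forall j, j \in S' -> `|h c 0 j| = 1) ->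
  (forall j, j \in S' -> exists2 i, i \in S & coord_match x S h i j) /\
  (forall i, i \in S -> exists2 j, j \in S' & coord_match x S h i j).
Proof.
move=> cx cx' ih fc cc hc1.
have hq := isometry_sqd ih; case: (ih) => ho _.
have hface y : face x S y -> face x' S' (h y) by move=> fy; rewrite -ho; exists y.
set p := h c; have p2 j : j \in S' -> p 0 j * p 0 j = 1 by move/hc1/normr1_sqr.
have c2 i : i \in S -> c 0 i * c 0 i = 1 by move/cc/normr1_sqr.
have hp y z : face x S y -> face x S z ->
    face_prod p S' (h y) (h z) = face_prod c S y z.
  by move=> fy fz; rewrite /p !face_prodE !hq //.
pose e i := face_pt x S (fun k => if k \in S then if k == i then - c 0 k else c 0 k else 0).
have eE i : e i = face_neighbour c x S i.
  by apply/rowP => k; rewrite !mxE; case: (k \in S).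
have fe i : face x S (e i).
  by apply: face_ptP => // k; case: ifP => [kS|]; [case: ifP; rewrite ?normrN cc|rewrite normr0].
pose e' j := face_pt x' S' (fun k => if k \in S' then if k == j then - p 0 k else p 0 k else 0).
have fe' j : face x' S' (e' j).
  by apply: face_ptP => // k; case: ifP => [kS|]; [case: ifP; rewrite ?normrN hc1 |rewrite normr0].
have e'E j : e' j = face_neighbour p x' S' j.
  by apply/rowP => k; rewrite !mxE; case: (k \in S').
have /choice[w hw] : forall j, exists y, face x S y /\ h y = e' j.
  by move=> j; have := fe' j; rewrite -ho => -[u fu hu]; exists u.
have hw1 y j : face x S y -> j \in S' ->
    face_prod c S y (w j) = 2 * (1 - p 0 j * h y 0 j).
  move=> fy jS; have [fw hwe] := hw j.
  rewrite -hp // hwe e'E face_prod_neighbour // -mulrA mulrBr p2 //.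
(* Up to the factor 2, this is the matrix comparing the edges at [c] with those at [h c]: an entry 2
   means that [w j] flips coordinate [i] of [c], an entry 0 that it keeps it. *)
pose A i j := 1 - c 0 i * w j 0 i.
have A0 i j : i \in S -> 0 <= A i j.
  move=> iS; have [[/(_ i) cw _] _] := hw j; rewrite /A subr_ge0.
  apply: le_trans (ler_norm _) _; by rewrite normrM cc // mul1r.
have AE i j : i \in S -> c 0 i - w j 0 i = c 0 i * A i j.
  by move=> iS; rewrite /A mulrBr mulr1 mulrA c2 // mul1r.
have Acol j : j \in S' -> \sum_(i in S) A i j ^+ 2 = 4.
  move=> jS; have [fw hwe] := hw j.
  have := hw1 _ _ fw jS; rewrite hwe !mxE jS eqxx => h1.
  have -> : \sum_(i in S) A i j ^+ 2 = face_prod c S (w j) (w j).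
    by apply: eq_bigr => i iS; rewrite AE // mulrACA c2 // mul1r expr2.
  by rewrite h1 mulrN p2 //; ring.
have Aort j j' : j \in S' -> j' \in S' -> j' != j ->
    forall i, i \in S -> A i j * A i j' = 0.
  move=> jS jS' jj.
  have [fw hwe] := hw j.
  have := hw1 _ _ fw jS'; rewrite hwe !mxE jS' (negbTE jj) p2 // subrr mulr0.
  have -> : face_prod c S (w j) (w j') = \sum_(i in S) A i j * A i j'.
    by apply: eq_bigr => i iS; rewrite !AE // mulrACA c2 // mul1r.
  move=> /eqP; rewrite psumr_eq0; last by move=> i iS; apply: mulr_ge0; exact: A0.
  by move=> /allP h0 i iS; apply/eqP; have := h0 i (mem_index_enum _); rewrite iS.
have Arow i : i \in S -> \sum_(j in S') A i j ^+ 2 = 4.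
  move=> iS.
  have E j : j \in S' -> A i j = 1 - p 0 j * h (e i) 0 j.
    move=> jS; have h1 := hw1 _ _ (fe i) jS.
    have h2 : face_prod c S (e i) (w j) = 2 * A i j.
      rewrite -[LHS]/(\sum_(k in S) _) (eq_bigr (fun k => (c 0 k - w j 0 k) * (c 0 k - e i 0 k))).
        rewrite -/(face_prod c S (w j) (e i)) eE face_prod_neighbour // AE //.
        by rewrite mulrA -(mulrA 2) c2 // mulr1.
      by move=> k _; rewrite mulrC.
    by lra.
  have h3 : face_prod c S (e i) (e i) = 4.
    by rewrite eE face_prod_neighbour // !mxE iS eqxx opprK -mulrA mulrDr c2 //; ring.
  rewrite -h3 -hp //; apply: eq_bigr => j jS; rewrite E //.
  have -> : p 0 j - h (e i) 0 j = p 0 j * (1 - p 0 j * h (e i) 0 j).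
    by rewrite mulrBr mulr1 mulrA p2 // mul1r.
  by rewrite mulrACA p2 // mul1r expr2.
have As j i : j \in S' -> i \in S -> A i j != 0 ->
    A i j = 2 /\ forall i', i' \in S -> i' != i -> A i' j = 0.
  move=> jS iS Aij.
  have h1 : A i j = 2.
    have := Arow i iS; rewrite (bigD1 j) //= big1 ?addr0 => [h4|j' /andP[jS' jj]].
      apply/eqP; rewrite -(eqrXn2 (n := 2)) //; last exact: A0.
      by rewrite h4; apply/eqP; ring.
    by have /eqP := Aort _ _ jS jS' jj i iS; rewrite mulf_eq0 (negbTE Aij) => /eqP ->; rewrite expr0n.
  split=> // i' iS' ii.
  have := Acol j jS; rewrite (bigD1 i) //= h1 => /eqP.
  have -> : (2 : R) ^+ 2 = 4 by ring.
  rewrite -[X in _ == X]addr0 (inj_eq (addrI _)) psumr_eq0; last by move=> ? _; exact: sqr_ge0.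
  move=> /allP /(_ i' (mem_index_enum _)); rewrite iS' ii /= sqrf_eq0 => /eqP //.
have key i j : i \in S -> j \in S' -> A i j != 0 -> coord_match x S h i j.
  move=> iS jS Aij; have [A2 Az] := As _ _ jS iS Aij.
  exists (p 0 j * c 0 i); split; first by rewrite normrM hc1 // cc // mul1r.
  move=> y fy; have := hw1 _ _ fy jS.
  have -> : face_prod c S y (w j) = 2 * (1 - c 0 i * y 0 i).
    rewrite /face_prod (bigD1 i) //= big1 ?addr0; last first.
      by move=> k /andP[kS ki]; rewrite AE // Az // !mulr0.
    by rewrite AE // A2 mulrA mulrBl c2 //; ring.
  move=> h2; have {}h2 : c 0 i * y 0 i = p 0 j * h y 0 j by lra.
  by rewrite -mulrA h2 mulrA p2 // mul1r.
split=> [j jS|i iS].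
  by have [i iS Ai] := sum_sqr_neq0 (Acol j jS); exists i => //; exact: key.
by have [j jS Ai] := sum_sqr_neq0 (Arow i iS); exists j => //; exact: key.
Qed.

(** The squared diameter of a face is four times its dimension, so both faces have the same
    dimension. Two opposite corners realize the diameter, hence so do their images, which must
    differ by 2 in every free coordinate: a corner goes to a corner, and [isometry_corner_coord]
    applies there. *)
Lemma isometry_coord n m (x : 'rV[R]_n) S (x' : 'rV[R]_m) S' h :
  cube x -> cube x' -> isometry_onto (face x S) (face x' S') h ->
  (forall j, j \in S' -> exists2 i, i \in S & coord_match x S h i j) /\
  (forall i, i \in S -> exists2 j, j \in S' & coord_match x S h i j).
Proof.
move=> cx cx' ih; have hq := isometry_sqd ih; case: (ih) => ho _.
have hface y : face x S y -> face x' S' (h y) by move=> fy; rewrite -ho; exists y.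
have n1 (b : bool) : `|if b then 1 else -1 : R| <= 1 by case: b; rewrite ?normrN1 ?normr1.
have d4 k (z : 'rV[R]_k) T b : face_sqd T (face_pt z T (fun=> if b then 1 else -1))
      (face_pt z T (fun=> if ~~ b then 1 else -1)) = 4 * #|T|%:R.
  rewrite mulr_natr -sumr_const; apply: eq_bigr => i iT; rewrite !mxE iT.
  by case: b => /=; ring.
have fp k (z : 'rV[R]_k) T b : cube z -> face z T (face_pt z T (fun=> if b then 1 else -1)).
  by move=> cz; apply: face_ptP => // ?.
have ST : #|S|%:R = #|S'|%:R :> R.
  apply/eqP; rewrite eq_le; apply/andP; split; rewrite -(ler_pM2l (_ : 0 < 4)) //.
    rewrite -(d4 _ x _ true) -hq; [|exact: (fp _ _ _ true)|exact: (fp _ _ _ false)].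
    by apply: face_sqd_le; apply: hface; [exact: (fp _ _ _ true)|exact: (fp _ _ _ false)].
  rewrite -(d4 _ x' _ true).
  have := fp _ x' S' true cx'; rewrite -ho => -[y fy <-].
  have := fp _ x' S' (~~ true) cx'; rewrite -ho => -[z fz <-].
  by rewrite hq //; exact: face_sqd_le fy fz.
pose c := face_pt x S (fun=> 1); pose c' := face_pt x S (fun=> -1).
have fc : face x S c by exact: (fp _ _ _ true).
have fc' : face x S c' by exact: (fp _ _ _ false).
have h4 : face_sqd S' (h c) (h c') = 4 * #|S'|%:R.
  by rewrite hq // (d4 _ _ _ true) ST.
have hc1 j : j \in S' -> `|h c 0 j| = 1.
  move=> jS; have [k1 _] := hface _ fc; have [k2 _] := hface _ fc'.
  have : \sum_(j in S') (4 - (h c 0 j - h c' 0 j) ^+ 2) = 0.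
    by rewrite sumrB sumr_const -/(face_sqd _ _ _) h4 -[X in X - _]mulr_natr subrr.
  have b i := k1 i; have b' i := k2 i.
  move=> /eqP; rewrite psumr_eq0; last first.
    move=> i _; have := b i; have := b' i; rewrite !ler_norml => /andP[? ?] /andP[? ?]; nra.
  move=> /allP /(_ j (mem_index_enum _)); rewrite jS /= => /eqP e4.
  apply/eqP; rewrite eq_le b /=; have := b j; have := b' j.
  rewrite !ler_norml => /andP[? ?] /andP[? ?].
  have [j0|j0] := leP 0 (h c 0 j); rewrite ?(ger0_norm j0) ?(ltr0_norm j0); nra.
apply: (isometry_corner_coord cx cx' ih fc) => // i iS.
by rewrite !mxE iS normr1.
Qed.

End faces.

(** * Stars of points *)

Section stars.
Variable R : realType.

Lemma finite_radius (T : finType) (P : T -> R -> Prop) :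
  (forall t e e', 0 < e' -> e' <= e -> P t e -> P t e') ->
  (forall t, exists2 e, 0 < e & P t e) -> exists2 e, 0 < e & forall t, P t e.
Proof.
move=> Pmono Pex.
have /choice[e he] : forall t, exists e, 0 < e /\ P t e.
  by move=> t; have [e] := Pex t; exists e.
have e0 t := (he t).1; have Pe t := (he t).2.
exists (\big[Order.min/1]_t e t).
  by elim/big_ind: _ => // x y x0 y0; rewrite lt_min x0.
have m0 : 0 < \big[Order.min/1]_t e t.
  by elim/big_ind: _ => // x y x0 y0; rewrite lt_min x0.
by move=> t; apply: (Pmono _ (e t)) => //; exact: bigmin_le.
Qed.

(** Sup-norm nearness, written by coordinates: invariant under signed permutations of the
    coordinates and compatible with products of cubes. *)
Definition cnear n (e : R) (x y : 'rV[R]_n) := forall i, `|x 0 i - y 0 i| < e.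

Lemma cnear_sym n e (x y : 'rV[R]_n) : cnear e x y -> cnear e y x.
Proof. by move=> h i; rewrite distrC. Qed.

Lemma cnear_le n e e' (x y : 'rV[R]_n) : e <= e' -> cnear e x y -> cnear e' x y.
Proof. by move=> ee h i; exact: lt_le_trans (h i) ee. Qed.

Lemma cnear_refl n e (x : 'rV[R]_n) : 0 < e -> cnear e x x.
Proof. by move=> e0 i; rewrite subrr normr0. Qed.

Lemma cnear_trans n e e' (x y z : 'rV[R]_n) :
  cnear e x y -> cnear e' y z -> cnear (e + e') x z.
Proof.
move=> h h' i; rewrite -(subrK (y 0 i) (x 0 i)) -addrA.
by apply: le_lt_trans (ler_normD _ _) _; apply: ltrD.
Qed.

Lemma cnear_slack n e (x y : 'rV[R]_n) : 0 < e -> cnear e x y ->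
  exists2 d, 0 < d & d < e /\ cnear (e - d) x y.
Proof.
move=> e0 h.
have [||d d0 hd] := @finite_radius 'I_n (fun i d => `|x 0 i - y 0 i| < e - d).
- by move=> i d d' _ dd /lt_le_trans; apply; rewrite lerD2l lerN2.
- move=> i; exists ((e - `|x 0 i - y 0 i|) / 2); have := h i; lra.
exists (Order.min d (e / 2)); first by rewrite lt_min d0 divr_gt0.
split=> [|i]; first by rewrite gt_min orbC ltr_pdivrMr // ltr_pMr // ltr1n.
by apply: lt_le_trans (hd i) _; rewrite lerD2l lerN2 ge_min lexx.
Qed.

Definition free n (x : 'rV[R]_n) : {set 'I_n} := [set i | `|x 0 i| < 1]%SET.

Lemma face_self n (x : 'rV[R]_n) S : cube x -> face x S x.
Proof. by split. Qed.

Lemma free_normr n (x : 'rV[R]_n) i : cube x -> i \notin free x -> `|x 0 i| = 1.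
Proof. by move=> cx; rewrite inE -leNgt => h; apply/le_anti; rewrite h cx. Qed.

Lemma face_eq n (x y : 'rV[R]_n) (S : {set 'I_n}) : (forall i, i \notin S -> x 0 i = y 0 i) ->
  face x S = face y S.
Proof.
move=> xy; rewrite eqEsubset; split=> z [cz hz]; split=> // i iS.
  by rewrite hz // xy.
by rewrite hz // xy.
Qed.

Lemma supp_free n (x y : 'rV[R]_n) : cube x -> cube y -> supp y x -> supp x y ->
  free x = free y.
Proof.
move=> cx cy [_ yx] [_ xy]; apply/setP => i.
have [i1|i1] := boolP (i \in free x); have [i2|i2] := boolP (i \in free y) => //.
  by move: i1; rewrite inE yx // free_normr // ltxx.
by move: i2; rewrite inE xy // free_normr // ltxx.
Qed.

Lemma supp_eqP n (x y : 'rV[R]_n) : cube x -> cube y ->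
  (supp x = supp y <-> free x = free y /\ forall i, i \notin free x -> x 0 i = y 0 i).
Proof.
move=> cx cy; split=> [ss|[E h]].
  have s1 : supp y x by rewrite -ss; exact: face_self.
  have s2 : supp x y by rewrite ss; exact: face_self.
  by split=> [|i iS]; [exact: supp_free|rewrite s2.2].
by rewrite /supp -!/(free _) -E; exact: face_eq.
Qed.

Lemma isometry_cnear n m (x : 'rV[R]_n) S (x' : 'rV[R]_m) S' h e y z :
  cube x -> cube x' -> isometry_onto (face x S) (face x' S') h ->
  face x S y -> face x S z -> 0 < e -> cnear e y z -> cnear e (h y) (h z).
Proof.
move=> cx cx' ih fy fz e0 yz j.
have fh u : face x S u -> face x' S' (h u) by case: ih => <- _ fu; exists u.
have [jS|jS] := boolP (j \in S'); last first.
  by rewrite (fh _ fy).2 // (fh _ fz).2 // subrr normr0.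
have [/(_ j jS)[i iS [a [a1 ha]]] _] := isometry_coord cx cx' ih.
by rewrite !ha // -mulrBr normrM a1 mul1r.
Qed.

Section star_of_point.
Variable X : cube_complex R.
Implicit Types (z w : X) (k : cc_cube X).

(** [cc_glue] does not tell where [h] sends [x]. As a signed permutation of the free coordinates,
    [h] keeps relative interiors, so [h x] and [x'] have the same support, and [cc_inj] identifies
    them. *)
Lemma glue_pt k k' (x : 'rV[R]_(cc_dim k)) (x' : 'rV[R]_(cc_dim k')) :
  cube x -> cube x' -> cc_char x = cc_char x' ->
  exists h, [/\ isometry_onto (supp x) (supp x') h,
    (forall y, supp x y -> cc_char y = cc_char (h y)) & h x = x'].
Proof.
move=> cx cx' xx'; have [h [ih hc]] := cc_glue cx cx' xx'.
exists h; split=> //.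
have fh u : supp x u -> supp x' (h u) by case: ih => <- _ fu; exists u.
have [chx hx] := fh _ (face_self _ cx).
have E : free (h x) = free x'.
  apply/setP => j; have [jS|jS] := boolP (j \in free x').
    have [/(_ j jS)[i iS [a [a1 ha]]] _] := isometry_coord cx cx' ih.
    by rewrite inE ha ?normrM ?a1 ?mul1r; [move: iS; rewrite inE|exact: face_self].
  by rewrite inE hx // free_normr // ltxx.
apply: (@cc_inj _ X) => //; last by rewrite -xx' (hc x) //; exact: face_self.
by rewrite /supp -!/(free _) E; exact: face_eq.
Qed.

(** The free coordinates of every preimage of [z] stay at distance at least [e] from the walls, so
    that moving by less than [e] can only leave faces, never enter smaller ones ([good_supp]). *)
Definition good_radius z (e : R) := 0 < e <= 1 /\
  forall k (x : 'rV[R]_(cc_dim k)), cube x -> cc_char x = z ->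
  forall i, `|x 0 i| < 1 -> `|x 0 i| + e <= 1.

(** One preimage decides: by [glue_pt], each free coordinate of another preimage is, up to sign, a
    free coordinate of the chosen one. *)
Lemma good_radius_exists z : exists e, good_radius z e.
Proof.
have [k [x [cx xz]]] := cc_cover z.
have [||e e0 he] := @finite_radius 'I_(cc_dim k)
    (fun i e => `|x 0 i| < 1 -> `|x 0 i| + e <= 1).
- by move=> i e e' _ ee h /h; apply: le_trans; rewrite lerD2l.
- move=> i; have [lt1|ge1] := ltP `|x 0 i| 1; last by exists 1.
  by exists (1 - `|x 0 i|) => [|_]; lra.
exists (Order.min e 1); split; first by rewrite lt_min e0 ltr01 ge_min lexx orbT.
move=> k' x' cx' x'z j xj.
have [h [ih _ hx]] := glue_pt cx cx' (etrans xz (esym x'z)).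
have jS : j \in free x' by rewrite inE.
have [/(_ j jS)[i iS [a [a1 ha]]] _] := isometry_coord cx cx' ih.
have E : `|x' 0 j| = `|x 0 i|.
  by rewrite -hx ha ?normrM ?a1 ?mul1r; [|exact: face_self].
rewrite E; apply: le_trans (he i _); last by rewrite -E.
by rewrite lerD2l ge_min lexx.
Qed.

Lemma good_radius_le z e e' : good_radius z e -> 0 < e' -> e' <= e -> good_radius z e'.
Proof.
move=> [/andP[e0 e1] h] e'0 ee; split; first by rewrite e'0 (le_trans ee).
by move=> k x cx xz i /(h k x cx xz); apply: le_trans; rewrite lerD2l.
Qed.

Lemma good_radius_half z r : good_radius z (r + r) ->
  [/\ 0 < r, r <= 1 & good_radius z r].
Proof.
move=> ge; have [/andP[r0 r1] _] := ge.
have r0' : 0 < r by lra.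
have r2 : r <= r + r by lra.
split=> //; first by lra.
exact: good_radius_le ge r0' r2.
Qed.

Lemma good_supp z e k (x y : 'rV[R]_(cc_dim k)) : good_radius z e ->
  cube x -> cc_char x = z -> cube y -> cnear e x y -> supp y x.
Proof.
move=> [/andP[e0 e1] h] cx xz cy xy; split=> // i /(free_normr cy) y1.
have := h _ _ cx xz i; have := xy i; have := cx i => cxi xyi hx.
have x1 : `|x 0 i| = 1.
  apply/le_anti; rewrite cxi /= leNgt; apply/negP => /hx.
  have := ler_normD (y 0 i - x 0 i) (x 0 i); rewrite subrK y1 distrC; lra.
move: x1 y1 xyi.
have [x0|x0] := lerP 0 (x 0 i); have [y0|y0] := lerP 0 (y 0 i);
rewrite ?(ger0_norm x0) ?(ltr0_norm x0) ?(ger0_norm y0) ?(ltr0_norm y0) => ? ?;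
  rewrite ltr_norml => /andP[? ?]; lra.
Qed.

(** Each point lies on the face carrying the other, so both have the same support and [cc_inj]
    applies. *)
Lemma good_uniq z e k (x x' : 'rV[R]_(cc_dim k)) : good_radius z e ->
  cube x -> cc_char x = z -> cube x' -> cc_char x' = z -> cnear e x x' -> x = x'.
Proof.
move=> ge cx xz cx' x'z xx'; apply: cc_inj => //; last by rewrite xz.
have s1 := good_supp ge cx xz cx' xx'.
have s2 := good_supp ge cx' x'z cx (cnear_sym xx').
have E := supp_free cx cx' s1 s2.
rewrite /supp -!/(free _) E; apply: face_eq => i; exact: s1.2.
Qed.

Definition star z e : set X := [set w | exists k (x y : 'rV[R]_(cc_dim k)),
  [/\ cube x, cube y, cc_char x = z, cc_char y = w & cnear e x y]].

Lemma star_transport z e k (x y : 'rV[R]_(cc_dim k)) k' (y' : 'rV[R]_(cc_dim k')) :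
  good_radius z e -> cube x -> cube y -> cc_char x = z -> cnear e x y ->
  cube y' -> cc_char y' = cc_char y -> exists h,
  [/\ isometry_onto (supp y) (supp y') h,
   (forall u, supp y u -> cc_char u = cc_char (h u)), h y = y', supp y x &
   forall e', 0 < e' -> cnear e' x y -> cnear e' (h x) y'].
Proof.
move=> ge cx cy xz xy cy' yy'.
have sx := good_supp ge cx xz cy xy.
have [h [ih hc hy]] := glue_pt cy cy' (esym yy').
exists h; split=> // e' e'0 xy'; rewrite -hy.
by apply: (isometry_cnear cy cy' ih) => //; exact: face_self.
Qed.

(** Membership in a star can be witnessed in any cube through [w]: the face carrying [y] contains
    the preimage [x] of the centre and is glued as a whole. *)
Lemma star_rep z e e' w k' (y' : 'rV[R]_(cc_dim k')) :
  good_radius z e -> 0 < e' <= e -> star z e' w -> cube y' -> cc_char y' = w ->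
  exists x', [/\ cube x', cc_char x' = z & cnear e' x' y'].
Proof.
move=> ge /andP[e0 ee] [k [x [y [cx cy xz yw xy]]]] cy' y'w.
have [h [ih hc hy sx hn]] := star_transport ge cx cy xz (cnear_le ee xy) cy' (etrans y'w (esym yw)).
have [chx _] : supp y' (h x) by case: ih => <- _; exists x.
by exists (h x); split=> //; [rewrite -hc | apply: hn].
Qed.

Lemma star_self z e : 0 < e -> star z e z.
Proof.
move=> e0; have [k [x [cx xz]]] := cc_cover z.
by exists k, x, x; split=> //; exact: cnear_refl.
Qed.

Lemma star_le z e e' : e <= e' -> star z e `<=` star z e'.
Proof.
move=> ee w [k [x [y [cx cy xz yw xy]]]].
by exists k, x, y; split=> //; exact: cnear_le xy.
Qed.

Lemma open_cube_preimage n (T : Type) (f : 'rV[R]_n -> T) (A : set T) :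
  open (f @^-1` A : set (subspace (@cube R n))) <->
  forall y, cube y -> A (f y) ->
    exists2 e, 0 < e & forall y', cube y' -> cnear e y y' -> A (f y').
Proof.
split=> [oA y cy Ay|h].
  have : nbhs (y : subspace (@cube R n)) (f @^-1` A) by apply: open_nbhs_nbhs.
  case: (@nbhs_subspaceP _ (@cube R n) y) => // _ /nbhs_ballP[e /= e0 he].
  exists e => // y' cy' yy'; apply: he => //; split=> // i j.
  by rewrite ord1; exact: yy'.
rewrite openE => y Ay; rewrite /interior.
case: (@nbhs_subspaceP _ (@cube R n) y) => [cy|ncy]; last by move=> ? ->.
have [e e0 he] := h _ cy Ay.
by apply/nbhs_ballP; exists e => //= y' [_ yy'] cy'; apply: he => // i; exact: yy'.
Qed.

Lemma open_cubes (A : set X) : open A <->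
  forall k (y : 'rV[R]_(cc_dim k)), cube y -> A (cc_char y) ->
  exists2 e, 0 < e & forall y' : 'rV[R]_(cc_dim k), cube y' -> cnear e y y' -> A (cc_char y').
Proof.
rewrite cc_quotient_topology.
by split=> h k; apply/open_cube_preimage; exact: h.
Qed.

Lemma star_open z e : good_radius z e -> open (star z e).
Proof.
move=> ge; have e0 : 0 < e <= e by case: ge => /andP[-> _] _ /=.
apply/open_cubes => k y cy yw.
have [x [cx xz xy]] := star_rep ge e0 yw cy erefl.
have [d d0 [_ hd]] := cnear_slack (andP e0).1 xy.
exists d => // y' cy' yy'; exists k, x, y'; split=> //.
by rewrite -(subrK d e); exact: cnear_trans hd yy'.
Qed.

Lemma star_nbhs z e : good_radius z e -> nbhs z (star z e).
Proof.
move=> ge; apply: open_nbhs_nbhs; split; first exact: star_open.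
by apply: star_self; case: ge => /andP[].
Qed.

End star_of_point.
End stars.

(** * Compactness and neighbourhood bases of stars *)

Section compactness.
Variable R : realType.

(** Finite data determining the open face that contains [x]: the free directions, and the signs
    which locate the remaining coordinates. *)
Definition position n (x : 'rV[R]_n) := (free x, [set i | 0 < x 0 i]%SET).

Lemma position_supp n (x y : 'rV[R]_n) : cube x -> cube y ->
  position x = position y -> supp x = supp y.
Proof.
move=> cx cy [E1 /setP E2]; rewrite /supp -!/(free _) E1; apply: face_eq => i yi.
have := E2 i; rewrite !inE.
have := free_normr cy yi; rewrite -E1 in yi; have := free_normr cx yi.
have [x0|x0] := lerP 0 (x 0 i); have [y0|y0] := lerP 0 (y 0 i);
  rewrite ?(ger0_norm x0) ?(ltr0_norm x0) ?(ger0_norm y0) ?(ltr0_norm y0) => ? ?; lra.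
Qed.

(** A set with at most one point in each open face is finite, since [position] takes finitely many
    values; so the radii have a common positive lower bound. *)
Lemma sparse_radius n (C : set 'rV[R]_n) (Q : 'rV[R]_n -> R -> Prop) :
  (forall x, C x -> cube x) ->
  (forall x x', C x -> C x' -> supp x = supp x' -> x = x') ->
  (forall x e e', 0 < e' -> e' <= e -> Q x e -> Q x e') ->
  (forall x, C x -> exists2 e, 0 < e & Q x e) ->
  exists2 e, 0 < e & forall x, C x -> Q x e.
Proof.
move=> Ccube Cuniq Qmono Qex.
have [||e e0 he] := @finite_radius R _ (fun t e => forall x, C x -> position x = t -> Q x e).
- by move=> t e e' e'0 ee h x Cx xt; apply: Qmono (h x Cx xt).
- move=> t; have [[x [Cx xt]]|nx] := pselect (exists x, C x /\ position x = t).
    have [e e0 he] := Qex _ Cx; exists e => // x' Cx' x't.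
    rewrite (Cuniq x' x) //; apply: position_supp; [exact: Ccube|exact: Ccube|].
    by rewrite x't.
  by exists 1 => // x Cx xt; case: nx; exists x.
by exists e => // x Cx; exact: he.
Qed.

Variable X : cube_complex R.

(** A weak neighbourhood may shrink at a different rate in each cube, so this can fail where
    infinitely many cubes meet. *)
Definition star_basis := forall (z : X) (U : set X), nbhs z U ->
  exists2 e, 0 < e & star z e `<=` U.

Definition finitely_covered := exists (J : finType) (K : J -> cc_cube X),
  forall z, exists j (x : 'rV[R]_(cc_dim (K j))), cube x /\ cc_char x = z.

(** Each of the finitely many cubes contains finitely many preimages of [z], so one radius serves
    them all; [star_rep] moves any point of the star into one of these cubes. *)
Lemma finitely_covered_star_basis : finitely_covered -> star_basis.
Proof.
move=> [J [K hK]] z U; rewrite nbhsE => -[V [oV Vz] VU].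
have [e0 ge] := good_radius_exists z.
have /open_cubes hV := oV.
have [||e e1 he] := @finite_radius R J (fun j e => forall x : 'rV[R]_(cc_dim (K j)),
    cube x /\ cc_char x = z -> forall y, cube y -> cnear e x y -> V (cc_char y)).
- by move=> j e e' _ ee h x cx y cy xy; apply: (h x cx y cy); exact: cnear_le xy.
- move=> j; apply: sparse_radius.
  + by move=> x [].
  + by move=> x x' [cx xz] [cx' x'z] ss; apply: cc_inj => //; rewrite xz.
  + by move=> x e e' _ ee h y cy xy; apply: (h y cy); exact: cnear_le xy.
  + by move=> x [cx xz]; apply: hV => //; rewrite xz.
have [e00 _] := ge; have /andP[e00' _] := e00.
exists (Order.min e e0); first by rewrite lt_min e1.
move=> w sw; apply: VU; have [j [y [cy yw]]] := hK w.
have m0 : 0 < Order.min e e0 <= e0 by rewrite lt_min e1 e00' ge_min lexx orbT.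
have [x [cx xz xy]] := star_rep ge m0 sw cy yw.
rewrite -yw; apply: (he j x) => //.
by apply: cnear_le xy; rewrite ge_min lexx.
Qed.

Definition same_cell (z w : X) := exists k (x y : 'rV[R]_(cc_dim k)),
  [/\ cube x, cube y, cc_char x = z, cc_char y = w & supp x = supp y].

(** Gluing along the common support moves the pair into any cube through [w]. Transitivity follows,
    and so does the fact that a cube meeting an open cell contains all of it. *)
Lemma same_cell_cube (z w : X) k (y : 'rV[R]_(cc_dim k)) : same_cell z w ->
  cube y -> cc_char y = w ->
  exists2 x : 'rV[R]_(cc_dim k), cube x & cc_char x = z /\ supp x = supp y.
Proof.
move=> [k' [x' [y' [cx' cy' x'z y'w ss]]]] cy yw.
have [h [ih hc hy]] := glue_pt cy' cy (etrans y'w (esym yw)).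
have sx' : supp y' x' by rewrite -ss; exact: face_self.
have [chx hx] : supp y (h x') by case: ih => <- _; exists x'.
exists (h x') => //; split; first by rewrite -hc.
have E : free (h x') = free y.
  have Ex : free x' = free y'.
    by apply: supp_free => //; rewrite ss; exact: face_self.
  apply/setP => j; have [jS|jS] := boolP (j \in free y).
    have [/(_ j jS)[i iS [a [a1 ha]]] _] := isometry_coord cy' cy ih.
    by rewrite inE ha ?normrM ?a1 ?mul1r //; move: iS; rewrite -/(free _) -Ex inE.
  by rewrite inE hx // free_normr // ltxx.
by rewrite /supp -!/(free _) E; apply: face_eq.
Qed.

Lemma same_cell_refl z : same_cell z z.
Proof. by have [k [x [cx xz]]] := cc_cover z; exists k, x, x. Qed.

Lemma same_cell_sym z w : same_cell z w -> same_cell w z.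
Proof. by move=> [k [x [y [? ? ? ? ?]]]]; exists k, y, x. Qed.

Lemma same_cell_trans z w u : same_cell z w -> same_cell w u -> same_cell z u.
Proof.
move=> zw [k [x [y [cx cy xw yu ss]]]].
have [x' cx' [x'z ss']] := same_cell_cube zw cx xw.
by exists k, x', y; split=> //; rewrite ss'.
Qed.

(* A transversal of the open cells is closed and discrete, hence finite. *)
Lemma compact_finitely_covered : compact [set: X] -> finitely_covered.
Proof.
move=> cX.
have [/asboolP[x0 _]|nX] := boolP `[< exists z : X, True >]; last first.
  have nX' (z : X) : False by move/asboolPn: nX; apply; exists z.
  by exists void, (fun v : void => match v with end) => z; case: (nX' z).
pose rep (z : X) := xget x0 [set w | same_cell w z].
have repP z : same_cell (rep z) z.
  by apply: (@xgetPex _ x0 [set w | same_cell w z]); exists z; exact: same_cell_refl.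
have repE z w : same_cell z w -> rep z = rep w.
  move=> zw; rewrite /rep; congr xget; rewrite eqEsubset; split=> u /= uz.
    exact: same_cell_trans zw.
  exact/(same_cell_trans uz)/same_cell_sym.
pose A := range rep.
(* [U a] meets the transversal [A] in [a] alone, so a finite subfamily covering the complex forces
   [A] to be finite. It is open because [A] has at most one point in each open face of a cube. *)
pose U a := ~` (A `\ a).
have oU a : open (U a).
  apply/open_cubes => k y cy Uy.
  pose C := [set x : 'rV[R]_(cc_dim k) | cube x /\ (A `\ a) (cc_char x)].
  have [||||e e0 he] := @sparse_radius _ C (fun x e => ~ cnear e y x).
  - by move=> x [].
  - move=> x x' [cx [[w _ wx] _]] [cx' [[w' _ wx'] _]] ss.
    have sc : same_cell (cc_char x) (cc_char x') by exists k, x, x'.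
    apply: cc_inj => //; rewrite -wx -wx'; apply: repE.
    apply: (same_cell_trans (same_cell_sym (repP w))); rewrite wx.
    by apply: same_cell_trans sc _; rewrite -wx'; exact: repP.
  - by move=> x e e' _ ee h /(cnear_le ee).
  - move=> x [cx Ax]; apply: contrapT => h.
    have xy : y = x.
      apply/rowP => i; apply/eqP; rewrite -subr_eq0 -normr_le0 leNgt; apply/negP => yx.
      by apply: h; exists `|y 0 i - x 0 i| => // /(_ i); rewrite ltxx.
    by apply: Uy; rewrite xy.
  - by exists e => // y' cy' yy' Ay'; apply: (he y').
have [D DA cD] : finite_subset_cover A U [set: X].
  pose PX : ptopologicalType := HB.pack (cc_space X) (isPointed.Build (cc_space X) x0).
  have : @cover_compact PX [set: X] by rewrite -(@compact_cover PX).
  apply; first by move=> a _; exact: (oU a).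
  move=> z _; exists (rep z); first by exists z.
  move=> [[w _ wz] nz]; apply: nz => /=.
  by rewrite -wz; apply: repE; exact/same_cell_sym/repP.
have AD a : A a -> a \in D.
  move=> Aa; have [b /= bD Ub] := cD a I.
  have [->|/eqP nab] := eqVneq a b; first exact: bD.
  by exfalso; apply: Ub.
have /choice[K hK] : forall a : X, exists k, exists x : 'rV[R]_(cc_dim k), cube x /\ cc_char x = a.
  by move=> a; exact: cc_cover.
exists _, (fun j : D => K (val j)) => z.
have rD : rep z \in D by apply: AD; exists z.
have [x [cx xr]] := hK (rep z).
have [y cy [yz _]] := same_cell_cube (same_cell_sym (repP z)) cx xr.
by exists (FSetSub rD), y.
Qed.

End compactness.

(** * Straight segments in cubes *)

Section segments.
Variable R : realType.

Lemma in01_0 : (0 : R) <= (0 : R) <= (1 : R).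
Proof. by apply/andP; split; [exact: lexx|exact: ler01]. Qed.

Lemma in01_1 : (0 : R) <= (1 : R) <= (1 : R).
Proof. by apply/andP; split; [exact: ler01|exact: lexx]. Qed.

Definition lerp n (x y : 'rV[R]_n) (t : R) : 'rV[R]_n := x + t *: (y - x).

Lemma lerpE n (x y : 'rV[R]_n) t i : lerp x y t 0 i = x 0 i + t * (y 0 i - x 0 i).
Proof. by rewrite !mxE. Qed.

Lemma lerp0 n (x y : 'rV[R]_n) : lerp x y 0 = x.
Proof. by rewrite /lerp scale0r addr0. Qed.

Lemma lerp1 n (x y : 'rV[R]_n) : lerp x y 1 = y.
Proof. by rewrite /lerp scale1r addrC subrK. Qed.

Lemma lerp_cube n (x y : 'rV[R]_n) t : cube x -> cube y -> 0 <= t <= 1 ->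
  cube (lerp x y t).
Proof.
move=> cx cy /andP[t0 t1] i; rewrite lerpE; have := cx i; have := cy i.
rewrite !ler_norml => /andP[? ?] /andP[? ?]; nra.
Qed.

Lemma lerp_face n (z x y : 'rV[R]_n) S t : face z S x -> face z S y ->
  0 <= t <= 1 -> face z S (lerp x y t).
Proof.
move=> [cx hx] [cy hy] t01; split; first exact: lerp_cube.
by move=> i iS; rewrite lerpE hx // hy // subrr mulr0 addr0.
Qed.

(** A signed permutation of coordinates is affine. *)
Lemma isometry_lerp n m (x : 'rV[R]_n) S (x' : 'rV[R]_m) S' h y z t :
  cube x -> cube x' -> isometry_onto (face x S) (face x' S') h ->
  face x S y -> face x S z -> 0 <= t <= 1 ->
  h (lerp y z t) = lerp (h y) (h z) t.
Proof.
move=> cx cx' ih fy fz t01; apply/rowP => j; rewrite lerpE.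
have fh u : face x S u -> face x' S' (h u) by case: ih => <- _ fu; exists u.
have fl := lerp_face fy fz t01.
have [jS|jS] := boolP (j \in S'); last first.
  by rewrite !(fh _ _).2 // subrr mulr0 addr0.
have [/(_ j jS)[i iS [a [a1 ha]]] _] := isometry_coord cx cx' ih.
by rewrite !ha // lerpE; ring.
Qed.

Lemma row_within_continuous (T : topologicalType) (A : set T) n (u : T -> 'rV[R]_n) :
  (forall i, {within A, continuous (fun z => u z 0 i)}) ->
  {within A, continuous u}.
Proof.
move=> cu; apply/subspace_continuousP => z Az; apply/cvg_ballP => e e0.
have h : \forall w \near within A (nbhs z), forall i, ball (u z 0 i) e (u w 0 i).
  apply: filter_forall => i.
  by have /subspace_continuousP /(_ z Az) /cvg_ballP /(_ e e0) := cu i.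
apply: filterS h => w hw; split=> // i j; rewrite ord1; exact: hw.
Qed.

Lemma row_continuous (T : topologicalType) n (u : T -> 'rV[R]_n) (A : set T) :
  (forall i, continuous (fun z => u z 0 i)) -> {within A, continuous u}.
Proof. by move=> cu; apply: row_within_continuous => i; exact: continuous_subspaceT. Qed.

Lemma convex01 (s u v : R) : 0 <= s <= 1 -> 0 <= u <= 1 -> 0 <= v <= 1 ->
  0 <= (1 - s) * u + s * v <= 1.
Proof.
move=> /andP[s0 s1] /andP[u0 u1] /andP[v0 v1].
have : 0 <= (1 - s) * (1 - u) by apply: mulr_ge0; lra.
have : 0 <= (1 - s) * u by apply: mulr_ge0; lra.
have : 0 <= s * (1 - v) by apply: mulr_ge0; lra.
have : 0 <= s * v by apply: mulr_ge0; lra.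
by move=> *; apply/andP; split; lra.
Qed.

Variable X : cube_complex R.

Lemma char_continuous k : {within @cube R (cc_dim k), continuous (@cc_char R X k)}.
Proof. by apply/continuousP => A /cc_quotient_topology; exact. Qed.

Lemma seg_continuous k (x y : 'rV[R]_(cc_dim k)) : cube x -> cube y ->
  {within `[0, 1], continuous (fun t => cc_char (lerp x y t) : X)}.
Proof.
move=> cx cy; apply: (within_comp _ _ (@char_continuous k)).
  by move=> t; rewrite /= in_itv => /(lerp_cube cx cy).
apply: row_continuous => i.
rewrite (_ : (fun t => _) = (fun t => (y 0 i - x 0 i) * t + x 0 i)).
  exact/lin_continuous/id_continuous.
by apply/funext => t; rewrite lerpE; ring.
Qed.

Definition seg k (x y : 'rV[R]_(cc_dim k)) (cx : cube x) (cy : cube y) :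
    cpath R (cc_char x : X) (cc_char y) :=
  CPath (seg_continuous cx cy) (congr1 (@cc_char R X k) (lerp0 x y))
    (congr1 (@cc_char R X k) (lerp1 x y)).

Lemma convex_homotopic (D : set (R * R)) (T : topologicalType) (K : R * R -> T)
    (a b : R -> R * R) (x y : T) (p q : cpath R x y) :
  {within D, continuous K} -> continuous a -> continuous b ->
  (forall s t, 0 <= s <= 1 -> 0 <= t <= 1 ->
    D ((1 - s) * (a t).1 + s * (b t).1, (1 - s) * (a t).2 + s * (b t).2)) ->
  (forall t, 0 <= t <= 1 -> p t = K (a t) /\ q t = K (b t)) ->
  (forall s, 0 <= s <= 1 ->
    K ((1 - s) * (a 0).1 + s * (b 0).1, (1 - s) * (a 0).2 + s * (b 0).2) = x /\
    K ((1 - s) * (a 1).1 + s * (b 1).1, (1 - s) * (a 1).2 + s * (b 1).2) = y) ->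
  homotopic p q.
Proof.
move=> cK ca cb ab pq e01.
exists (fun z => K ((1 - z.1) * (a z.2).1 + z.1 * (b z.2).1,
                    (1 - z.1) * (a z.2).2 + z.1 * (b z.2).2)); split.
- apply: (within_comp (B := D) (f := fun z : R * R => ((1 - z.1) * (a z.2).1 + z.1 * (b z.2).1,
                    (1 - z.1) * (a z.2).2 + z.1 * (b z.2).2))) => //.
    by move=> [s t] /unit_squareE /= [s01 t01]; exact: ab.
  apply: continuous_subspaceT.
  have c1 : continuous (fun z : R * R => 1 - z.1).
    by move=> z; apply: cvgB; [exact: cvg_cst|exact: cvg_fst].
  have comp (f : R * R -> R) (g : R -> R * R) : continuous f -> continuous g ->
      continuous (fun z : R * R => f (g z.2)).
    move=> cf cg z; apply: (@continuous_comp _ _ _ (fun z : R * R => g z.2) f); last exact: cf.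
    by apply: (@continuous_comp _ _ _ snd g); [exact: cvg_snd|exact: cg].
  apply: pair_continuous => z; apply: cvgD; apply: cvgM;
    by [exact: c1|exact: cvg_fst|exact: (comp fst _ (@fst_continuous R) _ _)|
        exact: (comp snd _ (@snd_continuous R) _ _)].
- move=> t /pq [-> ->] /=; rewrite subr0 subrr !mul1r !mul0r !addr0 !add0r.
  by split; congr (K _); rewrite -surjective_pairing.
- by move=> s /e01.
Qed.

Lemma square_homotopic (T : topologicalType) (K : R * R -> T) (a b : R -> R * R)
    (x y : T) (p q : cpath R x y) :
  {within unit_square R, continuous K} -> continuous a -> continuous b ->
  (forall t, 0 <= t <= 1 -> unit_square R (a t) /\ unit_square R (b t)) ->
  (forall t, 0 <= t <= 1 -> p t = K (a t) /\ q t = K (b t)) ->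
  (forall s, 0 <= s <= 1 ->
    K ((1 - s) * (a 0).1 + s * (b 0).1, (1 - s) * (a 0).2 + s * (b 0).2) = x /\
    K ((1 - s) * (a 1).1 + s * (b 1).1, (1 - s) * (a 1).2 + s * (b 1).2) = y) ->
  homotopic p q.
Proof.
move=> cK ca cb ab; apply: convex_homotopic => // s t /andP[s0 s1] /ab [].
move=> /unit_squareE[/andP[? ?] /andP[? ?]] /unit_squareE[/andP[? ?] /andP[? ?]].
by apply/unit_squareE; split=> /=; apply: convex01; apply/andP; split.
Qed.

(** The radius [r + r] comes from here: [h x] and [x'] are both within [r] of [y'], hence within
    [r + r] of each other, where [good_uniq] makes them equal. *)
Lemma star_glue (z : X) r k (x y : 'rV[R]_(cc_dim k)) k' (x' y' : 'rV[R]_(cc_dim k')) :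
  good_radius z (r + r) -> cube x -> cube y -> cube x' -> cube y' ->
  cc_char x = z -> cc_char x' = z -> cnear r x y -> cnear r x' y' ->
  cc_char y = cc_char y' -> exists h,
  [/\ isometry_onto (supp y) (supp y') h,
   (forall u, supp y u -> cc_char u = cc_char (h u)), h y = y', supp y x & h x = x'].
Proof.
move=> ge cx cy cx' cy' xz x'z xy xy' yy'.
have [r0 _ ge'] := good_radius_half ge.
have [h [ih hc hy sx hn]] := star_transport ge' cx cy xz xy cy' (esym yy').
exists h; split=> //.
have [chx _] : supp y' (h x) by case: ih => <- _; exists x.
apply: (good_uniq ge) => //; first by rewrite -hc.
exact: cnear_trans (hn _ r0 xy) (cnear_sym xy').
Qed.

(* Two cubes meeting at a point of the star meet along a face which also contains
   the centre, so straight segments to the centre do not depend on the cube. *)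
Lemma radial_exists (z : X) r w : good_radius z (r + r) -> star z r w ->
  exists f : R -> X, forall k (x y : 'rV[R]_(cc_dim k)), cube x -> cube y ->
    cc_char x = z -> cc_char y = w -> cnear r x y ->
    forall s, 0 <= s <= 1 -> f s = cc_char (lerp x y s).
Proof.
move=> ge [k [x [y [cx cy xz yw xy]]]].
exists (fun s => cc_char (lerp x y s)) => k' x' y' cx' cy' x'z y'w xy' s s01.
have [h [ih hc hy sx hx]] :=
  star_glue ge cx cy cx' cy' xz x'z xy xy' (etrans yw (esym y'w)).
have sy : supp y y by exact: face_self.
by rewrite hc ?(isometry_lerp cy cy' ih) // ?hx ?hy //; exact: lerp_face.
Qed.

Definition radial (z : X) r w : R -> X := xget (fun=> z)
  [set f : R -> X | forall k (x y : 'rV[R]_(cc_dim k)), cube x -> cube y ->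
    cc_char x = z -> cc_char y = w -> cnear r x y ->
    forall s, 0 <= s <= 1 -> f s = cc_char (lerp x y s)].

Lemma radialE (z : X) r k (x y : 'rV[R]_(cc_dim k)) s :
  good_radius z (r + r) -> cube x -> cube y ->
  cc_char x = z -> cnear r x y -> 0 <= s <= 1 ->
  radial z r (cc_char y) s = cc_char (lerp x y s).
Proof.
move=> ge cx cy xz xy s01.
have sw : star z r (cc_char y) by exists k, x, y.
by have := xgetPex (fun=> z) (radial_exists ge sw); apply.
Qed.

Hypothesis Xbasis : star_basis X.

(** For [t] near [t0] the centre, [q t0] and [q t] have representatives in one cube, where the two
    radial segments are compared coordinate by coordinate; [Xbasis] makes this estimate sufficient
    for continuity. *)
Lemma radial_continuous (z : X) r (q : R -> X) : good_radius z (r + r) ->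
  {within `[0, 1], continuous q} -> (forall t, 0 <= t <= 1 -> star z r (q t)) ->
  {within unit_square R, continuous (fun u => radial z r (q u.2) u.1)}.
Proof.
move=> ge cq hq; apply/subspace_continuousP => -[s0 t0] /unit_squareE/= [s001 t001].
have [r0 r1 ge'] := good_radius_half ge.
have [k [x [y0 [cx cy0 xz y0w xy0]]]] := hq _ t001.
have E0 : radial z r (q t0) s0 = cc_char (lerp x y0 s0) by rewrite -y0w (radialE ge cx cy0 xz xy0).
rewrite /from_subspace /= E0 => V /Xbasis[e e0 eV].
have [d d0 [dr hd]] := cnear_slack r0 xy0.
have [e1 ge1] := good_radius_exists (q t0).
(* The slack [d] keeps [q t] within [r] of the centre, [e / 2] leaves room for the two terms of the
   final estimate, and [e1] makes the star of [q t0] a neighbourhood. *)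
pose del := Num.min (Num.min d (e / 2)) e1.
have e10 : 0 < e1 by case: ge1 => /andP[].
have del0 : 0 < del by rewrite /del !lt_min e10 d0 divr_gt0.
have deld : del <= d by rewrite /del !ge_min lexx.
have dele : del <= e / 2 by rewrite /del !ge_min lexx orbT.
have ge2 : good_radius (q t0) del by apply: good_radius_le ge1 _ _; rewrite // /del ge_min lexx orbT.
have nq : \forall t \near within `[0, 1] (nbhs t0), star (q t0) del (q t).
  have /subspace_continuousP /(_ t0) := cq; rewrite /= in_itv /= => /(_ t001) h.
  exact: (h _ (star_nbhs ge2)).
have nq2 : \forall u \near (s0, t0), u.2 \in `[0, 1] -> star (q t0) del (q u.2).
  exact: (@cvg_snd _ _ (nbhs s0) (nbhs t0) _ _ nq).
have ns : \forall u \near (s0, t0), `|s0 - u.1| < del.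
  exact: (@cvg_fst _ _ (nbhs s0) (nbhs t0) _ _ (nbhsx_ballx s0 del del0)).
rewrite /= nbhs_simpl /= /within /=.
apply: filterS2 nq2 ns => -[s t] /= hqt hs /unit_squareE[/= s01 t01].
have : star (q t0) del (q t) by apply: hqt; rewrite in_itv.
move=> [k' [y0' [y [cy0' cy y0'w yw yy]]]].
have [h [ih hc hy sx hn]] := star_transport ge' cx cy0 xz xy0 cy0' (etrans y0'w (esym y0w)).
have [cx' _] : supp y0' (h x) by case: ih => <- _; exists x.
have x'z : cc_char (h x) = z by rewrite -hc.
have hd' : cnear (r - d) (h x) y0'.
  by apply: hn => //; rewrite subr_gt0.
have xy : cnear r (h x) y.
  by rewrite -(subrK d r); apply: cnear_trans hd' (cnear_le deld yy).
rewrite -yw (radialE ge cx' cy x'z xy) //; apply: eV.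
exists k', (lerp (h x) y0' s0), (lerp (h x) y s); split; try exact: lerp_cube.
- have hd'' : cnear r (h x) y0' by apply: cnear_le hd'; lra.
  by rewrite -(radialE ge cx' cy0' x'z hd'' s001) y0'w -E0.
- by [].
move=> i; rewrite !lerpE.
have -> : h x 0 i + s0 * (y0' 0 i - h x 0 i) - (h x 0 i + s * (y 0 i - h x 0 i)) =
    s * (y0' 0 i - y 0 i) + (s0 - s) * (y0' 0 i - h x 0 i) by ring.
apply: le_lt_trans (ler_normD _ _) _; rewrite !normrM.
have h1 : `|s| * `|y0' 0 i - y 0 i| < del.
  have /andP[s_0 s_1] := s01; rewrite ger0_norm //.
  by apply: le_lt_trans (yy i); rewrite ler_piMl.
have h2 : `|s0 - s| * `|y0' 0 i - h x 0 i| <= del.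
  have := hd' i; rewrite distrC => h3; rewrite -[del]mulr1.
  apply: ler_pM => //; first exact: ltW hs.
  by apply: le_trans (ltW h3) _; lra.
by lra.
Qed.

(** Radial contraction. The square [K (s, t)] is at the centre on its sides [s = 0] and [t = 0], is
    [q] on the side [s = 1] and the segment on the side [t = 1]; both of these are homotopic to its
    diagonal. *)
Lemma star_path_homotopic r k (x y : 'rV[R]_(cc_dim k)) (cx : cube x) (cy : cube y)
    (q : cpath R (cc_char x : X) (cc_char y)) :
  good_radius (cc_char x : X) (r + r) -> cnear r x y ->
  (forall t, 0 <= t <= 1 -> star (cc_char x : X) r (q t)) ->
  homotopic q (seg cx cy).
Proof.
move=> ge xy hq; have [r0 _ _] := good_radius_half ge.
pose K u := radial (cc_char x : X) r (q u.2) u.1.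
have cK : {within unit_square R, continuous K}.
  by apply: radial_continuous => //; exact: cpath_continuous.
have h01 := in01_0; have h11 := in01_1.
have K0 t : 0 <= t <= 1 -> K (0, t) = cc_char x.
  move=> /hq [k' [x' [y' [cx' cy' x'z y'q xy']]]].
  by rewrite /K /= -y'q (radialE ge cx' cy' x'z xy') // lerp0.
have K1 t : 0 <= t <= 1 -> K (1, t) = q t.
  move=> /hq [k' [x' [y' [cx' cy' x'z y'q xy']]]].
  by rewrite /K /= -y'q (radialE ge cx' cy' x'z xy') // lerp1.
have Kx t : 0 <= t <= 1 -> K (t, 0) = cc_char x.
  move=> t01; rewrite /K /= cpath0 (radialE ge cx cx erefl (cnear_refl _ r0)) //.
  by rewrite /lerp subrr scaler0 addr0.
have Ky t : 0 <= t <= 1 -> K (t, 1) = cc_char (lerp x y t).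
  by move=> t01; rewrite /K /= cpath1 (radialE ge cx cy erefl xy).
have cid := @id_continuous R.
have cc (a : R) : continuous (fun _ : R => a) by move=> ?; exact: cvg_cst.
have cd : {within `[0, 1], continuous (fun t => K (t, t))}.
  apply: (within_comp _ _ cK (f := fun t => (t, t))).
    by move=> t; rewrite /= in_itv => t01; apply/unit_squareE.
  exact/continuous_subspaceT/pair_continuous.
pose d : cpath R (cc_char x : X) (cc_char y) :=
  CPath cd (Kx 0 h01) (etrans (K1 1 h11) (cpath1 q)).
apply: (@homotopic_trans _ _ _ _ _ d).
  apply: (square_homotopic (a := fun t => (1, t)) (b := fun t => (t, t)) cK).
  - exact: pair_continuous.
  - exact: pair_continuous.
  - by move=> t t01; split; apply/unit_squareE.
  - by move=> t t01; rewrite K1.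
  - move=> s /andP[s0 s1] /=; rewrite !mulr0 !mulr1 !addr0 subrK.
    by rewrite Kx ?K1 ?cpath1 //; lra.
apply: (square_homotopic (a := fun t => (t, t)) (b := fun t => (t, 1)) cK).
- exact: pair_continuous.
- exact: pair_continuous.
- by move=> t t01; split; apply/unit_squareE.
- by move=> t t01; rewrite Ky.
- move=> s s01 /=; rewrite !mulr0 !mulr1 !addr0 add0r subrK.
  by rewrite K0 ?K1 ?cpath1.
Qed.


End segments.

(** * Homotopies inside one cube *)

Section cube_paths.
Variables (R : realType) (Z : cube_complex R).

Lemma cube_homotopic k (a b : R -> 'rV[R]_(cc_dim k)) (x y : Z) (p q : cpath R x y) :
  (forall i, continuous (fun t => a t 0 i)) ->
  (forall i, continuous (fun t => b t 0 i)) ->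
  (forall t, 0 <= t <= 1 -> cube (a t) /\ cube (b t)) ->
  a 0 = b 0 -> a 1 = b 1 ->
  (forall t, 0 <= t <= 1 -> p t = cc_char (a t) /\ q t = cc_char (b t)) ->
  homotopic p q.
Proof.
move=> ca cb cab e0 e1 pq.
have lxx (x' : 'rV[R]_(cc_dim k)) s : lerp x' x' s = x' by rewrite /lerp subrr scaler0 addr0.
exists (fun z => cc_char (lerp (a z.2) (b z.2) z.1)); split.
- apply: (within_comp _ _ (@char_continuous _ Z k)).
    move=> [s t] /unit_squareE /= [s01 /cab[? ?]]; exact: lerp_cube.
  apply: row_continuous => i.
  rewrite (_ : (fun z => _) = (fun z => a z.2 0 i + z.1 * (b z.2 0 i - a z.2 0 i))); last first.
    by apply/funext => z; rewrite lerpE.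
  have comp (f : R -> R) : continuous f -> continuous (fun z : R * R => f z.2).
    by move=> cf z; apply: (@continuous_comp _ _ _ snd f); [exact: cvg_snd|exact: cf].
  move=> z; apply: cvgD; first exact: (comp (fun t => a t 0 i)).
  apply: cvgM; first exact: cvg_fst.
  by apply: cvgB; [exact: (comp (fun t => b t 0 i))|exact: (comp (fun t => a t 0 i))].
- by move=> t /pq[-> ->] /=; rewrite lerp0 lerp1.
- move=> s s01 /=; rewrite -e0 -e1 !lxx -(pq _ (in01_0 R)).1 -(pq _ (in01_1 R)).1.
  by rewrite cpath0 cpath1.
Qed.

Lemma seg_refl_homotopic k (x : 'rV[R]_(cc_dim k)) (cx cx' : cube x) :
  homotopic (seg cx cx') (cpath_cst R (cc_char x : Z)).
Proof.
apply: (@cube_homotopic k (fun=> x) (fun=> x)) => //.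
- by move=> i t; exact: cvg_cst.
- by move=> i t; exact: cvg_cst.
- by move=> t _; split=> //=; rewrite /lerp subrr scaler0 addr0.
Qed.

Lemma seg_cat_homotopic k (x y z : 'rV[R]_(cc_dim k)) (cx : cube x) (cy : cube y)
    (cz : cube z) :
  homotopic (cpath_cat (seg cx cy) (seg cy cz)) (seg cx cz : cpath R (_ : Z) _).
Proof.
(* [m] moves only during the first half of the time and [M] only during the second, which gives the
   broken path a single formula, visibly continuous in each coordinate. *)
pose m t := Num.min (2 * t + 0) 1 : R; pose M t := Num.max (2 * t + -1) 0 : R.
have cm : continuous m.
  apply: minr_continuous; last by move=> ?; exact: cvg_cst.
  exact/lin_continuous/id_continuous.
have cM : continuous M.
  apply: maxr_continuous; last by move=> ?; exact: cvg_cst.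
  exact/lin_continuous/id_continuous.
pose a t := if t <= 1 / 2 then lerp x y (2 * t) else lerp y z (2 * t - 1).
have aE t i : a t 0 i = (y 0 i - x 0 i) * m t + ((z 0 i - y 0 i) * M t + x 0 i).
  rewrite /a /m /M; case: ifPn; rewrite -?ltNge lerpE => ht.
    rewrite min_l ?max_r; [ring|lra|lra].
  rewrite min_r ?max_l; [ring|lra|lra].
apply: (@cube_homotopic k a (lerp x z)).
- move=> i; rewrite (_ : (fun t => a t 0 i) =
      (fun t => (y 0 i - x 0 i) * m t + ((z 0 i - y 0 i) * M t + x 0 i))).
    2: by apply/funext => t; exact: aE.
  move=> t; apply: cvgD; first by apply: cvgM; [exact: cvg_cst|exact: cm].
  apply: cvgD; last exact: cvg_cst.
  by apply: cvgM; [exact: cvg_cst|exact: cM].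
- move=> i; rewrite (_ : (fun t => lerp x z t 0 i) = (fun t => (z 0 i - x 0 i) * t + x 0 i)).
    exact/lin_continuous/id_continuous.
  by apply/funext => t; rewrite lerpE; ring.
- move=> t t01; split; last exact: lerp_cube.
  by rewrite /a; case: ifPn; rewrite -?ltNge => ?; apply: lerp_cube => //; lra.
- by rewrite /a ifT ?mulr0 ?lerp0 //; lra.
- rewrite /a ifF; last by apply/negP => ?; lra.
  by rewrite (_ : 2 * 1 - 1 = 1) ?lerp1 //; lra.
- move=> t t01; split=> //=; rewrite /cat_fun /a.
  by case: ifP.
Qed.

End cube_paths.

(** * Homotopies of images and the induced map of fundamental groups *)

Section homotopies.
Variables (R : realType) (X : topologicalType).

Lemma homotopic_ext (x y : X) (p q : cpath R x y) :
  (forall t, 0 <= t <= 1 -> p t = q t) -> homotopic p q.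
Proof.
move=> pq; apply: (@homotopic_reparam _ _ _ _ p p q id id) => //.
- exact: id_continuous.
- exact: id_continuous.
- by move=> t t01; rewrite pq.
Qed.

Lemma homotopic_rev_cat (x y z : X) (p : cpath R x y) (q : cpath R y z) :
  homotopic (cpath_rev (cpath_cat p q)) (cpath_cat (cpath_rev q) (cpath_rev p)).
Proof.
apply: homotopic_ext => t /andP[t0 t1] /=; rewrite /rev_fun /cat_fun.
case: ifPn; rewrite -?ltNge => h; case: ifPn; rewrite -?ltNge => h'.
- have -> : t = 1 / 2 by lra.
  have -> : 2 * (1 - 1 / 2) = 1 :> R by lra.
  have -> : 1 - 2 * (1 / 2) = 0 :> R by lra.
  by rewrite cpath1 cpath0.
- by congr (cpath_fun _ _); lra.
- by congr (cpath_fun _ _); lra.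
- by exfalso; lra.
Qed.

Lemma homotopic_map (Y : topologicalType) (f : X -> Y) (cf : continuous f)
    (x y : X) (p q : cpath R x y) :
  homotopic p q -> homotopic (cpath_map cf p) (cpath_map cf q).
Proof.
move=> [F [cF F0 F1]]; exists (f \o F); split.
- apply: (within_comp (B := setT)) => //; exact: continuous_subspaceT.
- by move=> t /F0 [/= -> ->].
- by move=> s /F1 [/= -> ->].
Qed.

End homotopies.

Lemma homotopic_map_cat (R : realType) (X Y : topologicalType) (f : X -> Y) (cf : continuous f)
    (x y z : X) (p : cpath R x y) (q : cpath R y z) :
  homotopic (cpath_map cf (cpath_cat p q)) (cpath_cat (cpath_map cf p) (cpath_map cf q)).
Proof. by apply: homotopic_ext => t _ /=; rewrite /cat_fun; case: ifP. Qed.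

Lemma pi1_classM (R : realType) (X : topologicalType) (x : X) (p q : cpath R x x) :
  pi1_class (cpath_cat p q) = (pi1_class p * pi1_class q)%g.
Proof. by rewrite -[RHS]/(pi1_mul _ _) pi1_mulE. Qed.

Lemma pi1_classV (R : realType) (X : topologicalType) (x : X) (p : cpath R x x) :
  pi1_class (cpath_rev p) = (pi1_class p)^-1%g.
Proof. by rewrite -[RHS]/(pi1_inv _) pi1_invE. Qed.

Section pi1_map.
Variables (R : realType) (X Y : topologicalType) (f : X -> Y).
Hypothesis cf : continuous f.
Variable x : X.

Definition pi1_map (u : pi1 R x) : pi1 R (f x) := pi1_class (cpath_map cf (repr u)).

Lemma pi1_mapE (l : cpath R x x) : pi1_map (pi1_class l) = pi1_class (cpath_map cf l).
Proof. by apply/pi1_classP/homotopic_map; exact: pi1_reprP. Qed.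

Lemma pi1_mapM : {morph pi1_map : u v / (u * v)%g}.
Proof.
elim/pi1_ind => p; elim/pi1_ind => q.
rewrite -pi1_classM !pi1_mapE -pi1_classM; apply/pi1_classP.
exact: homotopic_map_cat.
Qed.

End pi1_map.

(** * Classes of paths modulo a subgroup of the fundamental group *)

Record pi1_subgroup (R : realType) (Z : topologicalType) (z0 : Z) := Pi1Subgroup {
  sg_mem :> pi1 R z0 -> Prop;
  sg1 : sg_mem 1%g;
  sgM : forall u v, sg_mem u -> sg_mem v -> sg_mem (u * v)%g;
  sgV : forall u, sg_mem u -> sg_mem u^-1%g }.

Section path_classes.
Variables (R : realType) (Z : topologicalType) (z0 : Z) (H : pi1_subgroup R z0).

Lemma homotopic_cancelV (x y z : Z) (p : cpath R x y) (q : cpath R z y) :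
  homotopic (cpath_cat (cpath_cat p (cpath_rev q)) q) p.
Proof.
apply: homotopic_trans (homotopic_catp1 p).
apply: homotopic_trans (homotopic_sym (homotopic_catA _ _ _)) _.
by apply: homotopic_cat; [exact: homotopic_refl|exact: homotopic_catVp].
Qed.

Definition path_rel (z : Z) (p q : cpath R z0 z) : bool :=
  `[< H (pi1_class (cpath_cat p (cpath_rev q))) >].

Lemma path_rel_refl z : reflexive (@path_rel z).
Proof.
move=> p; apply/asboolP.
rewrite (_ : pi1_class _ = 1%g); first exact: sg1.
by apply/pi1_classP; exact: homotopic_catpV.
Qed.

Lemma pi1_class_catV z (p q r : cpath R z0 z) :
  pi1_class (cpath_cat p (cpath_rev r)) =
  (pi1_class (cpath_cat p (cpath_rev q)) * pi1_class (cpath_cat q (cpath_rev r)))%g.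
Proof.
rewrite -pi1_classM; apply/pi1_classP/homotopic_sym.
apply: homotopic_trans (homotopic_catA _ _ _) _.
by apply: homotopic_cat; [exact: homotopic_cancelV|exact: homotopic_refl].
Qed.

Lemma pi1_class_catVV z (p q : cpath R z0 z) :
  pi1_class (cpath_cat p (cpath_rev q)) = (pi1_class (cpath_cat q (cpath_rev p)))^-1%g.
Proof.
apply: (mulIg (pi1_class (cpath_cat q (cpath_rev p)))).
rewrite mulVg -pi1_class_catV; apply/pi1_classP; exact: homotopic_catpV.
Qed.

Lemma path_rel_sym z : symmetric (@path_rel z).
Proof.
by move=> p q; apply/asboolP/asboolP => h; rewrite pi1_class_catVV; exact: sgV.
Qed.

Lemma path_rel_trans z : transitive (@path_rel z).
Proof.
move=> q p r /asboolP pq /asboolP qr; apply/asboolP.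
by rewrite (pi1_class_catV p q); exact: sgM.
Qed.

Canonical path_equiv z :=
  EquivRel (@path_rel z) (@path_rel_refl z) (@path_rel_sym z) (@path_rel_trans z).

Definition cover_space : Type := {z : Z & {eq_quot path_equiv z}}.

Definition cover_proj (e : cover_space) : Z := projT1 e.

Definition cls z (p : cpath R z0 z) : cover_space := existT _ z (\pi_({eq_quot path_equiv z}) p)%qT.

Lemma clsP z (p q : cpath R z0 z) :
  cls p = cls q <-> H (pi1_class (cpath_cat p (cpath_rev q))).
Proof.
split=> [|h].
  move=> E; have := projT2_eq E; rewrite (Prop_irrelevance (projT1_eq E) erefl) /=.
  by move=> /eqmodP/asboolP.
by congr existT; apply/eqmodP/asboolP.
Qed.

Lemma cls_ind (P : cover_space -> Prop) :
  (forall z (p : cpath R z0 z), P (cls p)) -> forall e, P e.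
Proof. by move=> h [z u]; rewrite -[u]reprK; exact: h. Qed.

Lemma homotopic_cls z (p q : cpath R z0 z) : homotopic p q -> cls p = cls q.
Proof.
move=> pq; apply/clsP; rewrite (_ : pi1_class _ = 1%g); first exact: sg1.
apply/pi1_classP; apply: homotopic_trans (homotopic_catpV q).
by apply: homotopic_cat => //; exact: homotopic_refl.
Qed.

(** Lets a path be given a propositionally equal end point without casts, since only the values on
    the unit interval count. *)
Lemma cls_ext z z' (p : cpath R z0 z) (q : cpath R z0 z') :
  (forall t, 0 <= t <= 1 -> p t = q t) -> cls p = cls q.
Proof.
move=> pq.
have zz' : z = z' by rewrite -(cpath1 p) -(cpath1 q) pq //; exact: in01_1.
by subst z'; apply: homotopic_cls; exact: homotopic_ext.
Qed.

Lemma cls_over e z : cover_proj e = z -> exists p : cpath R z0 z, e = cls p.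
Proof. by elim/cls_ind: e => z' p /= <-; exists p. Qed.

Lemma cls_cat z y (p p' : cpath R z0 z) (q q' : cpath R z y) :
  cls p = cls p' -> homotopic q q' -> cls (cpath_cat p q) = cls (cpath_cat p' q').
Proof.
move=> /clsP pp' qq'.
transitivity (cls (cpath_cat p' q)); last first.
  by apply: homotopic_cls; apply: homotopic_cat => //; exact: homotopic_refl.
apply/clsP.
suff -> : pi1_class (cpath_cat (cpath_cat p q) (cpath_rev (cpath_cat p' q))) =
    pi1_class (cpath_cat p (cpath_rev p')) by [].
apply/pi1_classP; set w := cpath_cat p' q.
apply: homotopic_trans (homotopic_catp1 _).
apply: (@homotopic_trans _ _ _ _ _
    (cpath_cat (cpath_cat (cpath_cat p (cpath_rev p')) w) (cpath_rev w))).
  apply: homotopic_cat; last exact: homotopic_refl.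
  apply: homotopic_trans (homotopic_sym (homotopic_catA _ _ _)).
  by apply: homotopic_cat; [exact/homotopic_sym/homotopic_cancelV|exact: homotopic_refl].
apply: homotopic_trans (homotopic_sym (homotopic_catA _ _ _)) _.
by apply: homotopic_cat; [exact: homotopic_refl|exact: homotopic_catpV].
Qed.

Lemma cls_catA z y x (p : cpath R z0 z) (q : cpath R z y) (r : cpath R y x) :
  cls (cpath_cat (cpath_cat p q) r) = cls (cpath_cat p (cpath_cat q r)).
Proof. exact/homotopic_cls/homotopic_sym/homotopic_catA. Qed.

End path_classes.

(** * The cover associated with a subgroup *)

Section weak_topology.
Variables (R : realType) (T C : Type) (dim : C -> nat) (chr : forall k, 'rV[R]_(dim k) -> T).

Definition weak_open (A : set T) :=
  forall k, open (@chr k @^-1` A : set (subspace (@cube R (dim k)))).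

Lemma weak_openT : weak_open setT.
Proof. by move=> k; exact: openT. Qed.

Lemma weak_openI : setI_closed weak_open.
Proof. by move=> A B oA oB k; exact: openI. Qed.

Lemma weak_open_bigcup (I : Type) (f : I -> set T) :
  (forall i, weak_open (f i)) -> weak_open (\bigcup_i f i).
Proof. by move=> h k; rewrite preimage_bigcup; apply: bigcup_open => i _; exact: h. Qed.

End weak_topology.

Section transport.
Variables (R : realType) (Z : cube_complex R) (z0 : Z) (H : pi1_subgroup R z0).
Local Notation E := (cover_space H).
Local Notation pr := (@cover_proj R Z z0 H).

(* Transport of a point over the image of [x] along the straight segment to [y];
   junk value [e] when [e] does not lie over the image of [x]. *)
Definition trans k (x y : 'rV[R]_(cc_dim k)) (e : E) : E := xget e
  [set e' | exists (cx : cube x) (cy : cube y) (p : cpath R z0 (cc_char x)),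
     e = cls H p /\ e' = cls H (cpath_cat p (seg cx cy))].

Lemma transE k (x y : 'rV[R]_(cc_dim k)) (cx : cube x) (cy : cube y)
    (p : cpath R z0 (cc_char x)) :
  trans x y (cls H p) = cls H (cpath_cat p (seg cx cy)).
Proof.
rewrite /trans; case: xgetP => [e' _ [cx' [cy' [p' [pp' ->]]]]|/(_ (cls H (cpath_cat p (seg cx cy)))) []].
  apply: cls_cat; first exact/esym.
  by rewrite (Prop_irrelevance cx cx') (Prop_irrelevance cy cy'); exact: homotopic_refl.
by exists cx, cy, p.
Qed.

Section one_cube.
Variables (k : cc_cube Z) (x y z : 'rV[R]_(cc_dim k)).
Hypotheses (cx : cube x) (cy : cube y) (cz : cube z).
Variable e : E.
Hypothesis ex : pr e = cc_char x.

Lemma trans_proj : pr (trans x y e) = cc_char y.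
Proof. by have [p ->] := cls_over ex; rewrite (transE cx cy). Qed.

Lemma trans_refl : trans x x e = e.
Proof.
have [p ->] := cls_over ex; rewrite (transE cx cx); apply: homotopic_cls.
apply: homotopic_trans (homotopic_catp1 p).
by apply: homotopic_cat; [exact: homotopic_refl|exact: seg_refl_homotopic].
Qed.

Lemma trans_trans : trans y z (trans x y e) = trans x z e.
Proof.
have [p ->] := cls_over ex; rewrite (transE cx cy) (transE cy cz) (transE cx cz).
rewrite cls_catA; apply: cls_cat => //; exact: seg_cat_homotopic.
Qed.

End one_cube.

Lemma transK k (x y : 'rV[R]_(cc_dim k)) e : cube x -> cube y ->
  pr e = cc_char x -> trans y x (trans x y e) = e.
Proof. by move=> cx cy ex; rewrite trans_trans // trans_refl. Qed.

(** Gluing carries a straight segment to a straight segment with the same image in [Z], so transport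
    does not depend on the cube in which it is computed. *)
Lemma trans_glue k k' (u x y : 'rV[R]_(cc_dim k)) S (u' : 'rV[R]_(cc_dim k')) S' h e :
  cube u -> cube u' -> isometry_onto (face u S) (face u' S') h ->
  (forall v, face u S v -> cc_char v = cc_char (h v) :> Z) ->
  face u S x -> face u S y -> pr e = cc_char x ->
  trans x y e = trans (h x) (h y) e.
Proof.
move=> cu cu' ih hc fx fy ex.
have fh v : face u S v -> face u' S' (h v) by case: ih => <- _ fv; exists v.
have [cx _] := fx; have [cy _] := fy; have [chx _] := fh _ fx; have [chy _] := fh _ fy.
have [p ->] := cls_over ex; rewrite (transE cx cy).
pose p' := CPath (cpath_continuous p) (cpath0 p) (etrans (cpath1 p) (hc _ fx)).
rewrite (@cls_ext _ _ _ _ _ _ p p') // (transE chx chy).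
apply: cls_ext => t t01; rewrite /= /cat_fun /=; case: ifPn => //; rewrite -ltNge => ht.
have t1 : 0 <= 2 * t - 1 <= 1 by lra.
by rewrite -(isometry_lerp cu cu' ih) // -hc //; exact: lerp_face.
Qed.

(** A lift of the centre [0] determines the lift of the whole cube by transport, so these pairs
    index all lifted cubes. *)
Record cover_cube := CoverCube {
  ck_cube : cc_cube Z;
  ck_lift : E;
  ck_liftP : pr ck_lift = @cc_char R Z ck_cube 0 }.

Definition cover_dim (c : cover_cube) := cc_dim (ck_cube c).

Definition cover_char (c : cover_cube) (y : 'rV[R]_(cover_dim c)) : E :=
  trans 0 y (ck_lift c).

Lemma cube0 n : cube (0 : 'rV[R]_n).
Proof. by move=> i; rewrite mxE normr0. Qed.

Lemma cover_char_proj c (y : 'rV[R]_(cover_dim c)) : cube y ->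
  pr (cover_char y) = @cc_char R Z (ck_cube c) y.
Proof. by move=> cy; apply: trans_proj => //; [exact: cube0|exact: ck_liftP]. Qed.

Lemma cover_char_trans c (x y : 'rV[R]_(cover_dim c)) : cube x -> cube y ->
  cover_char y = @trans (ck_cube c) x y (cover_char x).
Proof.
by move=> cx cy; rewrite /cover_char trans_trans //; [exact: cube0|exact: ck_liftP].
Qed.

Definition lift_cube k (x : 'rV[R]_(cc_dim k)) e (cx : cube x)
    (ex : pr e = cc_char x) : cover_cube :=
  CoverCube (trans_proj cx (@cube0 (cc_dim k)) ex).

Lemma lift_cubeE k (x y : 'rV[R]_(cc_dim k)) e (cx : cube x)
    (ex : pr e = cc_char x) : cube y ->
  @cover_char (lift_cube cx ex) y = trans x y e.
Proof. by move=> cy; rewrite /cover_char /= trans_trans //; exact: cube0. Qed.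

HB.instance Definition _ := gen_eqMixin E.
HB.instance Definition _ := gen_choiceMixin E.
HB.instance Definition _ := isOpenTopological.Build E
  (@weak_openT R E cover_cube cover_dim cover_char) (@weak_openI R E cover_cube cover_dim cover_char)
  (@weak_open_bigcup R E cover_cube cover_dim cover_char).

Lemma cover_openE (A : set E) : open A <-> weak_open cover_char A.
Proof. by []. Qed.

(** Frees the weak topology from the centres: any point of a cube and any point of the fibre over it
    may serve as origin of transport. *)
Lemma cover_openP (A : set E) : open A <->
  forall k (x : 'rV[R]_(cc_dim k)) e, cube x -> pr e = cc_char x -> A e ->
  exists2 d, 0 < d & forall y, cube y -> cnear d x y -> A (trans x y e).
Proof.
rewrite cover_openE; split=> [oA k x e cx ex Ae|h c].
  pose c := lift_cube cx ex.
  have ce : @cover_char c x = e by rewrite lift_cubeE // trans_refl.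
  have /open_cube_preimage /(_ x cx) : open (@cover_char c @^-1` A : set (subspace (@cube R (cover_dim c)))).
    exact: oA.
  rewrite ce => /(_ Ae)[d d0 hd]; exists d => // y cy xy.
  by have := hd y cy xy; rewrite lift_cubeE.
apply/open_cube_preimage => x cx Ax.
have [d d0 hd] := h (ck_cube c) x _ cx (cover_char_proj cx) Ax.
by exists d => // y cy xy; rewrite (cover_char_trans cx cy); exact: hd.
Qed.

Lemma cover_proj_continuous : continuous pr.
Proof.
apply/continuousP => A /open_cubes oA; apply/cover_openP => k x e cx ex Ae.
have [|d d0 hd] := oA k x cx; first by rewrite -ex.
by exists d => // y cy xy; rewrite /preimage /= (trans_proj cx cy ex); exact: hd.
Qed.

(** The lift through [e] of the star of its projection. For good radii the projection is injective
    on it ([sheet_inj]). *)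
Definition sheet (e : E) r : set E := [set e' | exists k (x y : 'rV[R]_(cc_dim k)),
  [/\ cube x, cube y, cc_char x = pr e, cnear r x y & e' = trans x y e]].

Lemma sheet_inj e r k (x y : 'rV[R]_(cc_dim k)) k' (x' y' : 'rV[R]_(cc_dim k')) :
  good_radius (pr e) (r + r) -> cube x -> cube y -> cube x' -> cube y' ->
  cc_char x = pr e -> cc_char x' = pr e -> cnear r x y -> cnear r x' y' ->
  cc_char y = cc_char y' :> Z -> trans x y e = trans x' y' e.
Proof.
move=> ge cx cy cx' cy' xe xe' xy xy' yy'.
have [h [ih hc <- sx <-]] := star_glue ge cx cy cx' cy' xe xe' xy xy' yy'.
by apply: (trans_glue cy cy' ih hc) => //; exact: face_self.
Qed.

Lemma sheet_open e r : good_radius (pr e) (r + r) -> open (sheet e r).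
Proof.
move=> ge; have [r0 _ ge'] := good_radius_half ge.
apply/cover_openP => k' y' e1 cy' ey' [k [x [y [cx cy xe xy e1E]]]].
have yy' : cc_char y' = cc_char y :> Z by rewrite -ey' e1E (trans_proj cx cy).
have [h [ih hc hy sx hn]] := star_transport ge' cx cy xe xy cy' yy'.
have [chx _] : supp y' (h x) by case: ih => <- _; exists x.
have hxe : cc_char (h x) = pr e by rewrite -hc.
have [d d0 [_ hd]] := cnear_slack r0 (hn _ r0 xy).
have e1E' : e1 = trans (h x) y' e.
  by rewrite e1E -hy; apply: (trans_glue cy cy' ih hc) => //; exact: face_self.
exists d => // y'' cy'' yy''; exists k', (h x), y''; split=> //.
  by rewrite -(subrK d r); exact: cnear_trans hd yy''.
by rewrite e1E' trans_trans.
Qed.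

Lemma sheet_self e r : 0 < r -> sheet e r e.
Proof.
move=> r0; have [k [x [cx xe]]] := cc_cover (pr e).
by exists k, x, x; split=> //; [exact: cnear_refl|rewrite trans_refl].
Qed.

Lemma sheet_nbhs e r : good_radius (pr e) (r + r) -> nbhs e (sheet e r).
Proof.
move=> ge; apply: open_nbhs_nbhs; split; first exact: sheet_open.
by apply: sheet_self; have [] := good_radius_half ge.
Qed.

Hypothesis Zbasis : star_basis Z.

(** The projection [U] of the part of a sheet lying in [W] is open in [Z], so it contains a star;
    injectivity of the projection on the sheet lifts this inclusion back to the cover. *)
Lemma sheet_basis (e : E) (V : set E) : nbhs e V ->
  exists2 r, 0 < r & sheet e r `<=` V.
Proof.
rewrite nbhsE => -[W [oW We] WV].
have [r2 ge2] := good_radius_exists (pr e).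
pose r := r2 / 2; have ge : good_radius (pr e) (r + r) by rewrite -splitr.
have [r0 _ ge'] := good_radius_half ge.
pose U := [set w | exists k (x y : 'rV[R]_(cc_dim k)),
  [/\ cube x, cube y, cc_char x = pr e, cc_char y = w & cnear r x y /\ W (trans x y e)]].
have oU : open U.
  apply/open_cubes => k' y' cy' [k [x [y [cx cy xe yy' [xy Wxy]]]]].
  have [h [ih hc hy sx hn]] := star_transport ge' cx cy xe xy cy' (esym yy').
  have [chx _] : supp y' (h x) by case: ih => <- _; exists x.
  have hxe : cc_char (h x) = pr e by rewrite -hc.
  have [d d0 [_ hd]] := cnear_slack r0 (hn _ r0 xy).
  have E1 : trans x y e = trans (h x) y' e.
    by rewrite -hy; apply: (trans_glue cy cy' ih hc) => //; exact: face_self.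
  have /cover_openP := oW => /(_ k' y' (trans (h x) y' e) cy').
  rewrite (trans_proj chx cy') // -E1 => /(_ erefl Wxy)[d' d'0 hd'].
  exists (Num.min d d'); first by rewrite lt_min d0.
  move=> y'' cy'' yy''; exists k', (h x), y''; split=> //; split.
    rewrite -(subrK d r); apply: cnear_trans hd (cnear_le _ yy'').
    by rewrite ge_min lexx.
  rewrite -(trans_trans chx cy' cy'') // -E1; apply: hd' => //.
  by apply: cnear_le yy''; rewrite ge_min lexx orbT.
have Ue : U (pr e).
  have [k [x [cx xe]]] := cc_cover (pr e).
  by exists k, x, x; split=> //; split; [exact: cnear_refl|rewrite trans_refl].
have [d d0 hd] := Zbasis (open_nbhs_nbhs (conj oU Ue)).
exists (Num.min d r); first by rewrite lt_min d0.
move=> _ [k [x [y [cx cy xe xy ->]]]]; apply: WV.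
have [] : U (cc_char y).
  apply: hd; exists k, x, y; split=> //.
  by apply: cnear_le xy; rewrite ge_min lexx.
move=> k' [x' [y' [cx' cy' xe' yy' [xy' Wxy]]]].
rewrite (@sheet_inj e r k x y k' x' y') //.
by apply: cnear_le xy; rewrite ge_min lexx orbT.
Qed.

End transport.

(** * Path lifting in covers *)

Section clamp.
Variable R : realType.

(** A retraction of the line onto the unit interval. A path is continuous only within the interval;
    composed with [clamp] it is continuous on the whole line, whose connectedness gives uniqueness
    of lifts. *)
Definition clamp (t : R) : R := Num.max 0 (Num.min t 1).

Lemma clamp01 t : 0 <= clamp t <= 1.
Proof. by rewrite /clamp le_max lexx /= ge_max ler01 ge_min lexx orbT. Qed.

Lemma clamp_id t : 0 <= t <= 1 -> clamp t = t.
Proof. by move=> /andP[t0 t1]; rewrite /clamp (min_idPl t1) (max_idPr t0). Qed.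

Lemma clamp_continuous : continuous clamp.
Proof.
apply: maxr_continuous; first by move=> ?; exact: cvg_cst.
by apply: minr_continuous; [exact: id_continuous|move=> ?; exact: cvg_cst].
Qed.

Lemma clamp0 : clamp 0 = 0.
Proof. exact/clamp_id/in01_0. Qed.

Lemma clamp1 : clamp 1 = 1.
Proof. exact/clamp_id/in01_1. Qed.

Lemma within_setT_continuous (S T : topologicalType) (f : S -> T) :
  {within [set: S], continuous f} -> continuous f.
Proof.
move=> /subspace_continuousP cf x V nV.
have : nbhs x (fun y => [set: S] y -> V (f y)) by exact: (cf x I V nV).
by apply: filterS => y; exact.
Qed.

Lemma cpath_clamp_continuous (T : topologicalType) (x y : T) (p : cpath R x y) :
  continuous (fun t => p (clamp t)).
Proof.
apply: within_setT_continuous; apply: cpath_comp; first exact: clamp_continuous.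
by move=> t _; exact: clamp01.
Qed.

Lemma locally_constant (T : topologicalType) (P : T -> Prop) : connected [set: T] ->
  (forall t0, \forall t \near t0, P t <-> P t0) -> forall t t', P t -> P t'.
Proof.
move=> cT lc t t' Pt.
have oP : open [set u | P u].
  by rewrite openE => u Pu; apply: filterS (lc u) => v /= h; exact/h.
have cP : closed [set u | P u].
  rewrite -openC openE => u nPu.
  by apply: filterS (lc u) => v h Pv; apply: nPu; exact/h.
suff /seteqP[_ /(_ t' I)] : [set u | P u] = [set: T] by [].
by apply: cT; [exists t|exists [set u | P u]; rewrite ?setTI|exists [set u | P u]; rewrite ?setTI].
Qed.

Lemma connected_line : connected [set: R].
Proof. exact/connected_intervalP. Qed.

End clamp.

Section lifting.
Variables (R : realType) (Z : cube_complex R) (z0 : Z) (H : pi1_subgroup R z0).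
Local Notation E := (cover_space H).
Local Notation pr := (@cover_proj R Z z0 H).
Hypothesis Zbasis : star_basis Z.

Section plane.
Variable K : R * R -> Z.
Hypothesis cK : continuous K.

Lemma scale_continuous (u : R * R) : continuous (fun t : R => (t * u.1, t * u.2)).
Proof.
by apply: pair_continuous => t; apply: cvgM; [exact: cvg_id|exact: cvg_cst|
  exact: cvg_id|exact: cvg_cst].
Qed.

Lemma ray_continuous u : {within `[0, 1], continuous (fun t : R => K (t * u.1, t * u.2))}.
Proof.
apply: continuous_subspaceT => t.
by apply: (@continuous_comp _ _ _ (fun t : R => (t * u.1, t * u.2)) K); [exact: scale_continuous|exact: cK].
Qed.

Lemma ray0 u : K (0 * u.1, 0 * u.2) = K (0, 0).
Proof. by rewrite !mul0r. Qed.

Lemma ray1 u : K (1 * u.1, 1 * u.2) = K u.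
Proof. by rewrite !mul1r -surjective_pairing. Qed.

Definition ray u : cpath R (K (0, 0)) (K u) := CPath (@ray_continuous u) (ray0 u) (ray1 u).

(** Since points of the cover are classes of paths, a lift of [K] can be written down at once: [u]
    goes to the class of [p0] followed by the image of the ray from the origin to [u]. Paths and
    homotopies are both lifted this way, without subdivision. *)
Definition lift_plane (p0 : cpath R z0 (K (0, 0))) (u : R * R) : E :=
  cls H (cpath_cat p0 (ray u)).

Let between (u v : R * R) (t : R) := (u.1 + t * (v.1 - u.1), u.2 + t * (v.2 - u.2)).

Let between_continuous u v : continuous (between u v).
Proof.
by apply: pair_continuous => t; apply: cvgD; [exact: cvg_cst| |exact: cvg_cst|];
  apply: cvgM; [exact: cvg_id|exact: cvg_cst|exact: cvg_id|exact: cvg_cst].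
Qed.

Let between_path_continuous u v : {within `[0, 1], continuous (fun t => K (between u v t))}.
Proof.
apply: continuous_subspaceT => t.
by apply: (@continuous_comp _ _ _ (between u v) K); [exact: between_continuous|exact: cK].
Qed.

Let between0 u v : K (between u v 0) = K u.
Proof. by rewrite /between !mul0r !addr0 -surjective_pairing. Qed.

Let between1 u v : K (between u v 1) = K v.
Proof. by rewrite /between !mul1r ![u.1 + _]addrC ![u.2 + _]addrC !subrK -surjective_pairing. Qed.

Let between_path u v := CPath (@between_path_continuous u v) (between0 u v) (between1 u v).

Let ray_cat u v : homotopic (ray v) (cpath_cat (ray u) (between_path u v)).
Proof.
pose m t := Num.min (2 * t + 0) 1 : R; pose M t := Num.max (2 * t + -1) 0 : R.
have cm : continuous m.
  apply: minr_continuous; last by move=> ?; exact: cvg_cst.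
  exact/lin_continuous/id_continuous.
have cM : continuous M.
  apply: maxr_continuous; last by move=> ?; exact: cvg_cst.
  exact/lin_continuous/id_continuous.
pose b t := (m t * u.1 + M t * (v.1 - u.1), m t * u.2 + M t * (v.2 - u.2)).
have m0 : m 0 = 0 by rewrite /m min_l; lra.
have M0 : M 0 = 0 by rewrite /M max_r; lra.
have m1 : m 1 = 1 by rewrite /m min_r; lra.
have M1 : M 1 = 1 by rewrite /M max_l; lra.
apply: (@convex_homotopic R setT _ K (fun t => (t * v.1, t * v.2)) b) => //.
- exact: continuous_subspaceT.
- exact: scale_continuous.
- apply: pair_continuous => t; apply: cvgD; apply: cvgM;
    by [exact: cm|exact: cM|exact: cvg_cst].
- move=> t t01; split=> //=; rewrite /cat_fun /= /b /m /M /between.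
  case: ifPn; rewrite -?ltNge => ht.
    rewrite min_l ?max_r; [|lra|lra].
    by congr K; congr pair; ring.
  rewrite min_r ?max_l; [|lra|lra].
  by congr K; congr pair; ring.
- move=> s s01; rewrite /b /= m0 M0 m1 M1 !mul0r !mul1r !mulr0 !addr0; split.
  by rewrite mulr0 addr0.
  transitivity (K (v.1, v.2)); last by rewrite -surjective_pairing.
  by congr K; congr pair; ring.
Qed.

(** The ray to [u] is homotopic to the ray to [u0] followed by the segment from [u0] to [u]. When
    [u] is close to [u0] the image of this segment stays in a star, hence is homotopic to a segment
    of a cube, and the lift at [u] is a transport of the lift at [u0]: it lies in a small sheet. *)
Lemma lift_plane_continuous (p0 : cpath R z0 (K (0, 0))) : continuous (lift_plane p0).
Proof.
move=> u0 V /(sheet_basis Zbasis)[e e0 eV].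
have [r2 ge2] := good_radius_exists (K u0).
pose r := r2 / 2; have ge : good_radius (K u0) (r + r) by rewrite -splitr.
have [r0 _ ge'] := good_radius_half ge.
pose e' := Num.min e r.
have e'0 : 0 < e' by rewrite lt_min e0.
have e'r : e' <= r by rewrite ge_min lexx orbT.
have ge'' : good_radius (K u0) e' by apply: good_radius_le ge' _ _.
have /nbhs_ballP[d /= d0 hd] := cK (star_nbhs ge'').
rewrite /= nbhs_simpl /=; apply/nbhs_ballP; exists d => //= u ud; apply: eV.
have hbt t : 0 <= t <= 1 -> star (K u0) e' (K (between u0 u t)).
  move=> /andP[t0 t1]; apply: hd; case: ud => ud1 ud2.
  have aux (a b : R) : `|a - b| < d -> `|a - (a + t * (b - a))| < d.
    move=> ab; rewrite opprD addrA subrr sub0r normrN normrM distrC ger0_norm //.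
    by apply: le_lt_trans ab; rewrite ler_piMl.
  by split; exact: aux.
have [k [x [y [cx cy xz yz xy]]]] : star (K u0) e' (K u).
  by rewrite -(between1 u0 u); apply: hbt; exact: in01_1.
exists k, x, y; split=> //.
  by apply: cnear_le xy; rewrite ge_min lexx.
pose pu0 := cpath_cat p0 (ray u0).
pose p' : cpath R z0 (cc_char x) :=
  CPath (cpath_continuous pu0) (cpath0 pu0) (etrans (cpath1 pu0) (esym xz)).
pose q := between_path u0 u.
pose q' : cpath R (cc_char x : Z) (cc_char y) :=
  CPath (cpath_continuous q) (etrans (cpath0 q) (esym xz)) (etrans (cpath1 q) (esym yz)).
have E1 : cls H pu0 = cls H p' by exact: cls_ext.
rewrite /lift_plane -/pu0 E1 (transE H cx cy).
transitivity (cls H (cpath_cat pu0 q)).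
  by rewrite cls_catA; apply: cls_cat => //; exact: ray_cat.
transitivity (cls H (cpath_cat p' q')); first exact: cls_ext.
apply: cls_cat => //; apply: (@star_path_homotopic _ _ Zbasis r).
- by rewrite xz.
- exact: cnear_le xy.
- by move=> t t01; have := star_le e'r (hbt t t01); rewrite -xz.
Qed.

End plane.

Lemma path_lift z (p0 : cpath R z0 z) z' (p : cpath R z z') : exists l : R -> E,
  [/\ continuous l, (forall t, pr (l t) = p (clamp t)), l 0 = cls H p0 &
      l 1 = cls H (cpath_cat p0 p)].
Proof.
pose K (u : R * R) := p (clamp u.2).
have cK : continuous K.
  move=> u; apply: (@continuous_comp _ _ _ snd (fun t => p (clamp t))); first exact: cvg_snd.
  exact: cpath_clamp_continuous.
have K0 : K (0, 0) = z by rewrite /K /= clamp0 cpath0.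
pose p1 : cpath R z0 (K (0, 0)) :=
  CPath (cpath_continuous p0) (cpath0 p0) (etrans (cpath1 p0) (esym K0)).
exists (fun t => lift_plane cK p1 (0, t)); split.
- move=> t; apply: (@continuous_comp _ _ _ (fun t : R => (0 : R, t)) (lift_plane cK p1)).
    by apply: pair_continuous => ?; [exact: cvg_cst|exact: cvg_id].
  exact: lift_plane_continuous.
- by [].
- transitivity (cls H (cpath_cat p0 (cpath_cst R z))).
    apply: cls_ext => t t01; rewrite /= /cat_fun /=; case: ifP => // _.
    by rewrite /K /= mulr0 clamp0 cpath0.
  exact/homotopic_cls/homotopic_catp1.
- apply: cls_ext => t t01; rewrite /= /cat_fun /=; case: ifPn => //; rewrite -ltNge => ht.
  by rewrite /K /= mulr1 clamp_id //; lra.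
Qed.

(** Near [t0] both lifts are transports of their values at [t0] along the same segment, by
    [sheet_inj]. Transport is invertible, so agreement is a locally constant condition. *)
Lemma lift_unique (l l' : R -> E) : continuous l -> continuous l' ->
  (forall t, pr (l t) = pr (l' t)) -> l 0 = l' 0 -> forall t, l t = l' t.
Proof.
move=> cl cl' ll' l0 t.
apply: (@locally_constant R (fun t => l t = l' t) (@connected_line R) _ 0) => //.
move=> t0.
have [r2 ge2] := good_radius_exists (pr (l t0)).
pose r := r2 / 2; have ge : good_radius (pr (l t0)) (r + r) by rewrite -splitr.
have ge' : good_radius (pr (l' t0)) (r + r) by rewrite -ll'.
have n1 : \forall t \near t0, sheet (l t0) r (l t) := cl t0 _ (sheet_nbhs ge).
have n2 : \forall t \near t0, sheet (l' t0) r (l' t) := cl' t0 _ (sheet_nbhs ge').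
apply: filterS2 n1 n2 => s [k [x [y [cx cy xe xy E1]]]] [k' [x' [y' [cx' cy' xe' xy' E2]]]].
have yy' : cc_char y = cc_char y' :> Z.
  have := ll' s; rewrite E1 E2 (trans_proj cx cy) // (trans_proj cx' cy') //.
have E3 : trans x y (l' t0) = l' s.
  by rewrite E2; apply: sheet_inj ge' _ _ _ _ _ _ _ _ yy' => //; rewrite -ll'.
rewrite -E3 E1; split=> [h|->//].
by rewrite -(transK cx cy (esym xe)) h (transK cx cy) // -ll'.
Qed.

Lemma path_end (e e' : E) (q : cpath R e e') (p0 : cpath R z0 (pr e)) :
  e = cls H p0 -> e' = cls H (cpath_cat p0 (cpath_map (@cover_proj_continuous R Z z0 H) q)).
Proof.
move=> ep.
have [l [cl pl l0 <-]] := path_lift p0 (cpath_map (@cover_proj_continuous R Z z0 H) q).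
rewrite -(cpath1 q) -[X in q X]clamp1.
apply: esym; apply: (@lift_unique l (fun t => q (clamp t))) => //.
  exact: cpath_clamp_continuous.
by rewrite l0 clamp0 cpath0.
Qed.

(** Homotopy lifting. The lift [L] of the homotopy below has the required four sides because each
    side is determined by unique lifting. *)
Lemma homotopic_proj (e e' : E) (q q' : cpath R e e') :
  homotopic (cpath_map (@cover_proj_continuous R Z z0 H) q)
    (cpath_map (@cover_proj_continuous R Z z0 H) q') -> homotopic q q'.
Proof.
move=> [F [cF F0 F1]].
pose K (u : R * R) := F (clamp u.1, clamp u.2).
have cK : continuous K.
  apply: within_setT_continuous; apply: (square_comp (f := fun u : R * R => (clamp u.1, clamp u.2)) cF).
    apply: pair_continuous => u.
      by apply: (@continuous_comp (R * R)%type R R fst (@clamp R)); [exact: cvg_fst|exact: clamp_continuous].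
    by apply: (@continuous_comp (R * R)%type R R snd (@clamp R)); [exact: cvg_snd|exact: clamp_continuous].
  by move=> u _; apply/unit_squareE; split; exact: clamp01.
have [p0 ep] : exists p : cpath R z0 (pr e), e = cls H p by exact: cls_over.
have K00 : K (0, 0) = pr e.
  by rewrite /K /= clamp0; have [-> _] := F1 0 (in01_0 R).
pose p1 : cpath R z0 (K (0, 0)) :=
  CPath (cpath_continuous p0) (cpath0 p0) (etrans (cpath1 p0) (esym K00)).
pose L := lift_plane cK p1.
have cL : continuous L by exact: lift_plane_continuous.
have L00 : L (0, 0) = e.
  rewrite ep; transitivity (cls H (cpath_cat p0 (cpath_cst R (pr e)))).
    apply: cls_ext => t t01; rewrite /= /cat_fun /=; case: ifP => // _.
    by rewrite mulr0.
  exact/homotopic_cls/homotopic_catp1.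
have cL1 s : continuous (fun t => L (s, t)).
  move=> t; apply: (@continuous_comp _ _ _ (fun t : R => (s, t)) L); last exact: cL.
  by apply: pair_continuous => ?; [exact: cvg_cst|exact: cvg_id].
have cL2 t : continuous (fun s => L (s, t)).
  move=> s; apply: (@continuous_comp _ _ _ (fun s : R => (s, t)) L); last exact: cL.
  by apply: pair_continuous => ?; [exact: cvg_id|exact: cvg_cst].
have ccst (a : E) : continuous (fun _ : R => a) by move=> ?; exact: cvg_cst.
have Ls0 s : L (s, 0) = e.
  apply: (lift_unique (cL2 0) (ccst e)) => // {}s.
  by rewrite /= /K /= clamp0; have [-> _] := F1 _ (clamp01 s).
have L0t t : L (0, t) = q (clamp t).
  apply: (@lift_unique (fun t => L (0, t)) (fun t => q (clamp t)) (cL1 0)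
    (@cpath_clamp_continuous _ _ _ _ q)); last by rewrite clamp0 cpath0.
  by move=> {}t; rewrite /= /K /= clamp0; have [-> _] := F0 _ (clamp01 t).
have L1t t : L (1, t) = q' (clamp t).
  apply: (@lift_unique (fun t => L (1, t)) (fun t => q' (clamp t)) (cL1 1)
    (@cpath_clamp_continuous _ _ _ _ q')); last by rewrite clamp0 cpath0.
  by move=> {}t; rewrite /= /K /= clamp1; have [_ ->] := F0 _ (clamp01 t).
have Ls1 s : L (s, 1) = e'.
  apply: (lift_unique (cL2 1) (ccst e')); last by rewrite L0t clamp1 cpath1.
  by move=> {}s; rewrite /= /K /= clamp1; have [_ ->] := F1 _ (clamp01 s).
exists L; split=> //.
- exact: continuous_subspaceT.
- by move=> t t01; rewrite L0t L1t clamp_id.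
Qed.

(** The lift of [p] joins the base point to the class of [p], and membership in a clopen set is
    locally constant along it. *)
Lemma cover_connected : connected [set: E].
Proof.
move=> B [b Bb] [O oO BO] [C cC BC].
rewrite setTI in BO; rewrite setTI in BC; subst O.
have key e : B (cls H (cpath_cst R z0)) <-> B e.
  elim/cls_ind: e => z p.
  have [l [cl _ l0 l1]] := path_lift (cpath_cst R z0) p.
  have {}l1 : l 1 = cls H p by rewrite l1; exact/homotopic_cls/homotopic_cat1p.
  have lc t0 : \forall t \near t0, B (l t) <-> B (l t0).
    have [Bt|nBt] := pselect (B (l t0)).
      have n1 : \forall t \near t0, B (l t) := cl t0 B (open_nbhs_nbhs (conj oO Bt)).
      by apply: filterS n1 => t Blt; split.
    have nB : open_nbhs (l t0) (~` B) by split=> //; rewrite openC BC.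
    have n1 : \forall t \near t0, ~ B (l t) := cl t0 _ (open_nbhs_nbhs nB).
    by apply: filterS n1 => t Blt; split.
  rewrite -l0 -l1; split; exact: (locally_constant (@connected_line R) lc).
by rewrite eqEsubset; split=> // e _; exact: (key e).1 ((key b).2 Bb).
Qed.

End lifting.

Lemma corner_cube (R : realType) n (c : 'rV[R]_n) : is_corner c -> cube c.
Proof. by move=> h i; rewrite h. Qed.

(** * The cover as a cube complex, and its links *)

Section cover_complex.
Variables (R : realType) (Z : cube_complex R) (z0 : Z) (H : pi1_subgroup R z0).
Hypothesis Zbasis : star_basis Z.
Local Notation E := (cover_space H).
Local Notation pr := (@cover_proj R Z z0 H).

Lemma cover_cc_cover (e : E) : exists c (x : 'rV[R]_(cover_dim c)),
  cube x /\ @cover_char _ _ _ H c x = e.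
Proof.
have [k [x [cx xe]]] := cc_cover (pr e).
by exists (lift_cube cx (esym xe)), x; split=> //; rewrite lift_cubeE // trans_refl.
Qed.

Lemma cover_cc_inj c (x y : 'rV[R]_(cover_dim c)) : cube x -> cube y ->
  supp x = supp y -> @cover_char _ _ _ H c x = cover_char y -> x = y.
Proof.
move=> cx cy ss xy; apply: (@cc_inj R Z (ck_cube c)) => //.
by rewrite -!cover_char_proj // xy.
Qed.

Lemma cover_glue_face (c c' : cover_cube H) (u x : 'rV[R]_(cover_dim c)) S
    (u' : 'rV[R]_(cover_dim c')) S' h :
  cube u -> cube u' -> isometry_onto (face u S) (face u' S') h ->
  (forall v, face u S v -> cc_char v = cc_char (h v) :> Z) ->
  face u S x -> cover_char x = cover_char (h x) ->
  forall y, face u S y -> cover_char y = cover_char (h y).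
Proof.
move=> cu cu' ih hc fx xh y fy.
have fh v : face u S v -> face u' S' (h v) by case: ih => <- _ fv; exists v.
have [cx _] := fx; have [cy _] := fy; have [chx _] := fh _ fx; have [chy _] := fh _ fy.
rewrite (cover_char_trans cx cy) (cover_char_trans chx chy) -xh.
by apply: (trans_glue cu cu' ih hc) => //; exact: cover_char_proj.
Qed.

Lemma cover_cc_glue c c' (x : 'rV[R]_(cover_dim c)) (x' : 'rV[R]_(cover_dim c')) :
  cube x -> cube x' -> @cover_char _ _ _ H c x = cover_char x' ->
  exists h, isometry_onto (supp x) (supp x') h /\
    forall y, supp x y -> cover_char y = cover_char (h y).
Proof.
move=> cx cx' xx'.
have xx'Z : @cc_char R Z (ck_cube c) x = @cc_char R Z (ck_cube c') x'.
  by rewrite -!cover_char_proj // xx'.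
have [h [ih hc hx]] := glue_pt cx cx' xx'Z.
exists h; split=> //; apply: (cover_glue_face cx cx' ih hc (x := x)).
  exact: face_self.
by rewrite hx.
Qed.

Lemma cover_finite_dim : exists N : nat, forall c : cover_cube H, (cover_dim c <= N)%N.
Proof. by have [N hN] := cc_finite_dim Z; exists N => c; exact: hN. Qed.

Definition cover_complex : cube_complex R :=
  @CubeComplex R E (cover_cube H) (@cover_dim _ _ _ H) (@cover_char _ _ _ H)
    cover_cc_cover cover_cc_inj cover_cc_glue (@cover_openE _ _ _ H)
    cover_finite_dim (cover_connected Zbasis).
Local Notation Y := cover_complex.

Definition corner_proj (s : corner Y) : corner Z :=
  @Corner R Z (ck_cube (co_cube s)) (co_pt s) (co_dirs s).

Lemma same_simplex_proj (s t : corner Y) : is_corner (co_pt s) -> is_corner (co_pt t) ->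
  same_simplex s t -> same_simplex (corner_proj s) (corner_proj t).
Proof.
move=> cs ct [h [ih hp hc]]; exists h; split=> // y fy.
have [cy _] := fy.
have [chy _] : @co_face _ _ t (h y) by case: ih => <- _; exists y.
rewrite -[LHS](@cover_char_proj _ _ _ H (co_cube s)) //.
rewrite -[RHS](@cover_char_proj _ _ _ H (co_cube t)) //.
by congr cover_proj; exact: hc.
Qed.

(** A gluing below lifts as soon as it matches the lifts at one point, here the corner; transport
    propagates the match over the face ([cover_glue_face]). *)
Lemma same_simplex_lift (s t : corner Y) : is_corner (co_pt s) -> is_corner (co_pt t) ->
  cc_char (co_pt s) = cc_char (co_pt t) ->
  same_simplex (corner_proj s) (corner_proj t) -> same_simplex s t.
Proof.
move=> cs ct st [h [ih hp hc]]; exists h; split=> //.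
apply: (cover_glue_face (corner_cube cs) (corner_cube ct) ih hc (x := co_pt s)).
  by apply: face_self; exact: corner_cube.
by rewrite hp; exact: st.
Qed.

Lemma link_simplex_proj (v : Y) s : link_simplex v s -> link_simplex (pr v) (corner_proj s).
Proof.
move=> [cs <- ns]; split=> //=; apply/esym.
exact: (@cover_char_proj _ _ _ H (co_cube s) _ (corner_cube cs)).
Qed.

Lemma link_simplex_lift (v : Y) s : link_simplex (pr v) s ->
  exists s' : corner Y, corner_proj s' = s /\ link_simplex v s'.
Proof.
case: s => k c S [/= cc cv nS].
exists (@Corner R Y (lift_cube (corner_cube cc) (esym cv)) c S); split=> //.
split=> //=; rewrite lift_cubeE ?trans_refl //; exact: corner_cube.
Qed.

Lemma has_vertex_proj (v : Y) s e : link_simplex v s -> link_simplex v e ->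
  has_vertex s e <-> has_vertex (corner_proj s) (corner_proj e).
Proof.
move=> [cs sv _] [ce ev _]; split=> -[i iS h]; exists i => //.
  exact: (same_simplex_proj (t := @co_edge _ _ s i)).
by apply: (same_simplex_lift (t := @co_edge _ _ s i)) => //; rewrite sv.
Qed.

(** The projection identifies the link of [v] with the link of [pr v]: simplices lift, and the
    relations [same_simplex] and [has_vertex] are preserved and reflected for corners over the same
    vertex. Each condition is thus pulled back from [Z]. *)
Lemma cover_NPC : NPC Z -> NPC Y.
Proof.
move=> npc v [k [c [cc cv]]].
have vZ : is_vertex (pr v).
  exists (ck_cube k), c; split=> //; rewrite -cv.
  by apply/esym/(@cover_char_proj _ _ _ H k); exact: corner_cube.
have [[ls1 ls2] lf] := npc _ vZ.
split; first split.
- move=> s ls i j iS jS ss; apply: (ls1 _ (link_simplex_proj ls) i j) => //.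
  have [cs _ _] := ls.
  exact: (same_simplex_proj (s := @co_edge _ _ s i) (t := @co_edge _ _ s j)).
- move=> s t ls lt hst.
  have [cs sv _] := ls; have [ct tv _] := lt.
  apply: same_simplex_lift => //; first by rewrite sv.
  apply: (ls2 _ _ (link_simplex_proj ls) (link_simplex_proj lt)) => e0 [le0 e01].
  have [e [ee le]] := link_simplex_lift le0; subst e0.
  rewrite -(has_vertex_proj ls le) -(has_vertex_proj lt le).
  by apply: hst; split.
- move=> n e le adj.
  have [i|i j ij|s0 [ls0 hs0]] := lf n (fun i => corner_proj (e i)).
  + by have [l1 l2] := le i; split=> //; exact: link_simplex_proj.
  + have [[ci iv _] _] := le i; have [[cj jv _] _] := le j.
    have [nij [s [ls si sj]]] := adj i j ij; split.
      by move=> ss; apply: nij; apply: same_simplex_lift => //; rewrite iv.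
    exists (corner_proj s); split; first exact: link_simplex_proj.
      by apply/(has_vertex_proj ls _) => //; case: (le i).
    by apply/(has_vertex_proj ls _) => //; case: (le j).
  + have [s [ss ls]] := link_simplex_lift ls0; subst s0.
    exists s; split=> // e' [le' e'1].
    rewrite (has_vertex_proj ls le') hs0; last by split=> //; exact: link_simplex_proj.
    have [ce' e'v _] := le'.
    split=> -[i hi]; exists i; have [[ci iv _] _] := le i.
      by apply: same_simplex_lift => //; rewrite e'v.
    exact: same_simplex_proj.
Qed.

End cover_complex.

(** * Fundamental group and automorphisms of a cover *)

Lemma cubical_continuous (R : realType) (X Y : cube_complex R) (f : X -> Y) :
  cubical f -> continuous f.
Proof.
move=> cf; apply/continuousP => A /open_cubes oA; apply/open_cubes => k x cx Ax.
have [k' [x' [h [cx' ih fh]]]] := cf k.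
have cubeE : @cube R (cc_dim k) = face x [set: 'I_(cc_dim k)]%SET.
  by rewrite eqEsubset; split=> y; [move=> cy; split=> // i; rewrite inE|case].
rewrite cubeE in ih.
have hin y : cube y -> cube (h y).
  move=> cy; suff [] : supp x' (h y) by [].
  by case: ih => <- _; exists y => //; rewrite -cubeE.
have [|e e0 he] := oA k' (h x) (hin _ cx); first by rewrite -fh.
exists e => // y cy xy; rewrite /preimage /= fh //; apply: he; first exact: hin.
by apply: (isometry_cnear cx cx' ih) => //; rewrite -cubeE.
Qed.

Section cover_pi1.
Variables (R : realType) (Z : cube_complex R) (z0 : Z) (H : pi1_subgroup R z0).
Hypothesis Zbasis : star_basis Z.
Local Notation Y := (cover_complex H Zbasis).
Local Notation pr := (@cover_proj R Z z0 H).

Definition cover_base : Y := cls H (cpath_cst R z0).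

Definition cover_loop (l : cpath R cover_base cover_base) : cpath R z0 z0 :=
  cpath_map (@cover_proj_continuous R Z z0 H) l.

Lemma cls_loop (p : cpath R z0 z0) : cls H p = cover_base <-> H (pi1_class p).
Proof.
rewrite clsP (_ : pi1_class _ = pi1_class p) //; apply/pi1_classP.
apply: homotopic_trans (homotopic_catp1 p).
by apply: homotopic_cat; [exact: homotopic_refl|exact: homotopic_ext].
Qed.

Definition cover_pi1 : pi1 R cover_base -> pi1 R z0 :=
  pi1_map (@cover_proj_continuous R Z z0 H) (x := cover_base).

Lemma cover_pi1E l : cover_pi1 (pi1_class l) = pi1_class (cover_loop l).
Proof. exact: pi1_mapE. Qed.

Lemma cover_pi1_inj : injective cover_pi1.
Proof.
elim/pi1_ind => p; elim/pi1_ind => q; rewrite !cover_pi1E => /pi1_classP h.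
by apply/pi1_classP; exact: (homotopic_proj Zbasis).
Qed.

Lemma cover_pi1_mem u : H (cover_pi1 u).
Proof.
elim/pi1_ind: u => l; rewrite cover_pi1E; apply/cls_loop.
rewrite [RHS](path_end Zbasis l (p0 := cpath_cst R z0) erefl).
exact/homotopic_cls/homotopic_sym/homotopic_cat1p.
Qed.

Lemma path_lift_cover (e e' : Y) (p : cpath R (pr e) (pr e')) (p0 : cpath R z0 (pr e)) :
  e = cls H p0 -> e' = cls H (cpath_cat p0 p) ->
  exists q : cpath R e e', forall t, 0 <= t <= 1 -> pr (q t) = p t.
Proof.
move=> ep e'p; have [l [cl pl l0 l1]] := path_lift H Zbasis p0 p.
rewrite -ep in l0; rewrite -e'p in l1.
have cl' : {within `[0, 1], continuous (l : R -> Y)} by exact: continuous_subspaceT.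
by exists (CPath cl' l0 l1) => t t01 /=; rewrite pl clamp_id.
Qed.

Lemma cover_pi1_surj u : H u -> exists v, cover_pi1 v = u.
Proof.
elim/pi1_ind: u => p /cls_loop pH.
have [||q hq] := @path_lift_cover cover_base cover_base p (cpath_cst R z0); first by [].
  by apply: (etrans (esym pH)); exact/homotopic_cls/homotopic_sym/homotopic_cat1p.
by exists (pi1_class q); rewrite cover_pi1E; apply/pi1_classP/homotopic_ext.
Qed.

Section lift_map.
Variables (f : Z -> Z) (cf : continuous f) (b : cpath R z0 (f z0)).

Definition conj_map (l : cpath R z0 z0) : cpath R z0 z0 :=
  cpath_cat b (cpath_cat (cpath_map cf l) (cpath_rev b)).

Hypothesis conjH : forall l, H (pi1_class l) -> H (pi1_class (conj_map l)).

Definition lift_map (e : Y) : Y := cls H (cpath_cat b (cpath_map cf (repr (projT2 e)))).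

(** Independence of the representative: two representatives differ by a loop in [H], and after
    applying [f] they differ by the [conj_map] of this loop, which [conjH] keeps in [H]. *)
Lemma lift_mapE z (p : cpath R z0 z) :
  lift_map (cls H p) = cls H (cpath_cat b (cpath_map cf p)).
Proof.
apply/clsP; rewrite /=; set q := repr _.
have /clsP/conjH : cls H q = cls H p by rewrite /cls /q reprK.
congr (H _); apply/pi1_classP.
apply: (@homotopic_trans _ _ _ _ _ (cpath_cat b (cpath_cat (cpath_map cf q)
    (cpath_cat (cpath_rev (cpath_map cf p)) (cpath_rev b))))).
  apply: homotopic_cat; first exact: homotopic_refl.
  apply: homotopic_trans (homotopic_sym (homotopic_catA _ _ _)).
  apply: homotopic_cat; last exact: homotopic_refl.
  exact: homotopic_map_cat.
apply: homotopic_trans (homotopic_catA _ _ _) _.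
by apply: homotopic_cat; [exact: homotopic_refl|exact/homotopic_sym/homotopic_rev_cat].
Qed.

Lemma lift_map_trans k k' (x y : 'rV[R]_(cc_dim k)) (x' : 'rV[R]_(cc_dim k')) h (e : Y) :
  cube x' -> isometry_onto (@cube R (cc_dim k)) (supp x') h ->
  (forall u : 'rV[R]_(cc_dim k), cube u -> f (cc_char u) = cc_char (h u)) ->
  cube x -> cube y -> pr e = cc_char x ->
  lift_map (trans x y e) = trans (h x) (h y) (lift_map e).
Proof.
move=> cx' ih fh cx cy ex.
have cubeE : @cube R (cc_dim k) = face x [set: 'I_(cc_dim k)]%SET.
  by rewrite eqEsubset; split=> u; [move=> cu; split=> // i; rewrite inE|case].
have hin u : cube u -> cube (h u).
  by move=> cu; suff [] : supp x' (h u) by []; case: ih => <- _; exists u.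
rewrite cubeE in ih.
have [p ->] := cls_over ex; rewrite (transE H cx cy) !lift_mapE.
pose p1 := cpath_cat b (cpath_map cf p).
pose p' : cpath R z0 (cc_char (h x)) :=
  CPath (cpath_continuous p1) (cpath0 p1) (etrans (cpath1 p1) (fh _ cx)).
have -> : cls H p1 = cls H p' by exact: cls_ext.
rewrite (transE H (hin _ cx) (hin _ cy)).
transitivity (cls H (cpath_cat p1 (cpath_map cf (seg cx cy)))).
  rewrite cls_catA; apply: cls_cat => //; exact: homotopic_map_cat.
apply: cls_ext => t t01; rewrite /= /cat_fun /=; case: ifPn => //; rewrite -ltNge => ht.
have t1 : 0 <= 2 * t - 1 <= 1 by lra.
by rewrite -(isometry_lerp cx cx' ih) -?cubeE // fh //; exact: lerp_cube.
Qed.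

Lemma lift_map_cubical : cubical f -> @cubical R Y Y lift_map.
Proof.
move=> cub c; have [k' [x' [h [cx' ih fh]]]] := cub (ck_cube c).
have c0 := @cube0 R (cc_dim (ck_cube c)).
have hin u : cube u -> cube (h u).
  by move=> cu; suff [] : supp x' (h u) by []; case: ih => <- _; exists u.
have pe : pr (lift_map (ck_lift c)) = cc_char (h 0).
  by rewrite -fh // -ck_liftP.
exists (lift_cube (hin _ c0) pe), x', h; split=> // y cy.
rewrite /= lift_cubeE; last exact: hin.
by apply: (lift_map_trans cx' ih fh) => //; exact: ck_liftP.
Qed.

(** [g] is the lift of [b] starting at the base point, so the conjugated loop of the cover projects
    pointwise onto [conj_map]. *)
Lemma lift_map_pi1 (cF : continuous lift_map) :
  exists g : cpath R cover_base (lift_map cover_base),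
  forall l : cpath R cover_base cover_base,
  cover_pi1 (pi1_class (cpath_cat g (cpath_cat (cpath_map cF l) (cpath_rev g)))) =
  pi1_class (conj_map (cover_loop l)).
Proof.
have bE : lift_map cover_base = cls H (cpath_cat (cpath_cst R z0) b).
  rewrite lift_mapE; apply: homotopic_cls.
  apply: homotopic_trans (homotopic_sym (homotopic_cat1p b)).
  apply: homotopic_trans (homotopic_catp1 b).
  by apply: homotopic_cat; [exact: homotopic_refl|exact: homotopic_ext].
have [g hg] := @path_lift_cover cover_base (lift_map cover_base) b (cpath_cst R z0) erefl bE.
exists g => l; rewrite cover_pi1E; apply/pi1_classP/homotopic_ext => t /andP[t0 t1].
rewrite /= /cat_fun /rev_fun /=.
case: ifPn; rewrite -?ltNge => ht; first by rewrite hg //; lra.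
by case: ifPn; rewrite -?ltNge => ht' //=; rewrite hg //; lra.
Qed.

End lift_map.

(** The last condition says that the composite of the lifts fixes the base point. The path in it
    ends at [g (f z0)], which is [z0] only through the cancellation hypothesis; hence the
    quantification over loops with the same values. *)
Lemma lift_map_cancel (f g : Z -> Z) (cf : continuous f) (cg : continuous g)
    (b : cpath R z0 (f z0)) (b' : cpath R z0 (g z0)) :
  (forall l, H (pi1_class l) -> H (pi1_class (conj_map cf b l))) ->
  (forall l, H (pi1_class l) -> H (pi1_class (conj_map cg b' l))) ->
  cancel f g ->
  (forall l : cpath R z0 z0, (forall t, 0 <= t <= 1 -> l t = cpath_cat b' (cpath_map cg b) t) ->
    H (pi1_class l)) ->
  cancel (lift_map cf b) (lift_map cg b').
Proof.
move=> hb hb' fK hl; elim/cls_ind => z p; rewrite !lift_mapE //.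
pose w := cpath_cat b' (cpath_map cg b).
pose l : cpath R z0 z0 := CPath (cpath_continuous w) (cpath0 w) (etrans (cpath1 w) (fK z0)).
transitivity (cls H (cpath_cat w (cpath_map cg (cpath_map cf p)))).
  by rewrite cls_catA; apply: cls_cat => //; exact: homotopic_map_cat.
transitivity (cls H (cpath_cat l p)).
  by apply: cls_ext => t t01; rewrite /= /cat_fun /=; case: (t <= 1 / 2) => //=; rewrite fK.
transitivity (cls H (cpath_cat (cpath_cst R z0) p)).
  by apply: cls_cat; [apply/cls_loop; exact: hl|exact: homotopic_refl].
exact/homotopic_cls/homotopic_cat1p.
Qed.

End cover_pi1.

(** * Finite powers of a cube complex *)

Lemma dep_choice (I : Type) (T : I -> Type) (P : forall i, T i -> Prop) :
  (forall i, exists t, P i t) -> exists f : forall i, T i, forall i, P i (f i).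
Proof. by move=> h; exists (fun i => projT1 (cid (h i))) => i; exact: projT2 (cid (h i)). Qed.

Section product_coordinates.
Variables (R : realType) (I : finType) (d : I -> nat).

(** Counting the pairs of a factor and a coordinate, in place of summing the dimensions, lets
    [enum_rank] serve as the bijection between pairs and coordinates. *)
Definition block_dim : nat := #|{: {i : I & 'I_(d i)}}|.

Definition coord i (j : 'I_(d i)) : 'I_block_dim := enum_rank (Tagged (fun i => 'I_(d i)) j).

Lemma coord_inj i (j j' : 'I_(d i)) : coord j = coord j' -> j = j'.
Proof. by move=> /enum_rank_inj/eqP; rewrite eq_Tagged /= => /eqP. Qed.

Lemma coord_tag i i' (j : 'I_(d i)) (j' : 'I_(d i')) : coord j = coord j' -> i = i'.
Proof. by move=> /enum_rank_inj/(congr1 (@tag _ _)). Qed.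

Lemma coord_ind (P : 'I_block_dim -> Prop) :
  (forall i (j : 'I_(d i)), P (coord j)) -> forall a, P a.
Proof.
move=> h a; rewrite -(enum_valK a); case: (enum_val a) => i j; exact: h.
Qed.

Definition block (x : 'rV[R]_block_dim) i : 'rV[R]_(d i) := \row_j x 0 (coord j).

Definition join (xs : forall i, 'rV[R]_(d i)) : 'rV[R]_block_dim :=
  \row_a xs (tag (enum_val a)) 0 (tagged (enum_val a)).

Lemma joinE xs i (j : 'I_(d i)) : join xs 0 (coord j) = xs i 0 j.
Proof. by rewrite mxE /coord enum_rankK. Qed.

Lemma joinK xs i : block (join xs) i = xs i.
Proof. by apply/rowP => j; rewrite mxE joinE. Qed.

Lemma blockP x y : (forall i, block x i = block y i) -> x = y.
Proof.
move=> h; apply/rowP; elim/coord_ind => i j.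
by have /rowP/(_ j) := h i; rewrite !mxE.
Qed.

Lemma cube_block x : cube x <-> forall i, cube (block x i).
Proof.
split=> [cx i j|h]; first by rewrite mxE.
by elim/coord_ind => i j; have := h i j; rewrite mxE.
Qed.

Definition block_set (S : {set 'I_block_dim}) i : {set 'I_(d i)} := [set j | coord j \in S]%SET.

Lemma face_block x S y : face x S y <-> forall i, face (block x i) (block_set S i) (block y i).
Proof.
split=> [[cy hy] i|h].
  split; first by move/cube_block: cy.
  by move=> j; rewrite inE !mxE; exact: hy.
split; first by apply/cube_block => i; have [] := h i.
elim/coord_ind => i j jS; have [_ /(_ j)] := h i.
by rewrite inE !mxE; exact.
Qed.

Lemma free_block x i : block_set (free x) i = free (block x i).
Proof. by apply/setP => j; rewrite !inE !mxE. Qed.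

Lemma corner_block x : is_corner x <-> forall i, is_corner (block x i).
Proof.
split=> [cx i j|h]; first by rewrite mxE.
by elim/coord_ind => i j; have := h i j; rewrite mxE.
Qed.

Lemma sum_coord (V : nmodType) (F : 'I_block_dim -> V) :
  \sum_a F a = \sum_i \sum_(j < d i) F (coord j).
Proof.
rewrite (sig_big_dep (fun=> true) (fun _ _ => true) (fun i j => F (coord j))) /=.
rewrite (reindex (@enum_rank _)) /=; last by apply: onW_bij; exact: enum_rank_bij.
by apply: eq_bigr => -[].
Qed.

Lemma edist_block x y :
  edist x y = Num.sqrt (\sum_i edist (block x i) (block y i) ^+ 2).
Proof.
rewrite /edist sum_coord; congr Num.sqrt; apply: eq_bigr => i _.
rewrite sqr_sqrtr; first by apply: eq_bigr => j _; rewrite !mxE.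
by apply: sumr_ge0 => j _; exact: sqr_ge0.
Qed.

Lemma cnear_block e x y : cnear e x y <-> forall i, cnear e (block x i) (block y i).
Proof.
split=> [h i j|h]; first by rewrite !mxE.
by elim/coord_ind => i j; have := h i j; rewrite !mxE.
Qed.

End product_coordinates.

Section product_isometry.
Variables (R : realType) (I : finType) (d d' : I -> nat).

Lemma isometry_join (x : 'rV[R]_(block_dim d)) S (x' : 'rV[R]_(block_dim d')) S'
    (h : forall i, 'rV[R]_(d i) -> 'rV[R]_(d' i)) :
  (forall i, isometry_onto (face (block x i) (block_set S i))
     (face (block x' i) (block_set S' i)) (h i)) ->
  isometry_onto (face x S) (face x' S') (fun y => join (fun i => h i (block y i))).
Proof.
move=> ih; split.
  rewrite eqEsubset; split=> [_ [y /face_block fy <-]|y' /face_block fy'].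
    apply/face_block => i; rewrite joinK; have [<- _] := ih i.
    by exists (block y i).
  have /dep_choice[w hw] : forall i, exists y, face (block x i) (block_set S i) y /\ h i y = block y' i.
    by move=> i; have := fy' i; have [<- _] := ih i => -[y fy yy']; exists y.
  exists (join w); first by apply/face_block => i; rewrite joinK; have [] := hw i.
  by apply: blockP => i; rewrite !joinK; have [] := hw i.
move=> y z /face_block fy /face_block fz; rewrite !edist_block.
congr Num.sqrt; apply: eq_bigr => i _; rewrite !joinK.
by have [_ ->] := ih i.
Qed.

End product_isometry.

Section product_complex.
Variables (R : realType) (I : finType) (X : cube_complex R).

(** A name of its own lets the power carry the weak topology of its product cubes instead of the
    product topology. *)
Definition prod_space := I -> X.
Definition prod_dim (k : I -> cc_cube X) := block_dim (fun i => cc_dim (k i)).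
Definition prod_char (k : I -> cc_cube X) (x : 'rV[R]_(prod_dim k)) : prod_space :=
  fun i => cc_char (block x i).

HB.instance Definition _ := gen_eqMixin prod_space.
HB.instance Definition _ := gen_choiceMixin prod_space.
HB.instance Definition _ := isOpenTopological.Build prod_space
  (@weak_openT R prod_space (I -> cc_cube X) prod_dim prod_char)
  (@weak_openI R prod_space (I -> cc_cube X) prod_dim prod_char)
  (@weak_open_bigcup R prod_space (I -> cc_cube X) prod_dim prod_char).

Lemma prod_openE (A : set prod_space) : open A <-> weak_open prod_char A.
Proof. by []. Qed.

Lemma prod_cover (z : prod_space) : exists k (x : 'rV[R]_(prod_dim k)),
  cube x /\ prod_char x = z.
Proof.
have /choice[k /dep_choice[x hx]] : forall i, exists k (x : 'rV[R]_(cc_dim k)),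
  cube x /\ cc_char x = z i by move=> i; exact: cc_cover.
exists k, (join x); split; first by apply/cube_block => i; rewrite joinK; have [] := hx i.
by apply/funext => i; rewrite /prod_char joinK; have [] := hx i.
Qed.

Lemma supp_block (k : I -> cc_cube X) (x y : 'rV[R]_(prod_dim k)) : cube x -> cube y ->
  supp x = supp y -> forall i, supp (block x i) = supp (block y i).
Proof.
move=> cx cy /(supp_eqP cx cy)[E h] i.
have cxi := (cube_block x).1 cx i; have cyi := (cube_block y).1 cy i.
apply/(supp_eqP cxi cyi); split; first by rewrite -!free_block E.
by move=> j; rewrite -free_block inE => jS; rewrite !mxE h.
Qed.

Lemma prod_inj (k : I -> cc_cube X) (x y : 'rV[R]_(prod_dim k)) : cube x -> cube y ->
  supp x = supp y -> prod_char x = prod_char y -> x = y.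
Proof.
move=> cx cy ss xy; apply: blockP => i; apply: cc_inj.
- exact: ((cube_block x).1 cx).
- exact: ((cube_block y).1 cy).
- exact: supp_block.
- exact: (congr1 (fun z => z i) xy).
Qed.

Lemma prod_glue (k k' : I -> cc_cube X) (x : 'rV[R]_(prod_dim k)) (x' : 'rV[R]_(prod_dim k')) :
  cube x -> cube x' -> prod_char x = prod_char x' ->
  exists h, isometry_onto (supp x) (supp x') h /\
    forall y, supp x y -> prod_char y = prod_char (h y).
Proof.
move=> /cube_block cx /cube_block cx' xx'.
have /dep_choice[h hh] : forall i, exists h, isometry_onto (supp (block x i)) (supp (block x' i)) h /\
    forall y, supp (block x i) y -> cc_char y = cc_char (h y) :> X.
  by move=> i; apply: cc_glue => //; exact: (congr1 (fun z => z i) xx').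
exists (fun y => join (fun i => h i (block y i))); split.
  by apply: isometry_join => i; rewrite -!/(free _) !free_block; exact: (hh i).1.
move=> y /face_block fy; apply/funext => i; rewrite /prod_char joinK.
by apply: (hh i).2; have := fy i; rewrite -/(free _) free_block.
Qed.

Lemma prod_finite_dim : exists N : nat, forall k : I -> cc_cube X, (prod_dim k <= N)%N.
Proof.
have [N hN] := cc_finite_dim X; exists (\sum_(i : I) N)%N => k.
rewrite /prod_dim /block_dim card_tagged sumnE big_map big_enum /=.
by apply: leq_sum => i _; rewrite card_ord.
Qed.

Definition upd (z : prod_space) i (w : X) : prod_space := fun i' => if i' == i then w else z i'.

Lemma upd_continuous z i : continuous (upd z i).
Proof.
apply/continuousP => A /prod_openE oA; apply/open_cubes => k x cx Ax.
have /choice[K /dep_choice[xs hxs]] : forall i', exists K (y : 'rV[R]_(cc_dim K)),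
  cube y /\ cc_char y = z i' by move=> i'; exact: cc_cover.
pose kk i' := if i' == i then k else K i'.
pose u (y : 'rV[R]_(cc_dim k)) i' : 'rV[R]_(cc_dim (kk i')) :=
  match i' == i as b return 'rV[R]_(cc_dim (if b then k else K i')) with
  | true => y | false => xs i' end.
have cu y : cube y -> cube (join (u y)).
  move=> cy; apply/cube_block => i'; rewrite joinK /u /kk.
  by case: (i' == i) => //; have [] := hxs i'.
have chu y : prod_char (join (u y) : 'rV[R]_(prod_dim kk)) = upd z i (cc_char y).
  apply/funext => i'; rewrite /prod_char joinK /u /kk /upd.
  by case: (i' == i) => //; have [] := hxs i'.
have /open_cube_preimage h := oA kk.
have [|e e0 he] := h (join (u x)) (cu _ cx); first by rewrite chu.
exists e => // y cy xy; rewrite /preimage /= -chu; apply: he; first exact: cu.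
apply/cnear_block => i'; rewrite !joinK /u /kk.
by case: (i' == i) => //; exact: cnear_refl.
Qed.

(* Changing the coordinates one at a time gives a chain of connected slices. *)
Lemma prod_connected : connected [set: prod_space].
Proof.
move=> B [b Bb] [O oO BO] [C cC BC].
rewrite setTI in BO; rewrite setTI in BC; subst O.
have key i z w : B z -> B (upd z i w).
  move=> Bz.
  have lc t0 : \forall t \near t0, B (upd z i t) <-> B (upd z i t0).
    have [Bt|nBt] := pselect (B (upd z i t0)).
      have n1 : \forall t \near t0, B (upd z i t) := @upd_continuous z i t0 B (open_nbhs_nbhs (conj oO Bt)).
      by apply: filterS n1 => t Blt; split.
    have nB : open_nbhs (upd z i t0) (~` B) by split=> //; rewrite openC BC.
    have n1 : \forall t \near t0, ~ B (upd z i t) := @upd_continuous z i t0 _ (open_nbhs_nbhs nB).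
    by apply: filterS n1 => t Blt; split.
  apply: (locally_constant (@cc_connected _ X) lc (t := z i)).
  rewrite (_ : upd z i (z i) = z) //.
  by apply/funext => i'; rewrite /upd; case: eqP => [->|].
rewrite eqEsubset; split=> // z _.
suff h (s : seq I) : B (fun i => if i \in s then z i else b i).
  have := h (enum I); congr (B _); apply/funext => i; rewrite mem_enum //.
elim: s => [|i s IH]; first by congr (B _): Bb; apply/funext.
have := key i _ (z i) IH; congr (B _); apply/funext => i'.
by rewrite /upd inE; case: eqP => [->|].
Qed.

Definition prod_complex : cube_complex R :=
  @CubeComplex R prod_space (I -> cc_cube X) prod_dim prod_char
    prod_cover prod_inj prod_glue prod_openE prod_finite_dim prod_connected.

Lemma prod_finitely_covered : finitely_covered X -> finitely_covered prod_complex.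
Proof.
move=> [J [K hK]]; exists {ffun I -> J}, (fun (f : {ffun I -> J}) (i : I) => K (f i)) => z.
have /choice[f hf] : forall i, exists j (x : 'rV[R]_(cc_dim (K j))), cube x /\ cc_char x = z i.
  by move=> i; exact: hK.
have /dep_choice[x hx] : forall i, exists (x : 'rV[R]_(cc_dim (K ([ffun i => f i] i)))),
    cube x /\ cc_char x = z i by move=> i; rewrite ffunE; exact: hf.
exists [ffun i => f i], (join x); split.
  by apply/cube_block => i; rewrite joinK; have [] := hx i.
by apply/funext => i; rewrite /= /prod_char joinK; have [] := hx i.
Qed.

Lemma coord_continuous i : continuous (fun z : prod_complex => z i).
Proof.
apply/continuousP => A /open_cubes oA; apply/prod_openE => k.
apply/open_cube_preimage => y cy Ay.
have [e e0 he] := oA (k i) (block y i) ((cube_block y).1 cy i) Ay.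
exists e => // y' /cube_block cy' /cnear_block yy'.
by apply: he.
Qed.

Lemma prod_star (z w : prod_complex) e : (forall i, star (z i) e (w i)) -> star z e w.
Proof.
move=> h.
have /choice[k /dep_choice[x /dep_choice[y hxy]]] : forall i, exists k (x y : 'rV[R]_(cc_dim k)),
  [/\ cube x, cube y, cc_char x = z i, cc_char y = w i & cnear e x y] by [].
exists k, (join x), (join y); split.
- by apply/cube_block => i; rewrite joinK; have [] := hxy i.
- by apply/cube_block => i; rewrite joinK; have [] := hxy i.
- by apply/funext => i; rewrite /= /prod_char joinK; have [] := hxy i.
- by apply/funext => i; rewrite /= /prod_char joinK; have [] := hxy i.
- by apply/cnear_block => i; rewrite !joinK; have [] := hxy i.
Qed.

Hypothesis Pbasis : star_basis prod_complex.

(** The weak topology could have too many open sets for this. [Pbasis] reduces neighbourhoods to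
    stars, and a star of the power contains the product of the stars of the coordinates
    ([prod_star]). *)
Lemma tuple_continuous (T : topologicalType) (A : set T) (u : T -> prod_complex) :
  (forall i, {within A, continuous (fun t => u t i)}) -> {within A, continuous u}.
Proof.
move=> cu; apply/subspace_continuousP => t At V /Pbasis[e e0 eV].
have h : \forall t' \near within A (nbhs t), forall i, star (u t i) e (u t' i).
  apply: filter_forall => i.
  have [e1 ge1] := good_radius_exists (u t i).
  have ge : good_radius (u t i) (Num.min e1 e).
    apply: (good_radius_le ge1); last by rewrite ge_min lexx.
    by rewrite lt_min e0 andbT; case: ge1 => /andP[].
  have /subspace_continuousP /(_ t At) cui := cu i.
  have n1 : \forall t' \near within A (nbhs t), star (u t i) (Num.min e1 e) (u t' i) := cui _ (star_nbhs ge).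
  by apply: filterS n1 => t'; apply: star_le; rewrite ge_min lexx orbT.
by apply: filterS h => t' /prod_star; exact: eV.
Qed.

Lemma tuple_path_continuous (x y : prod_complex) (p : forall i, cpath R (x i) (y i)) :
  {within `[0, 1], continuous (fun t : R => (fun i => p i t) : prod_complex)}.
Proof. by apply: tuple_continuous => i; exact: cpath_continuous. Qed.

Definition tuple_path (x y : prod_complex) (p : forall i, cpath R (x i) (y i)) : cpath R x y :=
  CPath (@tuple_path_continuous x y p) (funext (fun i => cpath0 (p i)))
    (funext (fun i => cpath1 (p i))).

Lemma homotopic_prod (x y : prod_complex) (p q : cpath R x y) :
  (forall i, homotopic (cpath_map (@coord_continuous i) p) (cpath_map (@coord_continuous i) q)) ->
  homotopic p q.
Proof.
move=> /dep_choice[F hF]; exists (fun z i => F i z); split.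
- by apply: tuple_continuous => i; have [] := hF i.
- move=> t t01; split; apply/funext => i; have [_ /(_ t t01)[]] := hF i => //.
- move=> s s01; split; apply/funext => i; have [_ _ /(_ s s01)[]] := hF i => //.
Qed.

End product_complex.

(** * Gluings of product faces split by factor *)

Section product_links.
Variables (R : realType) (I : finType) (X : cube_complex R).
Local Notation P := (prod_complex I X).

Section same_block.
Variables (k k' : I -> cc_cube X) (x : 'rV[R]_(prod_dim k)) (x' : 'rV[R]_(prod_dim k')).
Variables (S : {set 'I_(prod_dim k)}) (S' : {set 'I_(prod_dim k')}).
Variable h : 'rV[R]_(prod_dim k) -> 'rV[R]_(prod_dim k').
Hypotheses (cx : cube x) (cx' : cube x').
Hypothesis ih : isometry_onto (face x S) (face x' S') h.
Hypothesis hc : forall y, face x S y -> prod_char y = prod_char (h y).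

(* Moving along one coordinate of a block does not change the image of the
   other blocks, so by local injectivity it does not move their coordinates. *)
Lemma isometry_same_block i (j : 'I_(cc_dim (k i))) i' (j' : 'I_(cc_dim (k' i'))) :
  coord (d := fun i => cc_dim (k i)) j \in S ->
  coord (d := fun i => cc_dim (k' i)) j' \in S' ->
  coord_match x S h (coord j) (coord j') -> i = i'.
Proof.
set a := coord j; set a' := coord j' => aS aS' [e [e1 he]].
apply: contrapT => ii.
pose u (c : R) : 'rV[R]_(prod_dim k) := \row_b if b == a then c else x 0 b.
have fu c : `|c| <= 1 -> face x S (u c).
  move=> c1; split=> b; rewrite mxE; case: eqP => // -> /negP; by case.
have l0 : `|0 : R| <= 1 by rewrite normr0.
have l2 : `|1 / 2 : R| <= 1 by rewrite ger0_norm; lra.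
have f0 := fu _ l0; have f2 := fu _ l2.
have fh y : face x S y -> face x' S' (h y) by case: ih => <- _ fy; exists y.
have [c0 h0] := fh _ f0; have [c2 h2] := fh _ f2.
have bE : block (u 0) i' = block (u (1 / 2)) i'.
  apply/rowP => b; rewrite !mxE; case: eqP => // /coord_tag ii'; by case: ii.
have cE : cc_char (block (h (u 0)) i') = cc_char (block (h (u (1 / 2))) i') :> X.
  have := congr1 (fun z => z i') (hc f0); have := congr1 (fun z => z i') (hc f2).
  by rewrite /prod_char bE => -> ->.
have key b : b \in S' -> (`|h (u 0) 0 b| < 1 /\ `|h (u (1 / 2)) 0 b| < 1) \/
    h (u 0) 0 b = h (u (1 / 2)) 0 b.
  move=> bS; have [/(_ b bS)[b' b'S [e' [e'1 he']]] _] := isometry_coord cx cx' ih.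
  rewrite !he' // !mxE; case: eqP => _; last by right.
  by left; split; rewrite normrM e'1 mul1r ?normr0 ?ltr01 // ger0_norm; lra.
have key' b : (`|h (u 0) 0 b| < 1 /\ `|h (u (1 / 2)) 0 b| < 1) \/
    h (u 0) 0 b = h (u (1 / 2)) 0 b.
  by have [/key//|bS] := boolP (b \in S'); right; rewrite h0 // h2.
have bb : block (h (u 0)) i' = block (h (u (1 / 2))) i'.
  have cb0 := (cube_block _).1 c0 i'; have cb2 := (cube_block _).1 c2 i'.
  apply: cc_inj cE => //; apply/(supp_eqP cb0 cb2); split.
    apply/setP => b; rewrite !inE !mxE.
    by have [[-> ->]|->] := key' (coord b).
  move=> b; rewrite !inE !mxE; have [[-> _]//|->//] := key' (coord b).
have /rowP/(_ j') := bb; rewrite !mxE -/a' !he // !mxE eqxx mulr0 => /esym/eqP.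
by rewrite mulf_eq0 -normr_eq0 e1 oner_eq0 /= => /eqP; lra.
Qed.

Lemma isometry_block_local i y z : face x S y -> face x S z ->
  block y i = block z i -> block (h y) i = block (h z) i.
Proof.
move=> fy fz yz; apply/rowP => j'; rewrite !mxE.
have fh u : face x S u -> face x' S' (h u) by case: ih => <- _ fu; exists u.
have [jS|jS] := boolP (coord j' \in S'); last first.
  by rewrite (fh _ fy).2 // (fh _ fz).2.
have [/(_ _ jS)[a aS hm] _] := isometry_coord cx cx' ih.
move: a aS hm; elim/coord_ind => i1 j aS hm.
have ii : i1 = i := isometry_same_block aS jS hm; subst i1.
have [e [e1 he]] := hm; rewrite !he //.
by have /rowP/(_ j) := yz; rewrite !mxE => ->.
Qed.

Lemma isometry_block i : exists g,
  [/\ isometry_onto (face (block x i) (block_set S i)) (face (block x' i) (block_set S' i)) g,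
    (forall y, face x S y -> g (block y i) = block (h y) i) &
    forall v, face (block x i) (block_set S i) v -> cc_char v = cc_char (g v) :> X].
Proof.
pose r v : 'rV[R]_(prod_dim k) := join (@eqtype.dfwith _ (fun i => 'rV[R]_(cc_dim (k i))) (block x) i v).
have rE v : block (r v) i = v by rewrite joinK eqtype.dfwith_in.
have rN v i' : i != i' -> block (r v) i' = block x i'.
  by move=> ii; rewrite joinK eqtype.dfwith_out.
have fr v : face (block x i) (block_set S i) v -> face x S (r v).
  move=> fv; apply/face_block => i'; rewrite joinK.
  case: eqtype.dfwithP => // i1 _; apply: face_self.
  exact: ((cube_block x).1 cx).
have gE y : face x S y -> block (h (r (block y i))) i = block (h y) i.
  move=> fy; apply: (isometry_block_local (fr _ ((face_block x S y).1 fy i)) fy).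
  exact: rE.
have fh u : face x S u -> face x' S' (h u) by case: ih => <- _ fu; exists u.
exists (fun v => block (h (r v)) i); split.
- split.
    rewrite eqEsubset; split=> [_ [v fv <-]|v' fv'].
      exact: ((face_block x' S' _).1 (fh _ (fr _ fv))).
    pose w' : 'rV[R]_(prod_dim k') := join (@eqtype.dfwith _ (fun i => 'rV[R]_(cc_dim (k' i))) (block x') i v').
    have fw : face x' S' w'.
      apply/face_block => i'; rewrite joinK.
      case: eqtype.dfwithP => // i1 _; apply: face_self.
      exact: ((cube_block x').1 cx').
    move: fw; rewrite -(proj1 ih) => -[y fy hy].
    exists (block y i); first exact: ((face_block x S y).1 fy).
    by rewrite gE // hy joinK eqtype.dfwith_in.
  move=> v w fv fw; have [_ hd] := ih.
  have E (u : nat) (a b : 'rV[R]_u) : 0 <= edist a b by exact: sqrtr_ge0.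
  apply/eqP; rewrite -(eqrXn2 (n := 2)) //; apply/eqP.
  have := hd _ _ (fr _ fv) (fr _ fw); rewrite !edist_block.
  have only (d : I -> nat) (a b : 'rV[R]_(block_dim d)) :
      (forall i', i != i' -> block a i' = block b i') ->
      \sum_i' edist (block a i') (block b i') ^+ 2 = edist (block a i) (block b i) ^+ 2.
    move=> ab; rewrite (bigD1 i) //= big1 ?addr0 // => i' ii.
    rewrite ab; last by rewrite eq_sym.
    rewrite /edist big1; last by move=> j _; rewrite subrr expr0n.
    by rewrite sqrtr0 expr0n.
  rewrite !only.
  + by rewrite !sqrtr_sqr !ger0_norm // !rE => ->.
  + by move=> i' ii; rewrite !rN.
  + by move=> i' ii; apply: isometry_block_local; rewrite ?rN //; exact: fr.
- by move=> y fy; rewrite gE.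
- move=> v fv; have := congr1 (fun z => z i) (hc (fr _ fv)).
  by rewrite /prod_char rE.
Qed.

End same_block.

Definition corner_block_at (s : corner P) i : corner X :=
  @Corner R X (co_cube s i) (block (d := fun i => cc_dim (co_cube s i)) (co_pt s) i)
    (block_set (d := fun i => cc_dim (co_cube s i)) (co_dirs s) i).

Definition join_corner (cs : I -> corner X) : corner P :=
  @Corner R P (fun i => co_cube (cs i)) (join (fun i => co_pt (cs i)))
    [set a | tagged (enum_val a) \in co_dirs (cs (tag (enum_val a)))]%SET.

Lemma join_cornerK cs i : corner_block_at (join_corner cs) i = cs i.
Proof.
rewrite /corner_block_at /=.
have -> : block (d := fun i => cc_dim (co_cube (cs i))) (join (fun i => co_pt (cs i))) i = co_pt (cs i).
  exact: joinK.
have -> : block_set (d := fun i => cc_dim (co_cube (cs i)))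
    [set a | tagged (enum_val a) \in co_dirs (cs (tag (enum_val a)))]%SET i = co_dirs (cs i).
  by apply/setP => j; rewrite !inE /coord enum_rankK.
by case: (cs i).
Qed.

Lemma same_simplex_prod (s t : corner P) : cube (co_pt s) -> cube (co_pt t) ->
  same_simplex s t <-> forall i, same_simplex (corner_block_at s i) (corner_block_at t i).
Proof.
move=> cs ct; split=> [[h [ih hp hc]] i|/dep_choice[h hh]].
  have [g [ig gE gc]] := isometry_block cs ct ih hc i.
  exists g; split=> //=; rewrite gE ?hp //; exact: face_self.
exists (fun y => join (fun i => h i (block y i))); split.
- by apply: isometry_join => i; have [] := hh i.
- by apply: blockP => i; rewrite joinK; have [] := hh i.
- move=> y /face_block fy; apply/funext => i; rewrite /= /prod_char joinK.
  by have [_ _] := hh i; apply; exact: fy.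
Qed.

Lemma co_edge_block (s : corner P) i (j : 'I_(cc_dim (co_cube s i))) :
  corner_block_at (@co_edge _ _ s (coord (d := fun i => cc_dim (co_cube s i)) j)) i =
  @co_edge _ _ (corner_block_at s i) j.
Proof.
congr Corner; apply/setP => j'; rewrite !inE.
by apply/eqP/eqP => [/coord_inj//|->].
Qed.

Lemma co_edge_block_other (s : corner P) i (j : 'I_(cc_dim (co_cube s i))) i' : i' != i ->
  co_dirs (corner_block_at (@co_edge _ _ s (coord (d := fun i => cc_dim (co_cube s i)) j)) i') =
  finset.set0.
Proof.
move=> ii; apply/setP => j'; rewrite !inE.
by apply/eqP => /coord_tag ii'; rewrite ii' eqxx in ii.
Qed.

End product_links.

(** * Simplices of a link, empty ones allowed *)

Section simplices.
Variables (R : realType) (X : cube_complex R).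
Implicit Types s t : corner X.

(** [link_simplex] without a free direction being required: the link of a product is a join, and a
    simplex of a join may have empty components. *)
Definition corner_at (v : X) s := is_corner (co_pt s) /\ cc_char (co_pt s) = v.

Lemma link_simplexP (v : X) s : link_simplex v s <-> corner_at v s /\ co_dirs s != finset.set0.
Proof. by split=> [[]|[[]]]. Qed.

Lemma same_simplex_refl s : same_simplex s s.
Proof.
exists id; split=> //; split=> //; rewrite eqEsubset; split=> y; first by case=> z fz <-.
by move=> fy; exists y.
Qed.

Lemma same_simplex_empty v s t : corner_at v s -> corner_at v t ->
  co_dirs s = finset.set0 -> co_dirs t = finset.set0 -> same_simplex s t.
Proof.
move=> [cs sv] [ct tv] s0 t0.
have only u : cube (co_pt u) -> co_dirs u = finset.set0 -> @co_face _ X u = [set co_pt u].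
  move=> cu u0; rewrite /co_face u0 eqEsubset; split=> [y [_ h]|y ->]; last exact: face_self.
  by apply/rowP => i; rewrite h // inE.
have os := only s (corner_cube cs) s0; have ot := only t (corner_cube ct) t0.
exists (fun=> co_pt t); split=> //; rewrite ?os ?ot.
  split=> [|x y -> ->]; last first.
    by rewrite /edist !big1 // => i _; rewrite subrr expr0n.
  rewrite eqEsubset; split=> [_ [y _ <-]//|_ ->]; by exists (co_pt s).
by move=> y ->; rewrite sv tv.
Qed.

Lemma same_simplex_dirs0 s t : is_corner (co_pt s) -> is_corner (co_pt t) ->
  same_simplex s t -> co_dirs s = finset.set0 <-> co_dirs t = finset.set0.
Proof.
move=> /corner_cube cs /corner_cube ct [h [ih _ _]].
have [h1 h2] := isometry_coord cs ct ih.
split=> e0; apply/setP => i; rewrite inE; apply/negP => iS.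
  by have [j] := h1 i iS; rewrite e0 inE.
by have [j] := h2 i iS; rewrite e0 inE.
Qed.

Lemma has_vertex_dirs0 v s e : corner_at v s -> corner_at v e -> has_vertex s e ->
  co_dirs e != finset.set0 /\ co_dirs s != finset.set0.
Proof.
move=> [cs _] [ce _] [i iS h]; split; last by apply/finset.set0Pn; exists i.
apply/negP => /eqP /(same_simplex_dirs0 (t := co_edge i) ce cs h) /setP/(_ i).
by rewrite !inE eqxx.
Qed.

(** [link_flag] over a nonempty finite set of indices, as needed for those members of a family of
    vertices which belong to a given factor. *)
Lemma link_flag_set (v : X) (J : finType) (A : {set J}) (e : J -> corner X) :
  A != finset.set0 -> link_flag v ->
  (forall i, i \in A -> link_vertex v (e i)) ->
  (forall i j, i \in A -> j \in A -> i != j -> ~ same_simplex (e i) (e j) /\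
     exists s, [/\ link_simplex v s, has_vertex s (e i) & has_vertex s (e j)]) ->
  exists s, link_simplex v s /\
    forall e', link_vertex v e' ->
      (has_vertex s e' <-> exists2 i, i \in A & same_simplex e' (e i)).
Proof.
move=> A0 lf le adj.
have [n nA] : exists n, #|A| = n.+1.
  by exists #|A|.-1; rewrite prednK // card_gt0.
pose f (l : 'I_n.+1) := enum_val (cast_ord (esym nA) l).
have fA l : f l \in A by exact: enum_valP.
have [l|l l' ll|s [ls hs]] := lf n (e \o f).
- exact: le.
- apply: adj; rewrite ?fA //; apply: contra ll => /eqP /enum_val_inj /cast_ord_inj ->//.
exists s; split=> // e' le'; rewrite hs //; split=> [[l h]|[i iA h]].
  by exists (f l).
exists (cast_ord nA (enum_rank_in iA i)); rewrite /f /= cast_ordK enum_rankK_in //.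
Qed.

End simplices.

(** * Non-positive curvature of powers: links as joins *)

Section product_NPC.
Variables (R : realType) (I : finType) (X : cube_complex R).
Local Notation P := (prod_complex I X).
Local Notation at_ := (@corner_block_at R I X).

Lemma card_block_set (d : I -> nat) (S : {set 'I_(block_dim d)}) :
  #|S| = (\sum_i #|block_set S i|)%N.
Proof.
rewrite -sum1_card big_mkcond sum_coord; apply: eq_bigr => i _.
rewrite -sum1_card [RHS]big_mkcond; apply: eq_bigr => j _; by rewrite inE.
Qed.

Lemma corner_at_prod (v : P) s : corner_at v s <-> forall i, corner_at (v i) (at_ s i).
Proof.
split=> [[cs sv] i|h].
  by split; [exact: ((corner_block _).1 cs)|rewrite -sv].
split; first by apply/corner_block => i; have [] := h i.
by apply/funext => i; have [] := h i.
Qed.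

(** A vertex of a join belongs to exactly one component: the numbers of free directions of the
    blocks add up to 1. *)
Lemma vertex_block (v : P) e : link_vertex v e -> exists i,
  link_vertex (v i) (at_ e i) /\ forall i', i' != i -> co_dirs (at_ e i') = finset.set0.
Proof.
move=> [/link_simplexP[/corner_at_prod ce _]]; rewrite card_block_set => E.
have [i hi] : exists i, (0 < #|co_dirs (at_ e i)|)%N.
  apply: contrapT => h; move: E; rewrite big1 // => i _.
  by apply/eqP; rewrite -leqn0 leqNgt; apply/negP => hi; apply: h; exists i.
have aux a b : (0 < a)%N -> (a + b = 1)%N -> a = 1%N /\ b = 0%N.
  by case: a => [|[|a]] //= _ [].
exists i; move: E; rewrite (bigD1 i) //= -/(co_dirs (at_ e i)) => /(aux _ _ hi)[a1 b0].
split; first by split=> //; apply/link_simplexP; split=> //; rewrite -card_gt0.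
move=> i' ii; apply/eqP; rewrite -cards_eq0 -leqn0 -b0 (bigD1 i') //=.
exact: leq_addr.
Qed.

Lemma link_simplex_block (v : P) s i : link_simplex v s ->
  co_dirs (at_ s i) != finset.set0 -> link_simplex (v i) (at_ s i).
Proof. by move=> /link_simplexP[/corner_at_prod cs _] n0; apply/link_simplexP. Qed.

Lemma same_simplex_at (v : P) s t : corner_at v s -> corner_at v t ->
  same_simplex s t <-> forall i, same_simplex (at_ s i) (at_ t i).
Proof. by move=> [/corner_cube ? _] [/corner_cube ? _]; exact: same_simplex_prod. Qed.

Lemma has_vertex_prod (v : P) s e : corner_at v s -> corner_at v e ->
  has_vertex s e <-> exists i, has_vertex (at_ s i) (at_ e i) /\
    forall i', i' != i -> co_dirs (at_ e i') = finset.set0.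
Proof.
move=> cs ce; have /corner_at_prod csb := cs; have /corner_at_prod ceb := ce.
split=> [[a]|[i [[j jS h] e0]]].
  elim/coord_ind: a => i j jS h; exists i.
  have {}h := (@same_simplex_at v e (@co_edge _ _ s (coord j)) ce cs).1 h.
  split; first by exists j; [rewrite inE|have := h i; rewrite co_edge_block].
  move=> i' ii.
  have [c1 _] := ceb i'; have [c2 _] := csb i'.
  apply/(same_simplex_dirs0 c1 _ (h i')) => //.
  exact: co_edge_block_other.
exists (coord (d := fun i => cc_dim (co_cube s i)) j); first by move: jS; rewrite inE.
apply/(@same_simplex_at v e (@co_edge _ _ s (coord j)) ce cs) => i'.
have [->|ii] := eqVneq i' i; first by rewrite co_edge_block.
apply: (@same_simplex_empty _ _ (v i')); [exact: ceb|exact: csb|exact: e0|].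
exact: co_edge_block_other.
Qed.

(** The inclusion of the vertices of the link of factor [i] into the link of the product; [s] only
    supplies the corners in the other factors. *)
Definition insert_vertex (s : corner P) i (e0 : corner X) : corner P :=
  join_corner (fun i' => if i' == i then e0 else
    Corner (co_pt (at_ s i')) finset.set0).

Lemma insert_vertexE s i e0 i' : at_ (insert_vertex s i e0) i' =
  if i' == i then e0 else Corner (co_pt (at_ s i')) finset.set0.
Proof. exact: join_cornerK. Qed.

Lemma insert_vertexP (v : P) s i e0 : corner_at v s -> link_vertex (v i) e0 ->
  link_vertex v (insert_vertex s i e0).
Proof.
move=> /corner_at_prod cs [/link_simplexP[ce n0] c1].
have c1' : #|co_dirs (insert_vertex s i e0)| = 1%N.
  have cE i' : #|block_set (co_dirs (insert_vertex s i e0)) i'| = (i' == i : nat).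
    rewrite -[LHS]/(#|co_dirs (at_ (insert_vertex s i e0) i')|) insert_vertexE.
    by case: eqP => // _; exact: cards0.
  rewrite card_block_set (eq_bigr _ (fun i' _ => cE i')) (bigD1 i) //= eqxx.
  by rewrite big1 // => i' /negbTE ->.
split=> //; apply/link_simplexP; split; last by rewrite -card_gt0 c1'.
apply/corner_at_prod => i'; rewrite insert_vertexE; case: eqP => [->//|_]; exact: cs.
Qed.

Lemma has_insert_vertex (v : P) s t i e0 : corner_at v s -> corner_at v t ->
  link_vertex (v i) e0 -> has_vertex s (insert_vertex t i e0) <-> has_vertex (at_ s i) e0.
Proof.
move=> cs ct le0; have [/link_simplexP[ce _] _] := insert_vertexP ct le0.
rewrite (has_vertex_prod cs ce); split=> [[i' []]|h].
  rewrite insert_vertexE; case: eqP => [->//|_] h _.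
  have /corner_at_prod csb := cs; have /corner_at_prod ctb := ct.
  by have [/eqP] := has_vertex_dirs0 (csb i') (ctb i' : corner_at _ (Corner _ finset.set0)) h.
exists i; rewrite insert_vertexE eqxx; split=> // i' ii.
by rewrite insert_vertexE (negbTE ii).
Qed.

(** A join of flag simplicial complexes is one: simplices, their vertices and adjacency decompose by
    factor, where the hypothesis on [X] applies, while empty blocks at the same vertex are always
    identified ([same_simplex_empty]). *)
Lemma product_NPC : NPC X -> NPC P.
Proof.
move=> npc v [k [c [cc cv]]].
have vX i : is_vertex (v i).
  by exists (k i), (block c i); split; [exact: ((corner_block c).1 cc)|rewrite -cv].
have ls1 i := (npc _ (vX i)).1.1; have ls2 i := (npc _ (vX i)).1.2.
have lf i := (npc _ (vX i)).2.
split; first split.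
- move=> s ls a b; elim/coord_ind: a => i j; elim/coord_ind: b => i' j' jS j'S h.
  have [cs _] := (link_simplexP _ _).1 ls; have /corner_at_prod csb := cs.
  have {}h := (@same_simplex_at v (@co_edge _ _ s (coord j)) (@co_edge _ _ s (coord j')) cs cs).1 h.
  have ii : i = i'.
    apply/eqP/negPn/negP => ii; have := h i; rewrite co_edge_block => hi.
    have [c1 _] := csb i.
    have := (same_simplex_dirs0 (s := @co_edge _ _ (at_ s i) j)
      (t := at_ (@co_edge _ _ s (coord j')) i) c1 c1 hi).2 (co_edge_block_other j' ii).
    by move=> /setP/(_ j); rewrite !inE eqxx.
  subst i'; congr coord.
  have jSb : j \in co_dirs (at_ s i) by rewrite inE.
  apply: (ls1 i (at_ s i)) => //; last by have := h i; rewrite !co_edge_block.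
    by apply: (link_simplex_block ls); apply/finset.set0Pn; exists j.
  by rewrite inE.
- move=> s t ls lt hst.
  have [cs _] := (link_simplexP _ _).1 ls; have /corner_at_prod csb := cs.
  have [ct _] := (link_simplexP _ _).1 lt; have /corner_at_prod ctb := ct.
  have key i e0 : link_vertex (v i) e0 -> has_vertex (at_ s i) e0 <-> has_vertex (at_ t i) e0.
    move=> le0; rewrite -(has_insert_vertex cs cs le0) -(has_insert_vertex ct cs le0).
    exact/hst/insert_vertexP.
  have edge u i : corner_at (v i) (at_ u i) -> forall j, j \in co_dirs (at_ u i) ->
      link_vertex (v i) (@co_edge _ _ (at_ u i) j) /\ has_vertex (at_ u i) (@co_edge _ _ (at_ u i) j).
    move=> cu j jS; split; last by exists j => //; exact: same_simplex_refl.
    by split; rewrite ?cards1 //; apply/link_simplexP; split=> //; apply/finset.set0Pn; exists j; rewrite inE.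
  (* A free direction of one block gives a vertex of it, hence by [key] a vertex of the other, which
     is then nonempty too. *)
  have dirs0 i : (co_dirs (at_ s i) == finset.set0) = (co_dirs (at_ t i) == finset.set0).
    apply/idP/idP; apply: contraLR => /finset.set0Pn[j jS].
      have [l1 h1] := edge _ _ (ctb i) _ jS.
      by have [] := has_vertex_dirs0 (csb i) (proj1 ((link_simplexP _ _).1 l1.1)) ((key _ _ l1).2 h1).
    have [l1 h1] := edge _ _ (csb i) _ jS.
    by have [] := has_vertex_dirs0 (ctb i) (proj1 ((link_simplexP _ _).1 l1.1)) ((key _ _ l1).1 h1).
  apply/(same_simplex_at cs ct) => i.
  have [s0|s0] := boolP (co_dirs (at_ s i) == finset.set0).
    have t0 := s0; rewrite dirs0 in t0.
    by apply: (same_simplex_empty (csb i) (ctb i)); exact/eqP.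
  have t0 := s0; rewrite dirs0 in t0.
  by apply: (ls2 i); [exact: link_simplex_block|exact: link_simplex_block|exact: key].
- move=> n e le adj.
  have ce l : corner_at v (e l) by have [/link_simplexP[]] := le l.
  have ceb l i : corner_at (v i) (at_ (e l) i) by have /corner_at_prod := ce l; exact.
  have /choice[p hp] := fun l => vertex_block (le l).
  (* The vertices belonging to factor [i] span a simplex there by flagness; if there are none, the
     block is a corner with no free direction, which has no vertex. *)
  have /choice[t ht] : forall i, exists s, corner_at (v i) s /\
      forall e', link_vertex (v i) e' ->
      (has_vertex s e' <-> exists2 l, l \in [set l | p l == i]%SET & same_simplex e' (at_ (e l) i)).
    move=> i; have [A0|A0] := eqVneq [set l | p l == i]%SET finset.set0.
      exists (Corner (co_pt (at_ (e ord0) i)) finset.set0); split; first exact: ceb.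
      move=> e' [/link_simplexP[ce' _] _]; split=> [h|[l]]; last by rewrite A0 inE.
      have cE : corner_at (v i) (Corner (co_pt (at_ (e ord0) i)) finset.set0) by exact: ceb.
      by have [_ /eqP] := has_vertex_dirs0 cE ce' h.
    have [l|l l'|s [ls hs]] := @link_flag_set _ _ (v i) _ [set l | p l == i]%SET
        (fun l => at_ (e l) i) A0 (lf i).
    + by rewrite inE => /eqP <-; exact: (hp l).1.
    + rewrite !inE => /eqP pl /eqP pl' ll; have [nss [s [ls hl hl']]] := adj l l' ll.
      have [cs _] := (link_simplexP _ _).1 ls; have /corner_at_prod csb := cs.
      have at_i m : p m = i -> has_vertex s (e m) -> has_vertex (at_ s i) (at_ (e m) i).
        move=> pm /(has_vertex_prod cs (ce m))[i' [h _]].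
        have [->//|ii] := eqVneq i i'.
        have [/eqP[]] := has_vertex_dirs0 (csb i') (ceb m i') h.
        by apply: (hp m).2; rewrite pm eq_sym.
      split; last first.
        have h1 := at_i _ pl hl; have h2 := at_i _ pl' hl'.
        exists (at_ s i); split=> //; apply: (link_simplex_block ls).
        by have [] := has_vertex_dirs0 (csb i) (ceb l i) h1.
      move=> ss; apply: nss; apply/(same_simplex_at (ce l) (ce l')) => i'.
      have [->//|ii] := eqVneq i' i.
      apply: (same_simplex_empty (ceb l i') (ceb l' i')).
        by apply: (hp l).2; rewrite pl.
      by apply: (hp l').2; rewrite pl'.
    + by exists s; split=> //; have [] := (link_simplexP _ _).1 ls.
  have cs : corner_at v (join_corner t).
    by apply/corner_at_prod => i; rewrite join_cornerK; exact: (ht i).1.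
  have hv e' : link_vertex v e' ->
      has_vertex (join_corner t) e' <-> exists l, same_simplex e' (e l).
    move=> le'; have [ce' _] := (link_simplexP _ _).1 le'.1.
    have /corner_at_prod ceb' := ce'.
    rewrite (has_vertex_prod cs ce'); have [i [le'i e'0]] := vertex_block le'.
    split=> [[i1 [h1 h2]]|[l ss]].
      rewrite join_cornerK in h1.
      have ii : i1 = i.
        apply/eqP/negPn/negP => ii.
        have [/eqP[]] := has_vertex_dirs0 (ht i1).1 (ceb' i1) h1.
        exact: e'0.
      subst i1; have [l] := ((ht i).2 _ le'i).1 h1.
      rewrite inE => /eqP pl ss; exists l.
      apply/(same_simplex_at ce' (ce l)) => i'.
      have [->//|ii] := eqVneq i' i.
      apply: (same_simplex_empty (ceb' i') (ceb l i')); first exact: e'0.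
      by apply: (hp l).2; rewrite pl.
    exists i; split=> //; rewrite join_cornerK.
    have {}ss := (same_simplex_at ce' (ce l)).1 ss.
    apply/((ht i).2 _ le'i); exists l => //; rewrite inE eq_sym.
    apply/negPn/negP => ii.
    have [c1 _] := ceb' i; have [c2 _] := ceb l i.
    have := (same_simplex_dirs0 c1 c2 (ss i)).2 ((hp l).2 i ii).
    by have [/link_simplexP[_ /eqP]] := le'i.
  exists (join_corner t); split; last exact: hv.
  apply/link_simplexP; split=> //.
  have [ce0 _] := (link_simplexP _ _).1 (le ord0).1.
  have /(has_vertex_dirs0 cs ce0)[//] : has_vertex (join_corner t) (e ord0).
  by apply/(hv _ (le ord0)); exists ord0; exact: same_simplex_refl.
Qed.

End product_NPC.

(** * Permutations of the coordinates of a power *)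

Section reindex.
Variables (R : realType) (I : finType) (X : cube_complex R).
Local Notation P := (prod_complex I X).

Definition reindex_prod (s : I -> I) (z : P) : P := fun i => z (s i).

Lemma reindex_prod_cubical (s t : I -> I) : cancel s t -> cancel t s ->
  cubical (reindex_prod s).
Proof.
move=> sK tK k; pose k' i := k (s i).
pose h (x : 'rV[R]_(prod_dim k)) : 'rV[R]_(prod_dim k') := join (fun i => block x (s i)).
(* All coordinates of [0] are free, so its support is the whole cube [k']. *)
exists k', 0, h; split.
- by move=> i; rewrite mxE normr0.
- have free0 : free (0 : 'rV[R]_(prod_dim k')) = [set: _]%SET.
    by apply/setP => i; rewrite !inE mxE normr0 ltr01.
  rewrite /supp -!/(free _) free0; split.
    rewrite eqEsubset; split=> [_ [x /cube_block cx <-]|y [/cube_block cy _]].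
      by split=> [|i]; [apply/cube_block => i; rewrite joinK; exact: cx|rewrite inE].
    (* Block [i] of [y] lives in the cube [k (s i)], whereas the preimage needs a block in each
       [k i]. Packing a block with its index lets block [t i] be moved to index [i] along
       [s (t i) = i] without casts. *)
    pose F (i : I) : {i : I & 'rV[R]_(cc_dim (k i))} := existT _ (s i) (block y i).
    have /dep_choice[w hw] : forall i, exists v : 'rV[R]_(cc_dim (k i)), existT _ i v = F (t i).
      move=> i; suff : forall i', s (t i) = i' ->
          exists v : 'rV[R]_(cc_dim (k i')), existT _ i' v = F (t i) by apply.
      by move=> _ <-; exists (block y (t i)).
    have wE i : w (s i) = block y i.
      have E : existT (fun i => 'rV[R]_(cc_dim (k i))) (s i) (w (s i)) = F i by rewrite hw sK.
      by have := projT2_eq E; rewrite (Prop_irrelevance (projT1_eq E) erefl).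
    have hwy : h (join w) = y by apply: blockP => i; rewrite !joinK wE.
    exists (join w) => //; apply/cube_block => i; rewrite joinK -(tK i) wE; exact: cy.
  move=> x y _ _; rewrite !edist_block; congr Num.sqrt.
  rewrite [RHS](reindex s) /=; last by apply: onW_bij; exists t.
  by apply: eq_bigr => i _; rewrite !joinK.
- by move=> x _; apply/funext => i; rewrite /reindex_prod /= /prod_char joinK.
Qed.

End reindex.

(** * Realization *)

Section realization.
Variables (R : realType) (G : groupType) (X : cube_complex R) (x0 : X).
Variable theta : {multiplicative pi1 R x0 -> G}.
Hypotheses (theta_inj : injective theta) (theta_surj : forall c, exists u, theta u = c).
Variables (n : nat) (a : gaut G) (g : G).
Hypotheses (n_gt0 : (0 < n)%N) (aXn : forall c, (a ^+ n)%g c = (g * c * g^-1)%g).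
Hypothesis Xfin : finitely_covered X.

Local Notation Z := (prod_complex 'I_n X).
Let z0 : Z := fun=> x0.
Let i0 : 'I_n := Ordinal n_gt0.
Let Zbasis : star_basis Z := finitely_covered_star_basis (prod_finitely_covered 'I_n Xfin).

Lemma theta1 : theta 1%g = 1%g.
Proof. by apply: (mulgI (theta 1%g)); rewrite -gmulfM !mulg1. Qed.

Lemma thetaV u : theta u^-1%g = (theta u)^-1%g.
Proof. by apply: (mulgI (theta u)); rewrite -gmulfM !mulgV theta1. Qed.

Definition theta_at (i : 'I_n) (u : pi1 R z0) : G :=
  theta (pi1_map (@coord_continuous R 'I_n X i) u : pi1 R x0).

Lemma theta_atE i (l : cpath R z0 z0) :
  theta_at i (pi1_class l) =
  theta (pi1_class (cpath_map (@coord_continuous R 'I_n X i) l : cpath R x0 x0)).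
Proof. by rewrite /theta_at pi1_mapE. Qed.

Lemma theta_atM i u v : theta_at i (u * v)%g = (theta_at i u * theta_at i v)%g.
Proof. by rewrite /theta_at pi1_mapM; exact: gmulfM. Qed.

Lemma theta_at1 i : theta_at i 1%g = 1%g.
Proof. by apply: (mulgI (theta_at i 1%g)); rewrite -theta_atM !mulg1. Qed.

Lemma theta_atV i u : theta_at i u^-1%g = (theta_at i u)^-1%g.
Proof. by apply: (mulgI (theta_at i u)); rewrite -theta_atM !mulgV theta_at1. Qed.

Definition twisted (u : pi1 R z0) : Prop :=
  exists c, forall i : 'I_n, theta_at i u = (a ^+ i)%g c.

Lemma twisted1 : twisted 1%g.
Proof. by exists 1%g => i; rewrite theta_at1 gaut1. Qed.

Lemma twistedM u v : twisted u -> twisted v -> twisted (u * v)%g.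
Proof.
by move=> [c hc] [d hd]; exists (c * d)%g => i; rewrite theta_atM hc hd gautM.
Qed.

Lemma twistedV u : twisted u -> twisted u^-1%g.
Proof. by move=> [c hc]; exists c^-1%g => i; rewrite theta_atV hc gautV. Qed.

(* The graph of c |-> (c, a c, ..., a^(n-1) c) in pi1 of the n-fold product. *)
Definition twisted_subgroup : pi1_subgroup R z0 := Pi1Subgroup twisted1 twistedM twistedV.
Local Notation H := twisted_subgroup.
Local Notation Y := (cover_complex H Zbasis).

Lemma twistedE u : H u -> forall i : 'I_n, theta_at i u = (a ^+ i)%g (theta_at i0 u).
Proof. by move=> [c hc] i; rewrite !hc. Qed.

Lemma theta_at_inj u v : (forall i, theta_at i u = theta_at i v) -> u = v.
Proof.
elim/pi1_ind: u => p; elim/pi1_ind: v => q h; apply/pi1_classP.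
apply: (homotopic_prod Zbasis) => i.
by have := h i; rewrite !theta_atE => /theta_inj; exact: (@pi1_classP R X x0 _ _).1.
Qed.

Lemma theta_at_surj (c : 'I_n -> G) : exists u, forall i, theta_at i u = c i.
Proof.
have /choice[l hl] : forall i, exists l : cpath R x0 x0, theta (pi1_class l) = c i.
  by move=> i; have [u <-] := theta_surj (c i); elim/pi1_ind: u => l; exists l.
exists (pi1_class (tuple_path (x := z0) (y := z0) Zbasis l)) => i; rewrite theta_atE -hl.
by congr (theta _); apply/pi1_classP/homotopic_ext.
Qed.

(** At index 0 the exponent of [a] is 0, so on the twisted subgroup this coordinate recovers [c],
    and with it all the others. *)
Definition cover_theta (u : pi1 R (cover_base H Zbasis)) : G := theta_at i0 (cover_pi1 u).

Lemma cover_thetaM : {morph cover_theta : u v / (u * v)%g}.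
Proof. by move=> u v; rewrite /cover_theta /cover_pi1 pi1_mapM theta_atM. Qed.

HB.instance Definition _ := isMultiplicative.Build (pi1 R (cover_base H Zbasis)) G
  cover_theta cover_thetaM.

Lemma cover_theta_bij : bijective cover_theta.
Proof.
have inj : injective cover_theta.
  move=> u v uv; apply: (@cover_pi1_inj _ _ _ H Zbasis); apply: theta_at_inj => i.
  by rewrite (twistedE (cover_pi1_mem u)) (twistedE (cover_pi1_mem v)); congr (_ _); exact: uv.
have /choice[f hf] : forall c, exists u, cover_theta u = c.
  move=> c; have [w hw] := theta_at_surj (fun i => (a ^+ i)%g c).
  have [|u uw] := @cover_pi1_surj _ _ _ H Zbasis w; first by exists c.
  by exists u; rewrite /cover_theta uw hw.
by exists f => // u; apply: inj.
Qed.

Let shift : Z -> Z := @reindex_prod R 'I_n X (@ordS n).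
Let unshift : Z -> Z := @reindex_prod R 'I_n X (@ord_pred n).

Lemma shift_cubical : cubical shift.
Proof. exact: reindex_prod_cubical (@ordSK n) (@ord_predK n). Qed.

Lemma unshift_cubical : cubical unshift.
Proof. exact: reindex_prod_cubical (@ord_predK n) (@ordSK n). Qed.

(** Place [i] of the shifted tuple shows coordinate [ordS i]. Before the last place this is [i.+1]
    and a constant loop will do; at the last place the index wraps around to 0, and a loop of class
    [g] makes up for the difference between exponents 0 and [n]. *)
Lemma turn_exists : exists b : 'I_n -> cpath R x0 x0,
  forall i c, (theta (pi1_class (b i)) * (a ^+ ordS i) c * (theta (pi1_class (b i)))^-1)%g =
    (a ^+ i.+1)%g c.
Proof.
suff : forall i : 'I_n, exists b : cpath R x0 x0, forall c,
    (theta (pi1_class b) * (a ^+ ordS i) c * (theta (pi1_class b))^-1)%g = (a ^+ i.+1)%g c.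
  by move=> /choice[b hb]; exists b.
move=> i; have := ltn_ord i; rewrite leq_eqVlt => /orP[/eqP iE|iN].
  have [u hu] := theta_surj g; elim/pi1_ind: u hu => l hl; exists l => c.
  by rewrite hl /= iE modnn expg0 aXn.
exists (cpath_cst R x0) => c; have -> : pi1_class (cpath_cst R x0) = 1%g by [].
rewrite theta1 /= modn_small //.
by rewrite mul1g invg1 mulg1.
Qed.

Let turn : 'I_n -> cpath R x0 x0 := projT1 (cid turn_exists).
Let turn_val i : G := theta (pi1_class (turn i)).

Lemma turnE i c : (turn_val i * (a ^+ ordS i) c * (turn_val i)^-1)%g = (a ^+ i.+1)%g c.
Proof. exact: (projT2 (cid turn_exists)). Qed.

(** The shift fixes the constant tuple [z0], so this base path is really a loop, with [g] in its
    last coordinate. *)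
Let turn_path : cpath R z0 (shift z0) :=
  tuple_path (x := z0) (y := shift z0) Zbasis turn.
Let unturn_path : cpath R z0 (unshift z0) :=
  tuple_path (x := z0) (y := unshift z0) Zbasis (fun i => cpath_rev (turn (ord_pred i))).

Let shift_conj := conj_map (cubical_continuous shift_cubical) turn_path.
Let unshift_conj := conj_map (cubical_continuous unshift_cubical) unturn_path.

Lemma theta_conj (b l : cpath R x0 x0) :
  theta (pi1_class (cpath_cat b (cpath_cat l (cpath_rev b)))) =
  (theta (pi1_class b) * theta (pi1_class l) * (theta (pi1_class b))^-1)%g.
Proof. by rewrite !pi1_classM pi1_classV !gmulfM thetaV mulgA. Qed.

Lemma theta_at_shift_conj i l : theta_at i (pi1_class (shift_conj l)) =
  (turn_val i * theta_at (ordS i) (pi1_class l) * (turn_val i)^-1)%g.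
Proof.
rewrite !theta_atE -theta_conj.
congr (theta _); apply/pi1_classP/homotopic_ext => t _ /=.
by rewrite /cat_fun /=; case: (t <= 1 / 2) => //=; case: (2 * t - 1 <= 1 / 2).
Qed.

Lemma theta_at_unshift_conj i l : theta_at i (pi1_class (unshift_conj l)) =
  ((turn_val (ord_pred i))^-1 * theta_at (ord_pred i) (pi1_class l) * turn_val (ord_pred i))%g.
Proof.
rewrite !theta_atE -[X in (_ * X)%g]invgK /turn_val -thetaV -pi1_classV -theta_conj.
congr (theta _); apply/pi1_classP/homotopic_ext => t _ /=.
by rewrite /cat_fun /=; case: (t <= 1 / 2) => //=; case: (2 * t - 1 <= 1 / 2).
Qed.

(** Equivariance read on loops: the tuple of [c] becomes the tuple of [a c]. *)
Lemma shift_conj_twisted l : H (pi1_class l) -> H (pi1_class (shift_conj l)).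
Proof.
move=> [c hc]; exists (a c) => i.
by rewrite theta_at_shift_conj hc turnE expgSr.
Qed.

Lemma unshift_conj_twisted l : H (pi1_class l) -> H (pi1_class (unshift_conj l)).
Proof.
move=> [c hc]; exists (gaut_inv a c) => i.
have := turnE (ord_pred i) (gaut_inv a c); rewrite ord_predK expgSr /= gautKV.
by rewrite theta_at_unshift_conj hc => <-; rewrite !mulgA mulVg mul1g mulgVK.
Qed.

Let F : Y -> Y := lift_map (cubical_continuous shift_cubical) turn_path.
Let F' : Y -> Y := lift_map (cubical_continuous unshift_cubical) unturn_path.

Lemma twisted_trivial (l : cpath R z0 z0) (p : 'I_n -> cpath R x0 x0) :
  (forall i t, 0 <= t <= 1 -> l t i = p i t) ->
  (forall i, homotopic (p i) (cpath_cst R x0)) -> H (pi1_class l).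
Proof.
move=> lp hp; exists 1%g => i; rewrite gaut1 -theta1 theta_atE.
congr (theta _); apply/pi1_classP; apply: homotopic_trans (hp i).
by apply: homotopic_ext => t; exact: lp.
Qed.

Lemma F_cancel : cancel F F'.
Proof.
apply: lift_map_cancel; [exact: shift_conj_twisted|exact: unshift_conj_twisted| |].
  by move=> z; apply/funext => i; rewrite /unshift /shift /reindex_prod ord_predK.
move=> l hl; apply: (twisted_trivial (p := fun i =>
    cpath_cat (cpath_rev (turn (ord_pred i))) (turn (ord_pred i)))).
  by move=> i t t01; rewrite hl //= /cat_fun; case: ifP.
by move=> i; exact: homotopic_catVp.
Qed.

Lemma F'_cancel : cancel F' F.
Proof.
apply: lift_map_cancel; [exact: unshift_conj_twisted|exact: shift_conj_twisted| |].
  by move=> z; apply/funext => i; rewrite /unshift /shift /reindex_prod ordSK.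
move=> l hl; apply: (twisted_trivial (p := fun i =>
    cpath_cat (turn i) (cpath_rev (turn i)))).
  move=> i t t01; rewrite hl //= /cat_fun; case: ifP => // _.
  by rewrite /= /shift /reindex_prod /= ordSK.
by move=> i; exact: homotopic_catpV.
Qed.

Lemma F_cubical : cubical F.
Proof. exact: (lift_map_cubical shift_conj_twisted shift_cubical). Qed.

Lemma F'_cubical : cubical F'.
Proof. exact: (lift_map_cubical unshift_conj_twisted unshift_cubical). Qed.

Definition cover_shift : cube_automorphism Y :=
  CubeAutomorphism F_cancel F'_cancel (cubical_continuous F_cubical)
    (cubical_continuous F'_cubical) F_cubical F'_cubical.

(** Coordinate 0 of the conjugated loop comes from coordinate [ordS i0] of the loop, and [turnE] at
    [i0] rewrites it as [a] applied to coordinate 0, also for [n = 1], where the index wraps around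
    at once. *)
Lemma cover_shift_induces : induces cover_shift cover_theta (out_class a).
Proof.
have [gamma hg] := lift_map_pi1 shift_conj_twisted (@ca_continuous _ _ cover_shift).
exists gamma, a; split=> // l.
rewrite /cover_theta hg cover_pi1E theta_at_shift_conj.
have := cover_pi1_mem (pi1_class l); rewrite cover_pi1E => h.
by rewrite (twistedE h (ordS i0)) turnE.
Qed.

End realization.

Lemma out_classX (G : groupType) (a : gaut G) n :
  (out_class a ^+ n)%g = out_class (a ^+ n)%g.
Proof.
elim: n => [|n IH]; first by rewrite !expg0.
by rewrite !expgS IH -[LHS]/(out_mul _ _) out_mulE.
Qed.


Theorem proposition4p7 (R : realType) (G : groupType) (delta : R) :
  cubulated R G -> delta_hyperbolic G delta ->
  forall phi : Out G, (exists n : nat, (0 < n)%N /\ (phi ^+ n)%g = 1%g) ->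
  exists (Y : cube_complex R) (y0 : Y) (theta : {multiplicative pi1 R y0 -> G})
      (f : cube_automorphism Y),
    [/\ NPC Y, bijective theta & induces f theta phi].
Proof.
move=> [_ [X [npc cX [x0 [theta tbij]]]]] _; elim/out_ind => a [n [n0]].
rewrite out_classX => /out_classP[g ag].
have thetaS c : exists u, theta u = c.
  by have [f _ fK] := tbij; exists (f c).
have thetaI := bij_inj tbij.
have fin := compact_finitely_covered cX.
exists (cover_complex (twisted_subgroup theta n a)
  (finitely_covered_star_basis (prod_finitely_covered 'I_n fin))), (cover_base _ _).
exists (cover_theta n0 (Xfin := fin)), (cover_shift thetaS ag fin); split.
- exact/cover_NPC/product_NPC.
- exact: cover_theta_bij.
- exact: cover_shift_induces.
Qed.
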